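(* Let $H$ be a separable complex Hilbert space and let $T\in\mathcal{L}(H)$ be an essentially unitary $C_0$-contraction. Let $f\in\mathcal{A}(\mathbb{D})$. Then the following assertions are equivalent: (1) $f(T)$ is compact; (2) $f=0$ on $\sigma(T)\cap\mathbb{T}$.
   Context: $\mathbb{D}$ is the open unit disk, $\mathbb{T}$ the unit circle, $\mathcal{L}(H)$ the bounded operators on $H$, $\sigma(T)$ the spectrum of $T$. $H^\infty$ is the set of bounded holomorphic functions on $\mathbb{D}$. The disk algebra $\mathcal{A}(\mathbb{D})$ is the space of functions holomorphic in $\mathbb{D}$ and continuous on $\overline{\mathbb{D}}$. A contraction is an operator of norm at most $1$; it is completely nonunitary if it has no nonzero reducing subspace on which it acts as a unitary operator. A contraction $T$ on $H$ is a $C_0$-contraction if it is completely nonunitary and there is a nonzero $\theta\in H^\infty$ with $\theta(T)=0$, where $\theta(T)$ is defined by the Sz.-Nagy--Foias $H^\infty$ functional calculus. For $f\in\mathcal{A}(\mathbb{D})$, $f(T)$ is equivalently the operator-norm limit of $p_n(T)$ for any polynomials $p_n\to f$ uniformly on $\overline{\mathbb{D}}$. A contraction $T$ is essentially unitary if $I_H-T^*T$ is compact, where $I_H$ is the identity on $H$. *)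

(* Defs.v *)
From HB Require Import structures.
From mathcomp Require Import all_boot all_order all_algebra.
From mathcomp Require Import complex.
From mathcomp Require Import all_classical all_reals all_analysis.

Set Implicit Arguments.
Unset Strict Implicit.
Unset Printing Implicit Defensive.

Import Order.TTheory GRing.Theory Num.Theory.
Import numFieldNormedType.Exports.

Local Open Scope classical_set_scope.
Local Open Scope complex_scope.
Local Open Scope ring_scope.

(* The topology of the complex numbers lives on the regular module R[i]^o.
   As the norm of a normed R[i]-module, `|x| is an element of R[i]. *)

Section ComplexFunctions.
Context {R : realType}.
Implicit Type u : R[i]^o -> R[i]^o.

(* Functions on the disk are represented by total functions, and their values
   outside the disk are never used. [derivable u z 1] is differentiability in
   the complex sense, because the scalars are R[i]. *)
Definition holomorphic_disk u : Prop :=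
  forall z : R[i]^o, `|z| < 1 -> derivable u z 1.

Definition Hinfty u : Prop :=
  holomorphic_disk u /\
  exists M : R, forall z : R[i]^o, `|z| < 1 -> `|u z| <= M%:C.

Definition disk_algebra u : Prop :=
  holomorphic_disk u /\ {within [set z : R[i]^o | `|z| <= 1], continuous u}.

Definition unit_circle : set R[i]^o := [set z | `|z| = 1].

Definition taylor u (n : nat) : R[i] := derive1n n u 0 / n`!%:R.

End ComplexFunctions.

Definition separable_space (X : topologicalType) : Prop :=
  exists D : set X, countable D /\ dense D.

Section BoundedOperators.
Context {R : realType} {H : completeNormedModType R[i]}.

(* [continuous S] is boundedness of the linear map S. *)
Definition invertible_operator (A : H -> H) : Prop :=
  exists S : {linear H -> H}, [/\ continuous S, cancel A S & cancel S A].

Definition spectrum (T : H -> H) : set R[i]^o :=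
  [set z | ~ invertible_operator (fun x => T x - z *: x)].

Definition contraction (T : H -> H) : Prop := forall x, `|T x| <= `|x|.

Definition compact_operator (A : H -> H) : Prop :=
  precompact (A @` [set x | `|x| <= 1]).

Definition closed_subspace (M : set H) : Prop :=
  [/\ closed M, M 0 & forall (a : R[i]) x y, M x -> M y -> M (a *: x + y)].

(* u_r(T) for u_r(z) = u(rz): the sum of the c_n r^n T^n, where u(z) is the sum
   of the c_n z^n. For 0 <= r < 1 and T a contraction, it converges in norm. *)
Definition radial_calculus (T : H -> H) (u : R[i]^o -> R[i]^o) (r : R) (x : H)
    : H :=
  limn (series (fun n => (taylor u n * r%:C ^+ n) *: iter n T x)).

(* The Sz.-Nagy--Foias calculus: u(T) is the strong limit of u_r(T) as r tends
   to 1 from below. It exists for u in H^infty if T is completely nonunitary,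
   and for u in the disk algebra if T is any contraction. *)
Definition is_Hinfty_calculus (T : H -> H) (u : R[i]^o -> R[i]^o)
    (A : H -> H) : Prop :=
  forall x, radial_calculus T u r x @[r --> (1 : R)^'-] --> A x.

Definition Hinfty_calculus (T : H -> H) (u : R[i]^o -> R[i]^o) (x : H) : H :=
  lim (radial_calculus T u r x @[r --> (1 : R)^'-]).

End BoundedOperators.

Section HilbertSpaceOperators.
Context {R : realType} {H : completeNormedModType R[i]}.
Variable dot : {dot H for @Num.conj R[i]}.

(* [dot] is linear in its first argument. *)
Definition hilbert_norm : Prop := forall x : H, `|x| ^+ 2 = dot x x.

Definition orthocomplement (M : set H) : set H :=
  [set y | forall x, M x -> dot x y = 0].

(* By the Riesz representation theorem, for T bounded on a Hilbert space the
   vector selected here exists; it is unique because dot is definite. *)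
Definition adjoint (T : H -> H) (y : H) : H :=
  xget 0 [set z | forall x, dot (T x) y = dot x z].

Definition reducing (T : H -> H) (M : set H) : Prop :=
  [/\ closed_subspace M, T @` M `<=` M &
      T @` orthocomplement M `<=` orthocomplement M].

Definition unitary_on (T : H -> H) (M : set H) : Prop :=
  T @` M = M /\ forall x y, M x -> M y -> dot (T x) (T y) = dot x y.

Definition completely_nonunitary (T : H -> H) : Prop :=
  forall M, reducing T M -> unitary_on T M -> M = [set 0].

Definition C0_contraction (T : H -> H) : Prop :=
  [/\ contraction T, completely_nonunitary T &
      exists theta : R[i]^o -> R[i]^o,
        [/\ Hinfty theta, exists2 z : R[i]^o, `|z| < 1 & theta z != 0 &
            is_Hinfty_calculus T theta (fun=> 0)]].

Definition essentially_unitary (T : H -> H) : Prop :=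
  contraction T /\ compact_operator (fun x => x - adjoint T (T x)).

End HilbertSpaceOperators.

(* Main.v *)
(** Let [K = I - T^*T] and [D(x) = |x|^2 - |Tx|^2 = <Kx, x>]. For an [M]-th root of unity [w] put
[y_j = sum_k w^(jk) A^k x] with [A = rT], [r < 1]. Parseval's identity on [Z/M] for the semidefinite
form attached to [D_A], together with [|A^M x| -> 0], shows that [|x|^2] is essentially the mean of
[D_A(y_j)], and that [|p(A)x|^2] is the mean of [|p(w^-j)|^2 D_A(y_j)]. This gives von Neumann's
inequality.

If [f] vanishes on the unimodular spectrum then, by compactness of the circle, each root of unity
is either one where the polynomial [p] close to [f] is small, contributing at most [eta^2 |x|^2] in
total, or one where [T - w^-j] is bounded below by [kappa]. In the latter case
[y_j - w^j A y_j = x - A^M x] bounds [|y_j|] by [4|x|/kappa], so that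
[D_A(y_j) = <K y_j, y_j> + (1 - r^2)|T y_j|^2] is controlled by [|K y_j|] up to a small multiple of
[|x|^2]. Hence [p(T)] is small modulo finitely many compact operators [x |-> K y_j], and [f(T)] is
compact.

Conversely a unimodular point [z] of the spectrum is an approximate eigenvalue: [|x_n| = 1],
[T x_n - z x_n -> 0], hence [f(T) x_n - f(z) x_n -> 0]. If [f(T)] is compact and [f(z) <> 0],
a cluster point of [f(T) x_n] is an eigenvector of the contraction [T] for the unimodular [z], and
its span reduces [T] to a unitary operator.

That [f(T)] is a limit of polynomials in [T] requires the Taylor series of [f], obtained from
Goursat's bisection argument carried out in polar coordinates around an interior point. *)

Require Import Defs.
From HB Require Import structures.
From mathcomp Require Import all_boot all_order all_algebra.
From mathcomp Require Import complex.
From mathcomp Require Import all_classical all_reals all_analysis.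
From mathcomp Require Import cyclic separable cyclotomic.
From mathcomp Require Import ring lra.

Set Implicit Arguments.
Unset Strict Implicit.
Unset Printing Implicit Defensive.

Import Order.TTheory GRing.Theory Num.Theory.
Import numFieldNormedType.Exports.

Local Open Scope classical_set_scope.
Local Open Scope complex_scope.
Local Open Scope ring_scope.

(** The order of the choices shapes the main estimate. The polynomial [p] and the lower bound
    [kappa] come first, then [r], then the number [M] of roots of unity, which must be large in
    terms of [r] for [A^M x] to be negligible. The term [(1 - r^2) |T y_j|^2] must therefore be
    bounded independently of [M], which is what the resolvent identity achieves. The trivial bound
    [M |x|] on [|y_j|] is kept only as a factor of [|K y_j|], where it is harmless because [M] is
    fixed before the compactness of [K] is used. Finite Fourier sums take the place of the
    operator-valued Poisson integral, so that no vector is ever integrated. Scalar integrals enter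
    because the calculus is defined through iterated derivatives at 0, which have to be compared
    with Cauchy integrals to be estimated. *)

Lemma expr_small {R : realType} (r e : R) : 0 <= r < 1 -> 0 < e -> exists n, r ^+ n <= e.
Proof.
move=> /andP[r0 r1] e0.
have /cvgrPdist_le /(_ e e0) [n _ /(_ n (leqnn n))] : r ^+ n @[n --> \oo] --> (0 : R).
  by apply: cvg_expr; rewrite ger0_norm.
by rewrite /= sub0r normrN ger0_norm ?exprn_ge0 // => h; exists n.
Qed.

Lemma harmonic_small {R : realType} (e : R) : 0 < e ->
  exists N, forall n, (N <= n)%N -> n.+1%:R^-1 <= e.
Proof.
move=> e0; exists (Num.trunc e^-1) => n Nn.
rewrite -[e]invrK lef_pV2 ?posrE ?invr_gt0 //.
by apply: ltW; apply: lt_le_trans (truncnS_gt _) _; rewrite ler_nat.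
Qed.

Lemma bernoulli_le {R : realType} (r : R) n : 0 <= r <= 1 -> 1 - r ^+ n <= n%:R * (1 - r).
Proof.
move=> /andP[r0 r1]; elim: n => [|n IH]; first by rewrite expr0 subrr mul0r.
rewrite exprS -natr1 mulrDl mul1r.
have -> : 1 - r * r ^+ n = r * (1 - r ^+ n) + (1 - r) by ring.
rewrite lerD2r (le_trans _ IH) // ler_piMl // subr_ge0 exprn_ile1 //.
Qed.

Definition psum {K : pzRingType} (c : nat -> K) d z := \sum_(i < d) c i * z ^+ i.

(** * Real-valued norms *)

Section RealNorm.
Context {R : realType}.
Local Notation C := R[i].

(** The norm of a complex normed space lives in [R[i]], which is only partially ordered; real values
    give access to a total order and to [lra]. *)
Definition rnorm {V : normedZmodType C} (x : V) : R := complex.Re `|x|.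

Lemma rnormE (V : normedZmodType C) (x : V) : `|x| = (rnorm x)%:C.
Proof. by rewrite /rnorm RRe_real ?normr_real. Qed.

Section Zmod.
Variable V : normedZmodType C.
Implicit Types x y : V.

Lemma rnorm_ge0 x : 0 <= rnorm x.
Proof. by have := normr_ge0 x; rewrite rnormE ler0c. Qed.

Lemma rnorm0 : rnorm (0 : V) = 0.
Proof. by rewrite /rnorm normr0. Qed.

Lemma rnorm_eq0 x : (rnorm x == 0) = (x == 0).
Proof. by rewrite -(inj_eq (@complexI _)) -rnormE normr_eq0. Qed.

Lemma rnormD x y : rnorm (x + y) <= rnorm x + rnorm y.
Proof. by have := ler_normD x y; rewrite !rnormE -rmorphD lecR. Qed.

Lemma rnormN x : rnorm (- x) = rnorm x.
Proof. by rewrite /rnorm normrN. Qed.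

Lemma rnormB x y : rnorm (x - y) <= rnorm x + rnorm y.
Proof. by rewrite -(rnormN y) rnormD. Qed.

Lemma rnorm_distC x y : rnorm (x - y) = rnorm (y - x).
Proof. by rewrite /rnorm distrC. Qed.

Lemma rnorm_distD z x y : rnorm (x - y) <= rnorm (x - z) + rnorm (z - y).
Proof. by rewrite -[x - y](subrKA z) rnormD. Qed.

Lemma rnorm_subD x y : rnorm x <= rnorm (x - y) + rnorm y.
Proof. by rewrite -{1}[x](subrK y) rnormD. Qed.

Lemma rnorm_sum (I : Type) (r : seq I) (P : pred I) (F : I -> V) :
  rnorm (\sum_(i <- r | P i) F i) <= \sum_(i <- r | P i) rnorm (F i).
Proof.
elim/big_rec2: _ => [|i a b _ hab]; first by rewrite rnorm0.
by apply: le_trans (rnormD _ _) _; rewrite lerD2l.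
Qed.

End Zmod.

Implicit Types a b : C.

Lemma rnorm1 : rnorm (1 : C) = 1.
Proof. by rewrite /rnorm normr1. Qed.

Lemma rnormM a b : rnorm (a * b) = rnorm a * rnorm b.
Proof. by apply: (@complexI R); rewrite rmorphM -!rnormE normrM. Qed.

Lemma rnormX a n : rnorm (a ^+ n) = rnorm a ^+ n.
Proof. by apply: (@complexI R); rewrite rmorphXn -!rnormE normrX. Qed.

Lemma rnormV a : rnorm a^-1 = (rnorm a)^-1.
Proof. by apply: (@complexI R); rewrite fmorphV -!rnormE normfV. Qed.

Lemma rnormR (r : R) : rnorm r%:C = `|r|.
Proof. by apply: (@complexI R); rewrite -rnormE normc_def /= expr0n addr0 sqrtr_sqr. Qed.

Lemma rnorm_nat n : rnorm (n%:R : C) = n%:R.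
Proof. by rewrite -(rmorph_nat (real_complex R)) rnormR normr_nat. Qed.

Lemma rnormZ (V : normedModType C) a (x : V) : rnorm (a *: x) = rnorm a * rnorm x.
Proof. by have := normrZ a x; rewrite !rnormE -rmorphM => /complexI. Qed.

Lemma rnorm_conj a : rnorm a^* = rnorm a.
Proof. by apply: (@complexI R); rewrite -!rnormE normcJ. Qed.

Lemma conjE a : Num.conj a = a^*.
Proof.
have [->|a0] := eqVneq a 0; first by rewrite !rmorph0.
by apply: (mulfI a0); rewrite -normCK sqr_normc.
Qed.

Lemma rnormCK a : a * a^* = (rnorm a ^+ 2)%:C.
Proof. by rewrite -sqr_normc rnormE rmorphXn. Qed.

Lemma Re_le_rnorm a : complex.Re a <= rnorm a.
Proof.
rewrite (le_trans (ler_norm _)) //; have := normc_ge_Re a.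
by rewrite rnormE lecR.
Qed.

Lemma rnorm_le_ReIm a : rnorm a <= `|complex.Re a| + `|complex.Im a|.
Proof.
rewrite {1}[a]complexE; apply: le_trans (rnormD _ _) _.
rewrite rnormM !rnormR lerD2l ler_piMl //.
by rewrite /rnorm normc_def /= expr0n expr1n add0r sqrtr1.
Qed.

Lemma ReIm_le_rnorm a : `|complex.Re a| <= rnorm a /\ `|complex.Im a| <= rnorm a.
Proof.
split; first by have := normc_ge_Re a; rewrite rnormE lecR.
have := normc_ge_Re (a * 'i); rewrite rnormE lecR ReiNIm normrN rnormM.
suff -> : rnorm ('i : C) = 1 by rewrite mulr1.
by rewrite /rnorm normc_def /= expr0n expr1n add0r sqrtr1.
Qed.

End RealNorm.

Lemma geometric_cauchy {R : realType} {V : normedZmodType R[i]} (u : nat -> V) (D q : R) :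
  0 <= q < 1 -> 0 <= D ->
  (forall n, rnorm (u n.+1 - u n) <= D * q ^+ n) -> forall e : R, 0 < e ->
  exists N, forall m n, (N <= m)%N -> (N <= n)%N -> rnorm (u m - u n) <= e.
Proof.
move=> /andP[q0 q1] D0 hu e e0.
have q1' : 0 < 1 - q by rewrite subr_gt0.
(* The exact geometric sum is carried through the induction, so that its step is an identity. *)
have B n k : rnorm (u (n + k)%N - u n) <= D / (1 - q) * (q ^+ n - q ^+ (n + k)).
  elim: k => [|k IH]; first by rewrite addn0 !subrr rnorm0 mulr0.
  rewrite addnS; apply: le_trans (rnorm_distD (u (n + k)%N) _ _) _.
  have := hu (n + k)%N; move: IH; set a := rnorm _; set b := rnorm _ => ha hb.
  have -> : D / (1 - q) * (q ^+ n - q ^+ (n + k).+1) =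
     D / (1 - q) * (q ^+ n - q ^+ (n + k)) + D * q ^+ (n + k).
    by rewrite exprS; field; rewrite gt_eqF.
  by rewrite addrC lerD.
have [N hN] : exists N, q ^+ N <= e / 2 / (D / (1 - q) + 1).
  apply: expr_small; first by rewrite q0.
  by rewrite !divr_gt0 // ltr_wpDl // divr_ge0 // ltW.
have B2 n : (N <= n)%N -> rnorm (u n - u N) <= e / 2.
  move=> Nn; rewrite -(subnKC Nn); apply: le_trans (B _ _) _.
  rewrite ler_pdivlMr ?ltr_wpDl ?divr_ge0 ?(ltW q1') // in hN; apply: le_trans hN.
  rewrite mulrC; apply: ler_pM.
  - by rewrite subr_ge0 exprD ler_piMr ?exprn_ge0 // exprn_ile1 // ltW.
  - by rewrite divr_ge0 // ltW.
  - by rewrite gerBl exprn_ge0.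
  - by rewrite lerDl.
exists N => m n Nm Nn; apply: le_trans (rnorm_distD (u N) _ _) _.
by rewrite [e]splitr; apply: lerD; [apply: B2|rewrite rnorm_distC; apply: B2].
Qed.

(** * Von Neumann's inequality *)

Section Parseval.
Context {R : realType} {H : lmodType R[i]}.
Local Notation C := R[i].

(** [X^n - 1] splits with distinct roots, and among [n] distinct [n]-th roots of unity one is
    primitive. *)
Lemma prim_root_exists n : (0 < n)%N -> exists w : C, n.-primitive_root w.
Proof.
move=> n0; have [rs rsE] := closed_field_poly_normal ('X^n - 1 : {poly C}).
have sz : size ('X^n - 1 : {poly C}) = n.+1 by rewrite size_XnsubC.
move: rsE; rewrite (lead_coefDl); last first.
  by rewrite size_polyXn size_polyN size_polyC oner_eq0.
rewrite lead_coefXn scale1r => rsE.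
have srs : size rs = n by apply: succn_inj; rewrite -sz rsE size_prod_XsubC.
have urs : uniq rs.
  rewrite -separable_prod_XsubC -rsE.
  by rewrite separable_Xn_sub_1 // pnatr_eq0 -lt0n.
have ars : all n.-unity_root rs.
  by apply/allP => z zrs; rewrite /root_of_unity rsE root_prod_XsubC.
have := has_prim_root n0 ars urs; rewrite srs leqnn => /(_ isT) /hasP[w _ hw].
by exists w.
Qed.

Variables (M' : nat) (w : C).
Local Notation M := M'.+1.
Hypothesis hw : M.-primitive_root w.

Lemma prim_root_rnorm : rnorm w = 1.
Proof.
have : rnorm w ^+ M = 1 by rewrite -rnormX (prim_expr_order hw) rnorm1.
by move=> h; apply/eqP; rewrite -(@pexpr_eq1 _ _ M) ?rnorm_ge0 ?h.
Qed.

Lemma prim_root_conj : w * w^* = 1.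
Proof. by rewrite rnormCK prim_root_rnorm expr1n. Qed.

(** Orthogonality of the characters of [Z/M]: the summands are the powers of an [M]-th root of unity
    [z], and their sum vanishes unless [z = 1]. *)
Lemma sum_prim_root_expr (k l : 'I_M) :
  \sum_(j < M) (w ^+ (j * k)) * (w ^+ (j * l))^* = if k == l then M%:R else 0.
Proof.
have E (j : 'I_M) : (w ^+ (j * k)) * (w ^+ (j * l))^* = (w ^+ k * (w^*) ^+ l) ^+ j.
  by rewrite rmorphXn /= exprMn -!exprM ![(j * _)%N]mulnC.
rewrite (eq_bigr _ (fun j _ => E j)); set z := _ * _.
have [kl|kl] := eqVneq k l.
  rewrite /z kl -exprMn prim_root_conj expr1n (eq_bigr (fun _ => 1)).
    by rewrite sumr_const card_ord.
  by move=> j _; rewrite expr1n.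
have z1 : z != 1.
  apply: contraNneq kl => zE; apply/eqP/val_inj => /=.
  have : w ^+ k == w ^+ l.
    have := congr1 (fun t => t * w ^+ l) zE; rewrite /z mul1r -mulrA -exprMn.
    by rewrite [w^* * w]mulrC prim_root_conj expr1n mulr1 => ->.
  by rewrite (eq_prim_root_expr hw) !modn_small // => /eqP.
have zM : z ^+ M = 1.
  rewrite /z exprMn -!exprM ![(_ * M)%N]mulnC !exprM (prim_expr_order hw) expr1n.
  by rewrite -rmorphXn (prim_expr_order hw) rmorph1 expr1n mulr1.
have := subrX1 z M; rewrite zM subrr => /esym/eqP.
by rewrite mulf_eq0 subr_eq0 (negPf z1) => /eqP.
Qed.

(** A sesquilinear form that may be degenerate: it will be [dot x y - dot (A x) (A y)], whose
    quadratic form is the defect. *)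
Variable s : H -> H -> C.
Hypothesis sDl : forall x y z, s (x + y) z = s x z + s y z.
Hypothesis sDr : forall x y z, s x (y + z) = s x y + s x z.
Hypothesis sZl : forall a x y, s (a *: x) y = a * s x y.
Hypothesis sZr : forall a x y, s x (a *: y) = a^* * s x y.

Lemma sesqui_suml (I : finType) (F : I -> H) y : s (\sum_i F i) y = \sum_i s (F i) y.
Proof.
apply: (big_morph (s^~ y)) => [x z|]; first exact: sDl.
by rewrite -(scale0r 0) sZl mul0r.
Qed.

Lemma sesqui_sumr (I : finType) (F : I -> H) x : s x (\sum_i F i) = \sum_i s x (F i).
Proof.
apply: (big_morph (s x)) => [y z|]; first exact: sDr.
by rewrite -(scale0r 0) sZr rmorph0 mul0r.
Qed.

Definition dft (z : 'I_M -> H) (j : 'I_M) : H := \sum_(k < M) w ^+ (j * k) *: z k.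

Lemma parseval (z : 'I_M -> H) :
  \sum_(j < M) s (dft z j) (dft z j) = M%:R * \sum_(k < M) s (z k) (z k).
Proof.
under eq_bigr => j _.
  rewrite /dft sesqui_suml.
  under eq_bigr => k _ do rewrite sesqui_sumr.
  over.
rewrite exchange_big mulr_sumr; apply: eq_bigr => k _ /=.
rewrite exchange_big /= (bigD1 k) //= [X in _ + X]big1 ?addr0 => [|l lk].
  under eq_bigr => j _ do rewrite sZl sZr mulrA.
  by rewrite -mulr_suml sum_prim_root_expr eqxx.
under eq_bigr => j _ do rewrite sZl sZr mulrA.
by rewrite -mulr_suml sum_prim_root_expr eq_sym (negPf lk) mul0r.
Qed.

Lemma prim_root_expr_mod j n : w ^+ (j * (n %% M)) = w ^+ (j * n).
Proof. by rewrite mulnC exprM (prim_expr_mod hw) -exprM mulnC. Qed.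

(** The sum [k + i] is taken in ['I_M], hence modulo [M]; this is why convolutions of the orbit have
    to be cyclic. *)
Lemma dft_shift (z : 'I_M -> H) (i j : 'I_M) :
  dft (fun k => z (k + i)) j = (w ^+ (j * i))^-1 *: dft z j.
Proof.
rewrite /dft [in RHS](reindex_inj (addIr i)) scaler_sumr.
apply: eq_bigr => k _; rewrite scalerA; congr (_ *: _).
rewrite /= prim_root_expr_mod mulnDr exprD [X in _ = _ * X]mulrC mulKf //.
by rewrite expf_neq0 // (prim_root_eq0 hw).
Qed.

End Parseval.

Section LinearIterates.
Context {K : pzRingType} {V : lmodType K}.
Variable A : V -> V.
Hypothesis linA : linear A.

Lemma iter_linear n : linear (iter n A).
Proof. by elim: n => // n IH a x y; rewrite !iterS IH linA. Qed.

Lemma iter_sumZ n (I : finType) (c : I -> K) (F : I -> V) :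
  iter n A (\sum_i c i *: F i) = \sum_i c i *: iter n A (F i).
Proof.
have L := iter_linear n.
have A0 : iter n A 0 = 0.
  by have := L (-1) 0 0; rewrite scaler0 addr0 scaleN1r addNr.
elim/big_rec2: _ => // i y1 y2 _ <-; exact: L.
Qed.

(** The polynomial [psum c d] evaluated at the operator [A]. *)
Definition opsum (c : nat -> K) d x := \sum_(i < d) c i *: iter i A x.

Lemma opsum_iter c d n x : iter n A (opsum c d x) = opsum c d (iter n A x).
Proof.
by rewrite /opsum iter_sumZ; apply: eq_bigr => i _; rewrite -!iterD addnC.
Qed.

End LinearIterates.

Section DefectForm.
Context {R : realType} {H : completeNormedModType R[i]}.
Local Notation C := R[i].
Variable dot : {dot H for @Num.conj C}.
Hypothesis hn : hilbert_norm dot.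

Lemma dotDl x y z : dot (x + y) z = dot x z + dot y z.
Proof. exact: linearDl. Qed.

Lemma dotDr x y z : dot x (y + z) = dot x y + dot x z.
Proof. exact: linearDr. Qed.

Lemma dotZl a x y : dot (a *: x) y = a * dot x y.
Proof. exact: linearZl_LR. Qed.

Lemma dotZr a x y : dot x (a *: y) = a^* * dot x y.
Proof. by rewrite linearZr_LR /= conjE. Qed.

Lemma dotC x y : dot y x = (dot x y)^*.
Proof. by rewrite hermC /= expr0 mul1r. Qed.

Lemma dotNr x y : dot x (- y) = - dot x y.
Proof. by rewrite -scaleN1r dotZr rmorphN rmorph1 mulN1r. Qed.

Lemma dotxx x : dot x x = (rnorm x ^+ 2)%:C.
Proof. by rewrite -hn rnormE rmorphXn. Qed.

(** The quadratic form of [I - A^*A], written without the adjoint, whose existence is only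
    established later from the Riesz theorem. *)
Definition defect (A : H -> H) (x : H) : R := rnorm x ^+ 2 - rnorm (A x) ^+ 2.

Lemma contraction_rnorm (A : H -> H) : Defs.contraction A <-> forall x, rnorm (A x) <= rnorm x.
Proof.
by split=> h x; have := h x; rewrite /= ?rnormE lecR.
Qed.

Section Contraction.
Variable A : H -> H.
Hypothesis linA : linear A.
Hypothesis cA : forall x, rnorm (A x) <= rnorm x.

Lemma rnorm_iter n x : rnorm (iter n A x) <= rnorm x.
Proof. by elim: n => //= n; apply: le_trans. Qed.

Lemma defect_ge0 x : 0 <= defect A x.
Proof. by rewrite subr_ge0 lerXn2r ?nnegrE ?rnorm_ge0. Qed.

Let s x y := dot x y - dot (A x) (A y).
Let AD x y : A (x + y) = A x + A y.
Proof. by have := linA 1 x y; rewrite !scale1r. Qed.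
Let A0 : A 0 = 0.
Proof. by have := linA (-1) 0 0; rewrite scaler0 addr0 scaleN1r addNr. Qed.
Let AZ a x : A (a *: x) = a *: A x.
Proof. by have := linA a x 0; rewrite A0 !addr0. Qed.
Let sDl x y z : s (x + y) z = s x z + s y z.
Proof. by rewrite /s AD !dotDl opprD addrACA. Qed.
Let sDr x y z : s x (y + z) = s x y + s x z.
Proof. by rewrite /s AD !dotDr opprD addrACA. Qed.
Let sZl a x y : s (a *: x) y = a * s x y.
Proof. by rewrite /s AZ !dotZl mulrBr. Qed.
Let sZr a x y : s x (a *: y) = a^* * s x y.
Proof. by rewrite /s AZ !dotZr mulrBr. Qed.
Let sxx x : s x x = (defect A x)%:C.
Proof. by rewrite /s !dotxx -rmorphB. Qed.

Lemma defectZ a x : defect A (a *: x) = rnorm a ^+ 2 * defect A x.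
Proof. by rewrite /defect AZ !rnormZ !exprMn mulrBr. Qed.

Lemma sum_defect_iter n x :
  \sum_(k < n) defect A (iter k A x) = rnorm x ^+ 2 - rnorm (iter n A x) ^+ 2.
Proof.
elim: n => [|n IH]; first by rewrite big_ord0 subrr.
by rewrite big_ord_recr IH /defect /= addrA subrK.
Qed.

Section Dft.
Variables (M' : nat) (w : C).
Local Notation M := M'.+1.
Hypothesis hw : M.-primitive_root w.

Lemma parseval_defect (z : 'I_M -> H) :
  \sum_(j < M) defect A (dft w z j) = M%:R * \sum_(k < M) defect A (z k).
Proof.
have := parseval hw sDl sDr sZl sZr z.
under eq_bigr do rewrite sxx; under [X in _ * X]eq_bigr do rewrite sxx.
by rewrite -!rmorph_sum -(rmorph_nat (real_complex R)) -rmorphM => /complexI.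
Qed.

(* Cyclic convolution of the orbit by the coefficients [c] agrees with
   [opsum A c d] away from the last [d] indices, and [dft] diagonalizes it. *)
Lemma opsum_defect_le c d x : (d <= M)%N ->
  rnorm (opsum A c d x) ^+ 2 - rnorm (iter (M - d) A (opsum A c d x)) ^+ 2 <=
  M%:R^-1 * \sum_(j < M) rnorm (psum c d (w ^+ j)^-1) ^+ 2 *
                         defect A (dft w (fun k : 'I_M => iter k A x) j).
Proof.
move=> dM; set y := fun k : 'I_M => iter k A x.
pose z (k : 'I_M) := \sum_(i < d) c i *: y (k + inord i).
have zhat j : dft w z j = psum c d (w ^+ j)^-1 *: dft w y j.
  transitivity (\sum_(i < d) c i *: dft w (fun k => y (k + inord i)) j).
    rewrite /dft /z; under eq_bigr do rewrite scaler_sumr.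
    rewrite exchange_big; apply: eq_bigr => i _ /=.
    by rewrite scaler_sumr; apply: eq_bigr => k _; rewrite !scalerA mulrC.
  rewrite /psum scaler_suml; apply: eq_bigr => i _.
  rewrite (dft_shift hw) scalerA; congr (_ * _ *: _).
  by rewrite inordK ?(leq_trans (ltn_ord i)) // exprM exprVn.
have -> : \sum_(j < M) rnorm (psum c d (w ^+ j)^-1) ^+ 2 * defect A (dft w y j) =
          M%:R * \sum_(k < M) defect A (z k).
  by rewrite -parseval_defect; apply: eq_bigr => j _; rewrite zhat defectZ.
rewrite mulKf ?pnatr_eq0 // -sum_defect_iter.
(* The last [d] indices, where the convolution wraps around, are discarded because the defect is
   nonnegative; the sum over the others telescopes to the left-hand side. *)
have MdM : (M - d <= M)%N by rewrite leq_subr.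
rewrite (big_ord_widen M (fun k => defect A (iter k A (opsum A c d x))) MdM) /=.
rewrite big_mkcond; apply: ler_sum => k _; case: ifP => [kM|_]; last exact: defect_ge0.
suff -> : z k = iter k A (opsum A c d x) by [].
rewrite opsum_iter // /z /opsum; apply: eq_bigr => i _; rewrite /y -iterD.
congr (_ *: iter _ _ _); rewrite /= inordK ?(leq_trans (ltn_ord i)) //.
have kd : (k + d < M)%N by move: kM; rewrite ltn_subRL addnC.
have ki : (k + i < M)%N by apply: leq_ltn_trans kd; rewrite leq_add2l ltnW.
by rewrite modn_small // addnC.
Qed.

(** The total mass of the discrete Poisson kernel: by Parseval and telescoping the mean equals
    [|x|^2 - |A^M x|^2]. *)
Lemma sum_defect_dft_le x :
  M%:R^-1 * \sum_(j < M) defect A (dft w (fun k : 'I_M => iter k A x) j) <= rnorm x ^+ 2.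
Proof.
by rewrite parseval_defect mulKf ?pnatr_eq0 // sum_defect_iter gerBl sqr_ge0.
Qed.

(* The resolvent identity behind the discrete Poisson kernel. *)
Lemma dft_resolvent x (j : 'I_M) :
  let y := dft w (fun k : 'I_M => iter k A x) j in
  y - w ^+ j *: A y = x - iter M A x.
Proof.
rewrite /= /dft.
have -> : w ^+ j *: A (\sum_(k < M) w ^+ (j * k) *: iter k A x) =
          \sum_(k < M) w ^+ (j * k.+1) *: iter k.+1 A x.
  rewrite -[A _]/(iter 1 A _) iter_sumZ // scaler_sumr; apply: eq_bigr => k _.
  by rewrite scalerA -exprD mulnS.
rewrite -opprB -sumrB.
rewrite -(big_mkord xpredT (fun k => w ^+ (j * k.+1) *: iter k.+1 A x -
  w ^+ (j * k) *: iter k A x)).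
rewrite (@telescope_sumr _ 0 M (fun k => w ^+ (j * k) *: iter k A x)) // opprB.
by rewrite muln0 mulnC exprM (prim_expr_order hw) expr1n !scale1r.
Qed.

(** This bound grows with [M], so it can only multiply quantities that are made small after [M] is
    fixed. *)
Lemma rnorm_dft_iter_le x (j : 'I_M) :
  rnorm (dft w (fun k : 'I_M => iter k A x) j) <= M%:R * rnorm x.
Proof.
apply: le_trans (rnorm_sum _ _ _) _.
rewrite mulr_natl -[X in _ *+ X]card_ord -sumr_const; apply: ler_sum => k _.
by rewrite rnormZ rnormX (prim_root_rnorm hw) expr1n mul1r rnorm_iter.
Qed.

End Dft.

End Contraction.
End DefectForm.

Section VonNeumann.
Context {R : realType} {H : completeNormedModType R[i]}.
Local Notation C := R[i].
Variable dot : {dot H for @Num.conj C}.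
Hypothesis hn : hilbert_norm dot.
Variable A : H -> H.
Hypothesis linA : linear A.
Hypothesis cA : forall x, rnorm (A x) <= rnorm x.
Implicit Types (c : nat -> C) (d : nat).

(** For [a = r < 1] the iterates tend to zero in norm, which those of a mere contraction need not
    do. *)
Definition dilate (a : C) (x : H) : H := a *: A x.

Lemma dilate_linear a : linear (dilate a).
Proof. by move=> b x y; rewrite /dilate linA scalerDr !scalerA mulrC. Qed.

Lemma iter_dilate a n x : iter n (dilate a) x = a ^+ n *: iter n A x.
Proof.
have A0 : A 0 = 0 by have := linA (-1) 0 0; rewrite scaler0 addr0 scaleN1r addNr.
elim: n => [|n IH]; first by rewrite scale1r.
have E := linA (a ^+ n) (iter n A x) 0; rewrite A0 !addr0 in E.
by rewrite iterS IH /dilate E scalerA exprS.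
Qed.

Lemma opsum_dilate a c d x : opsum (dilate a) c d x = opsum A (fun i => c i * a ^+ i) d x.
Proof. by apply: eq_bigr => i _; rewrite iter_dilate scalerA. Qed.

Lemma dilate_contraction r : 0 <= r <= 1 -> forall x, rnorm (dilate r%:C x) <= rnorm x.
Proof.
move=> /andP[r0 r1] x; rewrite /dilate rnormZ rnormR ger0_norm //.
by rewrite (le_trans _ (cA x)) // ler_piMl // rnorm_ge0.
Qed.

Lemma rnorm_iter_dilate r n x : 0 <= r -> rnorm (iter n (dilate r%:C) x) <= r ^+ n * rnorm x.
Proof.
move=> r0; rewrite iter_dilate rnormZ rnormX rnormR ger0_norm //.
by rewrite ler_wpM2l ?exprn_ge0 // rnorm_iter.
Qed.

(** Each coefficient changes by the factor [1 - r^i], at most [i (1 - r)] by Bernoulli's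
    inequality. *)
Lemma opsum_dilate_dist r c d x : 0 <= r <= 1 ->
  rnorm (opsum A c d x - opsum (dilate r%:C) c d x) <=
  (1 - r) * (\sum_(i < d) rnorm (c i) * i%:R) * rnorm x.
Proof.
move=> /andP[r0 r1]; rewrite opsum_dilate -sumrB; apply: le_trans (rnorm_sum _ _ _) _.
rewrite mulr_sumr mulr_suml; apply: ler_sum => i _.
rewrite -scalerBl -{1}[c i]mulr1 -mulrBr rnormZ ler_pM ?rnorm_ge0 ?rnorm_iter //.
rewrite rnormM mulrCA ler_wpM2l ?rnorm_ge0 //.
rewrite -rmorphXn -(rmorph1 (real_complex R)) -rmorphB rnormR ger0_norm.
  by rewrite mulrC bernoulli_le ?r0.
by rewrite subr_ge0 exprn_ile1.
Qed.

Lemma vonNeumann_dilate r c d (B : R) : 0 <= r < 1 -> 0 <= B ->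
  (forall z : C, rnorm z = 1 -> rnorm (psum c d z) <= B) ->
  forall x, rnorm (opsum (dilate r%:C) c d x) <= B * rnorm x.
Proof.
move=> /andP[r0 r1] B0 hB x.
have r01 : 0 <= r <= 1 by rewrite r0 ltW.
set v := opsum _ _ _ _.
suff : rnorm v ^+ 2 <= (B * rnorm x) ^+ 2.
  by rewrite ler_sqr // nnegrE ?mulr_ge0 ?rnorm_ge0.
apply/ler_addgt0Pr => e e0.
have [n hn'] : exists n, (r ^+ 2) ^+ n <= e / (rnorm v ^+ 2 + 1).
  apply: expr_small; first by rewrite sqr_ge0 expr_lt1.
  by rewrite divr_gt0 // ltr_wpDl // sqr_ge0.
(* With [d + n + 1] roots of unity, [n + 1] iterations are left once the [d] wrapped indices are
   lost, and they make the tail at most [e]. *)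
have [w hw] := @prim_root_exists R (d + n).+1 isT.
have := @opsum_defect_le _ _ _ hn _ (dilate_linear _) (dilate_contraction r01) _ _ hw c d x.
rewrite leqW ?leq_addr // => /(_ isT); rewrite -/v subSn ?leq_addr // addKn => h1.
have h2 : rnorm (iter n.+1 (dilate r%:C) v) ^+ 2 <= e.
  apply: (@le_trans _ _ ((r ^+ n * rnorm v) ^+ 2)).
    rewrite lerXn2r ?nnegrE ?rnorm_ge0 ?mulr_ge0 ?exprn_ge0 ?rnorm_ge0 //.
    apply: le_trans (rnorm_iter_dilate _ _ r0) _.
    by rewrite ler_wpM2r ?rnorm_ge0 // exprS ler_piMl ?exprn_ge0 // ltW.
  rewrite exprMn -exprM mulnC exprM; move: hn'; rewrite ler_pdivlMr ?ltr_wpDl ?sqr_ge0 //.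
  by apply: le_trans; rewrite ler_wpM2l ?exprn_ge0 ?sqr_ge0 // lerDl.
rewrite lerBlDr in h1; apply: (le_trans h1); apply: lerD h2.
rewrite exprMn.
apply: (@le_trans _ _ (B ^+ 2 * ((d + n).+1%:R^-1 * \sum_(j < (d + n).+1)
    defect (dilate r%:C) (dft w (fun k : 'I_(d + n).+1 => iter k (dilate r%:C) x) j)))).
  rewrite mulrCA ler_wpM2l ?invr_ge0 // mulr_sumr; apply: ler_sum => j _.
  apply: ler_wpM2r; first exact/defect_ge0/dilate_contraction.
  rewrite lerXn2r ?nnegrE ?rnorm_ge0 //; apply: hB.
  by rewrite rnormV rnormX (prim_root_rnorm hw) expr1n invr1.
rewrite ler_wpM2l ?sqr_ge0 //.
exact: (sum_defect_dft_le hn (dilate_linear _) hw).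
Qed.

Lemma vonNeumann c d (B : R) : 0 <= B ->
  (forall z : C, rnorm z = 1 -> rnorm (psum c d z) <= B) ->
  forall x, rnorm (opsum A c d x) <= B * rnorm x.
Proof.
move=> B0 hB x; set D := (\sum_(i < d) rnorm (c i) * i%:R) * rnorm x.
have D0 : 0 <= D by rewrite mulr_ge0 ?rnorm_ge0 // sumr_ge0 // => i _; rewrite mulr_ge0 ?rnorm_ge0.
apply/ler_addgt0Pr => e e0.
have De : 0 < e / (D + e) <= 1.
  by rewrite divr_gt0 ?ltr_wpDl //= ler_pdivrMr ?ltr_wpDl // mul1r lerDr.
(* This [r] gives [(1 - r) D = e D / (D + e) <= e], while [r] stays in [[0, 1)]. *)
move: De => /andP[De0 De1]; pose r := 1 - e / (D + e).
have r01 : 0 <= r < 1 by rewrite /r subr_ge0 De1 gtrBl.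
apply: le_trans (rnorm_subD _ (opsum (dilate r%:C) c d x)) _.
rewrite addrC; apply: lerD; first exact: vonNeumann_dilate.
apply: le_trans (opsum_dilate_dist _ _ _ _) _; first by case/andP: r01 => -> /ltW ->.
rewrite -mulrA -/D /r opprB addrC subrK mulrAC ler_pdivrMr ?ltr_wpDl //.
by rewrite ler_pM2l // lerDl ltW.
Qed.

End VonNeumann.

(** * Polynomials of an essentially unitary contraction *)

Section EssentialBound.
Context {R : realType} {H : completeNormedModType R[i]}.
Local Notation C := R[i].
Variable dot : {dot H for @Num.conj C}.
Hypothesis hn : hilbert_norm dot.
(** [K] stands for [I - T^*T], and [hK] for the Cauchy-Schwarz bound of its quadratic form. *)
Variables (T K : H -> H).
Hypothesis linT : linear T.
Hypothesis cT : forall x, rnorm (T x) <= rnorm x.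
Hypothesis hK : forall y, defect T y <= rnorm (K y) * rnorm y.

(** The three terms on the right are the tail of the orbit, an error controlled by [eta] and [1 - r]
    with a constant free of [M'], and the part that compactness will absorb. *)
Lemma opsum_dilate_essential r c d (B eta kappa : R) M' w x :
  let A := dilate T r%:C in
  let y j := dft w (fun k : 'I_M'.+1 => iter k A x) j in
  0 <= r < 1 -> 0 <= B -> 0 <= eta -> 0 < kappa -> 1 - r <= kappa / 2 -> (d <= M'.+1)%N ->
  M'.+1.-primitive_root w ->
  (forall z : C, rnorm z = 1 -> rnorm (psum c d z) <= B) ->
  (forall z : C, rnorm z = 1 -> rnorm (psum c d z) <= eta \/
     forall x, kappa * rnorm x <= rnorm (T x - z *: x)) ->
  rnorm (opsum A c d x) ^+ 2 <=
  rnorm (iter (M'.+1 - d) A (opsum A c d x)) ^+ 2 +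
  (eta ^+ 2 + B ^+ 2 * (1 - r ^+ 2) * (4 / kappa) ^+ 2) * rnorm x ^+ 2 +
  B ^+ 2 * M'.+1%:R * rnorm x * \sum_(j < M'.+1) rnorm (K (y j)).
Proof.
move=> A y /andP[r0 r1] B0 eta0 k0 rk dM hw hB hgood.
have r01 : 0 <= r <= 1 by rewrite r0 ltW.
have cA := dilate_contraction cT r01.
have linA := dilate_linear linT r%:C.
have M0 : (0 : R) < M'.+1%:R by rewrite ltr0n.
have r2 : 0 <= 1 - r ^+ 2 by rewrite subr_ge0 exprn_ile1 // ltW.
rewrite -addrA -lerBlDl.
have h1 := opsum_defect_le hn linA cA hw c x dM.
apply: le_trans h1 _.
set E := B ^+ 2 * (1 - r ^+ 2) * (4 / kappa) ^+ 2.
apply: (@le_trans _ _ (M'.+1%:R^-1 * \sum_(j < M'.+1) (eta ^+ 2 * defect A (y j) +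
   (E * rnorm x ^+ 2 + B ^+ 2 * M'.+1%:R * rnorm x * rnorm (K (y j)))))).
  rewrite ler_wpM2l ?invr_ge0 ?ler0n //; apply: ler_sum => j _; rewrite -/(y j).
  have dy := defect_ge0 cA (y j).
  have nz : rnorm (w ^+ j)^-1 = 1.
    by rewrite rnormV rnormX (prim_root_rnorm hw) expr1n invr1.
  have B2 := sqr_ge0 B.
  have rx := rnorm_ge0 x.
  have E0 : 0 <= E by rewrite /E mulr_ge0 ?sqr_ge0 // mulr_ge0.
  have tE : 0 <= E * rnorm x ^+ 2 by rewrite mulr_ge0 ?sqr_ge0.
  have tK : 0 <= B ^+ 2 * M'.+1%:R * rnorm x * rnorm (K (y j)).
    by rewrite mulr_ge0 ?rnorm_ge0 // mulr_ge0 // mulr_ge0 // ler0n.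
  have [bad|good] := hgood _ nz.
    apply: ler_wpDr; first exact: addr_ge0.
    by rewrite ler_wpM2r // lerXn2r ?nnegrE ?rnorm_ge0.
  apply: ler_wpDl; first by rewrite mulr_ge0 ?sqr_ge0.
  (* Since [T y - w^-j y = - w^-j (y - w^j A y) + (1 - r) T y], the lower bound gives
     [kappa |y| <= 2 |x| + (kappa / 2) |y|], hence the constant [4 / kappa]. *)
  have yk : rnorm (y j) <= 4 / kappa * rnorm x.
    have e1 : rnorm (T (y j) - (w ^+ j)^-1 *: y j) <=
        rnorm (y j - w ^+ j *: A (y j)) + (1 - r) * rnorm (y j).
      have -> : T (y j) - (w ^+ j)^-1 *: y j =
          - (w ^+ j)^-1 *: (y j - w ^+ j *: A (y j)) + (1 - r)%:C *: T (y j).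
        have W0 : w ^+ j != 0 by rewrite expf_neq0 // (prim_root_eq0 hw).
        rewrite /A /dilate scalerBr !scaleNr scalerK // opprK -addrA -scalerDl.
        by rewrite -rmorphD addrC [r + _]addrC subrK rmorph1 scale1r.
      apply: le_trans (rnormD _ _) _; rewrite !rnormZ rnormN nz mul1r lerD2l rnormR.
      by rewrite ger0_norm ?subr_ge0 ?(ltW r1) // ler_wpM2l ?subr_ge0 ?(ltW r1).
    have e2 : rnorm (y j - w ^+ j *: A (y j)) <= 2 * rnorm x.
      rewrite (dft_resolvent linA hw); apply: le_trans (rnormB _ _) _.
      by rewrite mulrDl mul1r lerD2l rnorm_iter.
    have e3 := good (y j).
    have e4 : (1 - r) * rnorm (y j) <= kappa / 2 * rnorm (y j).
      by rewrite ler_wpM2r ?rnorm_ge0.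
    rewrite mulrAC ler_pdivlMr // mulrC.
    set a := rnorm (y j) in e1 e2 e3 e4 *; lra.
  have yM : rnorm (y j) <= M'.+1%:R * rnorm x by exact: rnorm_dft_iter_le.
  have -> : defect A (y j) = defect T (y j) + (1 - r ^+ 2) * rnorm (T (y j)) ^+ 2.
    rewrite /defect /A /dilate rnormZ rnormR ger0_norm // exprMn; ring.
  (* The factor [|y|] beside [|K y|] takes the crude bound with [M]; the term in [1 - r^2] takes the
     bound [yk], free of [M]. *)
  apply: (@le_trans _ _ (B ^+ 2 * (rnorm (K (y j)) * (M'.+1%:R * rnorm x) +
      (1 - r ^+ 2) * (4 / kappa * rnorm x) ^+ 2))).
    apply: ler_pM; rewrite ?sqr_ge0 //.
    - by rewrite addr_ge0 ?defect_ge0 // mulr_ge0 ?sqr_ge0.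
    - by rewrite lerXn2r ?nnegrE ?rnorm_ge0 // hB.
    apply: lerD.
      by apply: le_trans (hK _) _; rewrite ler_wpM2l ?rnorm_ge0.
    rewrite ler_wpM2l // lerXn2r ?nnegrE ?rnorm_ge0 ?mulr_ge0 ?invr_ge0 ?(ltW k0) //.
    exact: le_trans (cT _) yk.
  by rewrite le_eqVlt; apply/orP; left; apply/eqP; rewrite /E; ring.
rewrite big_split /= mulrDr -mulr_sumr mulrCA.
rewrite [X in _ + _ * X <= _]big_split /= big_const_ord iter_addr addr0 -mulr_sumr.
set S := \sum_(j < _) rnorm _.
have S0 : 0 <= S by apply: sumr_ge0 => j _; exact: rnorm_ge0.
rewrite mulrDl -!addrA; apply: lerD.
  by rewrite ler_wpM2l ?sqr_ge0 //; exact: (sum_defect_dft_le hn linA hw x).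
rewrite mulrDr -[X in _ * X]mulr_natl mulKf ?gt_eqF // lerD2l.
rewrite ler_piMl ?mulr_ge0 ?sqr_ge0 ?rnorm_ge0 ?(ltW M0) //.
by rewrite invf_le1 // ler1n.
Qed.

(** The maps [L j] are [x |-> y_j] for suitable [r] and [M]. They are linear and bounded, so
    [K \o L j] inherits compactness from [K]. *)
Lemma opsum_essential c d (B eta kappa e : R) :
  0 <= B -> 0 <= eta -> 0 < kappa -> 0 < e ->
  (forall z : C, rnorm z = 1 -> rnorm (psum c d z) <= B) ->
  (forall z : C, rnorm z = 1 -> rnorm (psum c d z) <= eta \/
     forall x, kappa * rnorm x <= rnorm (T x - z *: x)) ->
  exists n (L : 'I_n -> H -> H) (D : R),
  [/\ 0 < D, forall j, linear (L j), forall j x, rnorm (L j x) <= D * rnorm x &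
  forall x, rnorm (opsum T c d x) ^+ 2 <= (eta ^+ 2 + e) * rnorm x ^+ 2 +
    D * rnorm x * \sum_(j < n) rnorm (K (L j x))].
Proof.
move=> B0 eta0 k0 e0 hB hgood.
pose D0 := \sum_(i < d) rnorm (c i) * i%:R.
have D00 : 0 <= D0 by apply: sumr_ge0 => i _; rewrite mulr_ge0 ?rnorm_ge0.
have B2 := sqr_ge0 B.
have B21 : 0 <= 2 * B + 1 by rewrite addr_ge0 ?mulr_ge0.
(* [1 - r] will be [1 / X]. Each summand of [X] encodes one requirement on [1 - r] in the form
   [u * q <= 1]: [q1] for [1 - r <= kappa / 2], [2 * q2] for the dilation error, [D0] and [q3] for
   replacing [T] by [rT]. *)
pose q1 := 2 / kappa; pose q2 := B ^+ 2 * (4 / kappa) ^+ 2 * 3 / e.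
pose q3 := D0 * (2 * B + 1) * 3 / e; pose X := 1 + q1 + 2 * q2 + (D0 + q3).
have t1 : 0 <= q1 by rewrite divr_ge0 // ltW.
have t2 : 0 <= q2 by rewrite divr_ge0 ?(ltW e0) // mulr_ge0 // mulr_ge0 // sqr_ge0.
have t3 : 0 <= q3 by rewrite divr_ge0 ?(ltW e0) // mulr_ge0 // mulr_ge0.
have X1 : 1 <= X by rewrite /X; lra.
have X0 : 0 < X by apply: lt_le_trans X1.
pose u := X^-1.
have u0 : 0 < u by rewrite invr_gt0.
have u1 : u <= 1 by rewrite invf_le1.
have uX a : a <= X -> u * a <= 1 by move=> aX; rewrite mulrC ler_pdivrMr // mul1r.
pose r := 1 - u.
have r01 : 0 <= r < 1 by rewrite /r subr_ge0 u1 gtrBl.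
have ru : 1 - r = u by rewrite /r opprB addrC subrK.
have r2 : 1 - r ^+ 2 <= 2 * u.
  have : 0 <= u ^+ 2 by exact: sqr_ge0.
  rewrite /r => ?; nra.
have e30 : 0 <= e / 3 by rewrite divr_ge0 // ltW.
have e3n : e != 0 by rewrite gt_eqF.
have kn : kappa != 0 by rewrite gt_eqF.
have h1 : 1 - r <= kappa / 2.
  have -> : 1 - r = u * q1 * (kappa / 2) by rewrite ru /q1; field.
  by rewrite ler_piMl ?divr_ge0 ?(ltW k0) // uX // /X; lra.
have h2 : B ^+ 2 * (1 - r ^+ 2) * (4 / kappa) ^+ 2 <= e / 3.
  apply: (@le_trans _ _ (B ^+ 2 * (2 * u) * (4 / kappa) ^+ 2)).
    by rewrite ler_wpM2r ?sqr_ge0 // ler_wpM2l.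
  have -> : B ^+ 2 * (2 * u) * (4 / kappa) ^+ 2 = u * (2 * q2) * (e / 3).
    by rewrite /q2; field; rewrite e3n kn.
  by rewrite ler_piMl // uX // /X; lra.
have h3 : u * D0 <= 1 by apply: uX => //; rewrite /X; lra.
have h4 : u * D0 * (2 * B + 1) <= e / 3.
  have -> : u * D0 * (2 * B + 1) = u * q3 * (e / 3) by rewrite /q3; field.
  by rewrite ler_piMl // uX // /X; lra.
have r012 : 0 <= r ^+ 2 < 1 by case/andP: r01 => ? ?; rewrite sqr_ge0 expr_lt1.
(* Chosen after [r], so that the tail of the orbit costs at most [e / 3]. *)
have [n hn'] : exists n, (r ^+ 2) ^+ n <= e / 3 / (B ^+ 2 + 1).
  apply: expr_small; first by [].
  by rewrite !divr_gt0 // ltr_wpDl.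
have [w hw] := @prim_root_exists R (d + n).+1 isT.
set A := dilate T r%:C.
have linA := dilate_linear linT r%:C.
have r0 : 0 <= r by case/andP: r01.
have r01' : 0 <= r <= 1 by case/andP: r01 => -> /ltW ->.
exists (d + n).+1, (fun j x => dft w (fun k : 'I_(d + n).+1 => iter k A x) j).
(* One constant serves twice: it dominates the norms [M] of the [L j] and the factor [B^2 M] of the
   compact term. *)
exists ((B ^+ 2 + 1) * (d + n).+1%:R); split.
- by rewrite mulr_gt0 // ltr_wpDl.
- move=> j a x y; rewrite /dft scaler_sumr -big_split; apply: eq_bigr => k _ /=.
  by rewrite (iter_linear linA) scalerDr !scalerA mulrC.
- move=> j x; apply: le_trans (rnorm_dft_iter_le (dilate_contraction cT r01') hw x j) _.
  by rewrite ler_wpM2r ?rnorm_ge0 // ler_peMl // lerDr.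
move=> x; have rx := rnorm_ge0 x; have rx2 := sqr_ge0 (rnorm x).
set p := rnorm (opsum T c d x); set a := rnorm (opsum A c d x).
have pa : p <= a + u * D0 * rnorm x.
  apply: le_trans (rnorm_subD _ (opsum A c d x)) _; rewrite addrC lerD2l.
  have := opsum_dilate_dist linT cT c d x r01'; rewrite -/D0.
  by rewrite ru.
have aB : a <= B * rnorm x by exact: (vonNeumann_dilate hn linT cT).
have a0 : 0 <= a by exact: rnorm_ge0.
have p0 : 0 <= p by exact: rnorm_ge0.
have h5 : p ^+ 2 <= a ^+ 2 + e / 3 * rnorm x ^+ 2.
  have h51 : p ^+ 2 <= (a + u * D0 * rnorm x) ^+ 2.
    by rewrite lerXn2r ?nnegrE ?addr_ge0 ?mulr_ge0 // ltW.
  apply: (le_trans h51).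
  set v := u * D0 in h3 h4 *.
  have v0 : 0 <= v by rewrite mulr_ge0 // ltW.
  (* The square expands with [a <= B |x|] in the cross term and [v <= 1], hence [v^2 <= v], in the
     last one. *)
  have h52 : (a + v * rnorm x) ^+ 2 <= a ^+ 2 + (v * (2 * B + 1)) * rnorm x ^+ 2.
    have e1 : a * (v * rnorm x) <= B * rnorm x * (v * rnorm x).
      by rewrite ler_wpM2r // mulr_ge0.
    have e2 : v ^+ 2 * rnorm x ^+ 2 <= v * rnorm x ^+ 2.
      by rewrite ler_wpM2r // expr2 ler_piMl.
    have -> : (a + v * rnorm x) ^+ 2 = a ^+ 2 + 2 * (a * (v * rnorm x)) + v ^+ 2 * rnorm x ^+ 2 by ring.
    have -> : v * (2 * B + 1) * rnorm x ^+ 2 = 2 * (B * rnorm x * (v * rnorm x)) + v * rnorm x ^+ 2 by ring.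
    lra.
  by apply: (le_trans h52); rewrite lerD2l ler_wpM2r.
have dM : (d <= (d + n).+1)%N by rewrite leqW ?leq_addr.
have h6 := opsum_dilate_essential x r01 B0 eta0 k0 h1 dM hw hB hgood.
rewrite /= subSn ?leq_addr // addKn -/A -/a in h6.
set S := \sum_(j < _) _ in h6 *.
have S0 : 0 <= S by apply: sumr_ge0 => j _; exact: rnorm_ge0.
have h7 : rnorm (iter n.+1 A (opsum A c d x)) ^+ 2 <= e / 3 * rnorm x ^+ 2.
  apply: (@le_trans _ _ ((r ^+ n * (B * rnorm x)) ^+ 2)).
    rewrite lerXn2r ?nnegrE ?rnorm_ge0 ?mulr_ge0 ?exprn_ge0 //.
    apply: le_trans (rnorm_iter_dilate linT cT _ _ r0) _; rewrite -/a.
    rewrite ler_pM ?exprn_ge0 // exprS ler_piMl ?exprn_ge0 //.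
    by case/andP: r01' .
  have -> : (r ^+ n * (B * rnorm x)) ^+ 2 = (r ^+ 2) ^+ n * B ^+ 2 * rnorm x ^+ 2.
    by rewrite [in RHS]exprAC; ring.
  apply: ler_wpM2r => //; move: hn'; rewrite ler_pdivlMr ?ltr_wpDl //; apply: le_trans.
  by rewrite ler_wpM2l ?exprn_ge0 ?sqr_ge0 // lerDl.
apply: le_trans h5 _.
have h8 : B ^+ 2 * (d + n).+1%:R * rnorm x * S <= (B ^+ 2 + 1) * (d + n).+1%:R * rnorm x * S.
  by rewrite !ler_wpM2r // lerDl.
have h9 : (eta ^+ 2 + B ^+ 2 * (1 - r ^+ 2) * (4 / kappa) ^+ 2) * rnorm x ^+ 2 <=
   (eta ^+ 2 + e / 3) * rnorm x ^+ 2 by rewrite ler_wpM2r // lerD2l.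
have -> : (eta ^+ 2 + e) * rnorm x ^+ 2 = (eta ^+ 2 + e / 3) * rnorm x ^+ 2 + e / 3 * rnorm x ^+ 2 + e / 3 * rnorm x ^+ 2.
  by field.
lra.
Qed.

End EssentialBound.

(** * Hilbert spaces and compact operators *)

Section Hilbert.
Context {R : realType} {H : completeNormedModType R[i]}.
Local Notation C := R[i].
Variable dot : {dot H for @Num.conj C}.
Hypothesis hn : hilbert_norm dot.

Lemma rnorm_sqrD x y :
  rnorm (x + y) ^+ 2 = rnorm x ^+ 2 + rnorm y ^+ 2 + 2 * complex.Re (dot x y).
Proof.
have := dotxx hn (x + y); rewrite dotDl !dotDr !(dotxx hn) (dotC dot x y) => /esym E.
have := congr1 (@complex.Re R) E; rewrite /= => ->.
by case: (dot x y) => a b /=; ring.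
Qed.

Lemma cauchy_schwarz x y : rnorm (dot x y) <= rnorm x * rnorm y.
Proof.
have [->|y0] := eqVneq y 0.
  have -> : dot x 0 = 0 by rewrite -(scale0r 0) dotZr rmorph0 mul0r.
  by rewrite rnorm0 mulr_ge0 ?rnorm_ge0.
have ny : 0 < rnorm y by rewrite lt_neqAle rnorm_ge0 eq_sym rnorm_eq0 y0.
set h := dot x y; set a := rnorm x; set b := rnorm y in ny *.
(* The vector [|y|^2 x - <x, y> y] is [|y|^2] times the component of [x] orthogonal to [y]. *)
have := sqr_ge0 (rnorm ((b ^+ 2)%:C *: x + (- h) *: y)).
rewrite rnorm_sqrD !rnormZ rnormR rnormN dotZl dotZr -/h -/a -/b.
rewrite rmorphN mulNr mulrN [_ * h]mulrC rnormCK -rmorphM -rmorphN [complex.Re _]/=.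
rewrite ger0_norm ?sqr_ge0 // => E.
have {}E : 0 <= b ^+ 2 * ((a * b) ^+ 2 - rnorm h ^+ 2) by apply: le_trans E _; rewrite le_eqVlt; apply/orP; left; apply/eqP; ring.
rewrite pmulr_rge0 ?exprn_gt0 // subr_ge0 in E.
by rewrite -ler_sqr ?nnegrE ?rnorm_ge0 ?mulr_ge0 ?rnorm_ge0.
Qed.

Lemma dot_eq0 x : (forall y, dot y x = 0) -> x = 0.
Proof.
move=> /(_ x); rewrite (dotxx hn) => /complexI/eqP; rewrite sqrf_eq0 rnorm_eq0.
by move/eqP.
Qed.

Lemma parallelogram (x y : H) :
  rnorm (x - y) ^+ 2 = 2 * rnorm x ^+ 2 + 2 * rnorm y ^+ 2 - rnorm (x + y) ^+ 2.
Proof.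
by rewrite !rnorm_sqrD rnormN dotNr; case: (dot x y) => a b /=; ring.
Qed.

Lemma rnorm_cvgP (T : Type) (F : set_system T) (FF : Filter F) (f : T -> H) (y : H) :
  f x @[x --> F] --> y <-> forall e : R, 0 < e -> \forall x \near F, rnorm (y - f x) <= e.
Proof.
rewrite cvgrPdist_le; split=> h e e0.
  have := h e%:C; rewrite ltcR => /(_ e0); apply: filterS => x.
  by rewrite rnormE lecR.
have ee : e = (complex.Re e)%:C by rewrite RRe_real // gtr0_real.
rewrite ee ltcR in e0; have := h _ e0; apply: filterS => x.
by rewrite rnormE ee lecR.
Qed.

Lemma rnorm_cauchy_cvg (u : nat -> H) :
  (forall e : R, 0 < e -> exists N, forall m n, (N <= m)%N -> (N <= n)%N -> rnorm (u m - u n) <= e) ->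
  exists v, forall e : R, 0 < e -> exists N, forall n, (N <= n)%N -> rnorm (v - u n) <= e.
Proof.
move=> hu.
have cu : cvg (u @ \oo).
  apply/cauchy_cvgP/cauchy_exP => e e0.
  have ee : e = (complex.Re e)%:C by rewrite RRe_real // gtr0_real.
  rewrite ee ltcR in e0.
  have [|N hN] := hu (complex.Re e / 2); first by rewrite divr_gt0.
  exists (u N); exists N => // n /= Nn; rewrite -ball_normE /= rnormE ee ltcR.
  apply: le_lt_trans (hN _ _ _ Nn) _ => //.
  by rewrite ltr_pdivrMr // ltr_pMr // ltr1n.
exists (lim (u @ \oo)) => e e0.
by have /rnorm_cvgP /(_ e e0) [N _ hN] := cu; exists N.
Qed.

Section Riesz.
Variable g : H -> C.
Hypothesis gD : forall x y, g (x + y) = g x + g y.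
Hypothesis gZ : forall a x, g (a *: x) = a * g x.

(** If [z] represents [g], then [phi v = |v - z|^2 - |z|^2]; the Riesz vector is therefore sought as
    the minimizer of [phi]. *)
Let phi v := rnorm v ^+ 2 - 2 * complex.Re (g v).

(** Moving [v] by [- h^* *: x], where [h = dot x v - g x] and [|x| <= 1], lowers [phi] by at least
    [|h|^2], and near the infimum at most [d] can be gained. *)
Let near_min m d v x : (forall w, m <= phi w) -> phi v <= m + d -> rnorm x <= 1 ->
  rnorm (dot x v - g x) ^+ 2 <= d.
Proof.
move=> hm hv x1; set h := dot x v - g x.
have := hm (v + - h^* *: x); rewrite /phi rnorm_sqrD gD gZ dotZr rnormZ rnormN rnorm_conj.
move: hv; rewrite /phi => hv hv'.
have E : complex.Re (h * (dot x v)^*) = rnorm h ^+ 2 + complex.Re (h^* * g x).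
  have e1 : dot x v = h + g x by rewrite /h subrK.
  have := rnormCK h; rewrite e1; move: (rnorm h ^+ 2).
  move=> r hr; rewrite rmorphD mulrDr hr.
  by case: (h) (g x) => [a b] [c e] /=; ring.
have e2 : complex.Re (dot v (- h^* *: x)) = - (rnorm h ^+ 2 + complex.Re (h^* * g x)).
  rewrite dotZr (dotC dot x v) -E rmorphN /= .
  have : (h^*)^* = h by exact: conjcK.
  by move=> ->; case: (h) (dot x v) => [a b] [c e] /=; ring.
have e3 : complex.Re (- h^* * g x) = - complex.Re (h^* * g x).
  by case: (h^*) (g x) => [a b] [c e] /=; ring.
have x2 : rnorm x ^+ 2 <= 1 by rewrite expr_le1 ?rnorm_ge0.
have e4 : rnorm h ^+ 2 * rnorm x ^+ 2 <= rnorm h ^+ 2 by rewrite ler_piMr ?sqr_ge0.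
rewrite dotZr in e2.
move: hv'; rewrite e2 [complex.Re (g v + _)]raddfD /= e3 exprMn.
move: hv e4; move: (rnorm h ^+ 2 * rnorm x ^+ 2) (rnorm h ^+ 2) => p q.
move: (complex.Re (h^* * g x)) (complex.Re (g v)) (rnorm v ^+ 2) => *; lra.
Qed.

Lemma riesz (M : R) : (forall x, rnorm (g x) <= M * rnorm x) ->
  exists z, forall x, g x = dot x z.
Proof.
move=> gM.
(* Completing the square [(|v| - M)^2]. *)
have lb v : - M ^+ 2 <= phi v.
  have h1 : complex.Re (g v) <= M * rnorm v by apply: le_trans (gM v); exact: Re_le_rnorm.
  have := sqr_ge0 (rnorm v - M); rewrite /phi; set a := rnorm v in h1 *; nra.
pose S := [set phi v | v in setT].
have Si : has_inf S.
  by split; [exists (phi 0), 0 | exists (- M ^+ 2) => _ [v _ <-]].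
pose m := inf S.
have hm v : m <= phi v by apply: ge_inf; [case: Si | exists v].
have ex n : exists v, phi v <= m + n.+1%:R^-1.
  have [|_ [v _ <-] hv] := @inf_adherent _ S n.+1%:R^-1 _ Si; first by rewrite invr_gt0.
  by exists v; apply: ltW.
have [u hu] := choice ex.
have [v hv] : exists v, forall e : R, 0 < e -> exists N, forall n, (N <= n)%N -> rnorm (v - u n) <= e.
  apply: rnorm_cauchy_cvg => e e0.
  (* Comparing [phi] at the midpoint with the infimum gives [|u_k - u_l|^2 <= 2 (d_k + d_l)], where
     [d_k] is the excess allowed to [u_k]; excesses of [e^2 / 4] suffice. *)
  have [|N hN] := @harmonic_small _ (e ^+ 2 / 4); first by rewrite divr_gt0 // exprn_gt0.
  exists N => k l kN lN.
  rewrite -ler_sqr ?nnegrE ?rnorm_ge0 ?(ltW e0) // parallelogram.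
  have := hm ((2^-1)%:C *: (u k + u l)); rewrite /phi rnormZ gZ gD rnormR ger0_norm ?invr_ge0 //.
  have -> : complex.Re ((2^-1)%:C * (g (u k) + g (u l))) = (complex.Re (g (u k)) + complex.Re (g (u l))) / 2.
    by case: (g (u k)) (g (u l)) => [a b] [c d] /=; ring.
  have := hu k; have := hu l; rewrite /phi; have := hN _ kN; have := hN _ lN.
  rewrite exprMn (_ : 2^-1 ^+ 2 = 4^-1 :> R); last by field.
  move: (k.+1%:R^-1) (l.+1%:R^-1) (e ^+ 2) (complex.Re (g (u k))) (complex.Re (g (u l))) => dk dl E gk gl.
  set a := rnorm (u k) ^+ 2; set b := rnorm (u l) ^+ 2; set c := rnorm (_ + _) ^+ 2.
  move=> *; lra.
exists v.
(* The estimate [near_min] needs [|x| <= 1]; other vectors are reached afterwards by scaling. *)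
have U x : rnorm x <= 1 -> g x = dot x v.
  move=> x1; apply/eqP; rewrite eq_sym -subr_eq0 -rnorm_eq0 eq_le rnorm_ge0 andbT.
  apply/ler_addgt0Pr => e e0; rewrite add0r.
  have [|N hN] := hv (e / 2); first by rewrite divr_gt0.
  have [|N' hN'] := @harmonic_small _ ((e / 2) ^+ 2); first by rewrite exprn_gt0 // divr_gt0.
  pose n := maxn N N'.
  have -> : dot x v - g x = dot x (v - u n) + (dot x (u n) - g x).
    by rewrite dotDr dotNr addrA subrK.
  apply: le_trans (rnormD _ _) _; rewrite [e]splitr; apply: lerD.
    apply: le_trans (cauchy_schwarz _ _) _.
    by rewrite -[e / 2]mul1r ler_pM ?rnorm_ge0 // hN // leq_maxl.
  rewrite -ler_sqr ?nnegrE ?rnorm_ge0 ?divr_ge0 ?(ltW e0) //.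
  apply: le_trans (near_min hm (hu n) x1) _; apply: hN'; exact: leq_maxr.
move=> x; have [->|x0] := eqVneq x 0.
  by apply: U; rewrite rnorm0.
have nx : 0 < rnorm x by rewrite lt_neqAle rnorm_ge0 eq_sym rnorm_eq0 x0.
have := U ((rnorm x)^-1%:C *: x); rewrite rnormZ rnormR gtr0_norm ?invr_gt0 // mulVf ?gt_eqF //.
move=> /(_ (lexx _)); rewrite gZ dotZl => /mulfI -> //.
by rewrite -(rmorph0 (real_complex R)) (inj_eq (@complexI R)) gt_eqF ?invr_gt0.
Qed.

End Riesz.

Section Adjoint.
Variable T : H -> H.
Hypothesis linT : linear T.
Hypothesis cT : forall x, rnorm (T x) <= rnorm x.

Let TD x y : T (x + y) = T x + T y.
Proof. by have := linT 1 x y; rewrite !scale1r. Qed.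
Let TZ a x : T (a *: x) = a *: T x.
Proof.
have A0 : T 0 = 0 by have := linT (-1) 0 0; rewrite scaler0 addr0 scaleN1r addNr.
by have := linT a x 0; rewrite A0 !addr0.
Qed.

Lemma adjointP y x : dot (T x) y = dot x (adjoint dot T y).
Proof.
rewrite /adjoint; case: xgetP => [z _ /= -> //|h].
(* A representing vector exists, so the default value 0 of [xget] in [adjoint] is ruled out. *)
have [z hz] : exists z, forall x, dot (T x) y = dot x z.
  apply: (@riesz _ _ _ (rnorm y)) => [a b|a b|a]; rewrite ?TD ?TZ ?dotDl ?dotZl //.
  by apply: le_trans (cauchy_schwarz _ _) _; rewrite mulrC ler_wpM2l ?rnorm_ge0.
by have := h z hz.
Qed.

Definition defect_operator x := x - adjoint dot T (T x).

Lemma defect_operatorP x y : dot y (defect_operator x) = dot y x - dot (T y) (T x).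
Proof. by rewrite dotDr dotNr -adjointP. Qed.

Lemma defect_operator_linear : linear defect_operator.
Proof.
move=> a x y; apply/eqP; rewrite -subr_eq0; apply/eqP/dot_eq0 => z.
have E b u v : dot z (b *: u + v) = b^* * dot z u + dot z v by rewrite dotDr dotZr.
rewrite dotDr dotNr E !defect_operatorP TD TZ E dotDr dotZr.
by ring.
Qed.

Lemma defect_le_operator x : defect T x <= rnorm (defect_operator x) * rnorm x.
Proof.
have -> : defect T x = complex.Re (dot x (defect_operator x)).
  by rewrite defect_operatorP !(dotxx hn).
by apply: le_trans (Re_le_rnorm _) _; rewrite mulrC cauchy_schwarz.
Qed.

(* Cauchy-Schwarz for the semidefinite form x, y |-> <x, y> - <Tx, Ty>. *)
Lemma isometric_vector x y : rnorm (T x) = rnorm x -> dot (T x) (T y) = dot x y.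
Proof.
move=> hx; set s := dot x y - dot (T x) (T y).
suff : s = 0 by move/eqP; rewrite subr_eq0 => /eqP ->.
apply/eqP; rewrite -rnorm_eq0; apply/negPn/negP => s0.
have s2 : 0 < rnorm s ^+ 2 by rewrite exprn_gt0 // lt_neqAle eq_sym s0 rnorm_ge0.
(* As [x] has defect zero, adding [- t s^* x] to [y] changes the defect by [- 2 t |s|^2]. With this
   [t] the result would be [- defect T y - 2 < 0]. *)
pose t : R := (defect T y + 1) / rnorm s ^+ 2.
have := defect_ge0 cT (((- t)%:C * s^*) *: x + y).
rewrite /defect TD TZ !rnorm_sqrD !dotZl !rnormZ hx.
suff E : complex.Re ((- t)%:C * s^* * dot x y) - complex.Re ((- t)%:C * s^* * dot (T x) (T y)) = - (t * rnorm s ^+ 2).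
  have : t * rnorm s ^+ 2 = defect T y + 1 by rewrite /t divfK // gt_eqF.
  have := defect_ge0 cT y; rewrite /defect; move: E; move: (t * _) => q E.
  by set a := (_ * rnorm x) ^+ 2; lra.
rewrite -raddfB -mulrBr -/s -mulrA [_^* * s]mulrC rnormCK /=; ring.
Qed.

End Adjoint.

End Hilbert.

(** * Total boundedness, and invertibility on the unit circle *)

Section CompactOperators.
Context {R : realType} {H : completeNormedModType R[i]}.
Local Notation C := R[i].

Lemma rnorm_ball (x y : H) (e : R) : ball x e%:C y <-> rnorm (x - y) < e.
Proof. by rewrite -ball_normE /= rnormE ltcR. Qed.

Lemma nbhs_rnorm (x : H) (e : R) : 0 < e -> nbhs x [set y | rnorm (x - y) < e].
Proof.
move=> e0; apply/nbhs_ballP; exists e%:C; first by rewrite /= ltcR.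
by move=> y /rnorm_ball.
Qed.

(** Total boundedness as a finite colouring of the unit ball: it bounds differences directly, which
    suits linear maps, and finitely many colourings combine into one. *)
Definition totally_bounded_operator (A : H -> H) := forall e : R, 0 < e ->
  exists n (col : H -> 'I_n), forall x y, rnorm x <= 1 -> rnorm y <= 1 ->
    col x = col y -> rnorm (A x - A y) <= e.

Let unit_ballE (x : H) : (`|x| <= 1) = (rnorm x <= 1).
Proof. by rewrite rnormE -(rmorph1 (real_complex R)) lecR. Qed.

Lemma compact_totally_bounded (A : H -> H) :
  compact_operator A -> totally_bounded_operator A.
Proof.
rewrite /compact_operator precompactE => cA e e0.
set S := closure _ in cA.
have e2 : 0 < e / 2 by rewrite divr_gt0.
rewrite compact_cover in cA.
have [||D' _ cov] := cA H setT (fun p : H => [set y | rnorm (p - y) < e / 2]°).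
- by move=> i _; exact: open_interior.
- by move=> y _; exists y => //; exact: nbhs_rnorm.
pose s : seq H := finmap.enum_fset D'.
have ex x : rnorm x <= 1 -> has (fun p => rnorm (p - A x) < e / 2) s.
  move=> x1; have [|p pD /interior_subset hp] := cov (A x).
    by apply: subset_closure; exists x => //=; rewrite unit_ballE.
  by apply/hasP; exists p.
pose F x := find (fun p => rnorm (p - A x) < e / 2) s.
(* The colour is the index of the first centre close to [A x]. The extra colour is the value of
   [find] when there is none, which happens only off the unit ball. *)
exists (size s).+1, (fun x => inord (F x)) => x y x1 y1.
have fx := ex x x1; have fy := ex y y1.
move=> /(congr1 val) /=; rewrite !inordK ?ltnS ?find_size // => E.
have := nth_find 0 fx; have := nth_find 0 fy; rewrite -/(F x) -/(F y) E => h1 h2.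
apply: le_trans (rnorm_distD (nth 0 s (F y)) _ _) _; rewrite [e]splitr.
by apply: lerD; apply: ltW => //; rewrite rnorm_distC.
Qed.

(** An ultrafilter on the closure is Cauchy: if it contained no ball of radius [e], it would contain
    the complement of finitely many such balls that cover the closure. *)
Lemma totally_bounded_compact (A : H -> H) :
  totally_bounded_operator A -> compact_operator A.
Proof.
move=> tA; rewrite /compact_operator precompactE compact_ultra => F FU FS.
set S := closure _ in FS *.
suff cF : cvg F.
  exists (lim F); split => //.
  by have := @closed_cvg _ _ F _ id S (@closed_closure _ _) FS (lim F); apply.
apply/cauchy_cvgP/cauchy_exP => e e0.
have ee : e = (complex.Re e)%:C by rewrite RRe_real // gtr0_real.
rewrite ee ltcR in e0 *; move: (complex.Re e) e0 => {ee}e e0.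
have e2 : 0 < e / 2 by rewrite divr_gt0.
have [n [col hcol]] := tA _ e2.
apply: contrapT => nF.
have hF (p : H) : \forall y \near F, ~ rnorm (p - y) < e.
  have [h|h] := in_ultra_setVsetC [set y | rnorm (p - y) < e] FU; last by apply: filterS h.
  by case: nF; exists p; apply: filterS h => y /rnorm_ball.
(* One unit-ball representative per colour; a colour absent from the ball gets 0, a harmless extra
   centre. *)
pose rep (i : 'I_n) := xget 0 [set x | rnorm x <= 1 /\ col x = i].
have h1 : \forall y \near F, forall i, ~ rnorm (A (rep i) - y) < e.
  by apply: filter_forall => i; exact: hF.
have [y [Sy hy]] := filter_ex (filterI FS h1).
have [_ [[x x1 <-] /= hx]] := Sy _ (nbhs_rnorm y e2).
rewrite /= unit_ballE in x1.
apply: (hy (col x)); apply: le_lt_trans (rnorm_distD (A x) _ _) _.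
rewrite [e]splitr; apply: ler_ltD; last by rewrite rnorm_distC.
have [r1 rc] : rnorm (rep (col x)) <= 1 /\ col (rep (col x)) = col x.
  by rewrite /rep; case: xgetP => // /(_ x) [].
exact: hcol.
Qed.

Lemma totally_bounded_family n (A : 'I_n -> H -> H) :
  (forall i, totally_bounded_operator (A i)) -> forall e : R, 0 < e ->
  exists m (col : H -> 'I_m), forall x y, rnorm x <= 1 -> rnorm y <= 1 ->
    col x = col y -> forall i, rnorm (A i x - A i y) <= e.
Proof.
move=> hA e e0.
(* The number of colours and the colouring are packed into one dependent pair so that [choice]
   selects both at once. *)
have {hA}hA i : exists p : {m : nat & H -> 'I_m}, forall x y, rnorm x <= 1 -> rnorm y <= 1 ->
    projT2 p x = projT2 p y -> rnorm (A i x - A i y) <= e.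
  by have [m [col h]] := hA i e e0; exists (existT _ m col).
have [p hp] := choice hA.
(* The common refinement: a colour is a tuple of colours. *)
pose T := {dffun forall i : 'I_n, 'I_(projT1 (p i))}.
pose col x : T := [ffun i => projT2 (p i) x].
exists #|T|, (fun x => enum_rank (col x)) => x y x1 y1 /enum_rank_inj E i.
by apply: hp => //; have := congr1 (fun c : T => c i) E; rewrite !ffunE.
Qed.

Lemma geometric_cvg (u : nat -> H) (D q : R) : 0 <= q < 1 -> 0 <= D ->
  (forall n, rnorm (u n.+1 - u n) <= D * q ^+ n) ->
  exists v, forall e : R, 0 < e -> exists N, forall n, (N <= n)%N -> rnorm (v - u n) <= e.
Proof. by move=> q01 D0 hu; apply: rnorm_cauchy_cvg; exact: geometric_cauchy hu. Qed.

Lemma fixed_point (F : H -> H) (q : R) : 0 <= q < 1 ->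
  (forall x y, rnorm (F x - F y) <= q * rnorm (x - y)) -> exists x, F x = x.
Proof.
move=> q01 hF; have /andP[q0 q1] := q01; pose u n := iter n F 0.
have [|v hv] := @geometric_cvg u (rnorm (u 1 - u 0)) q q01 (rnorm_ge0 _).
  elim=> [|n IH]; first by rewrite expr0 mulr1.
  by rewrite exprS mulrCA; apply: le_trans (hF _ _) _; rewrite ler_wpM2l.
exists v; apply/eqP; rewrite -subr_eq0 -rnorm_eq0 eq_le rnorm_ge0 andbT.
apply/ler_addgt0Pr => e e0; rewrite add0r.
have [|N hN] := hv (e / 2); first by rewrite divr_gt0.
apply: le_trans (rnorm_distD (u N.+1) _ _) _; rewrite [e]splitr; apply: lerD.
  by apply: le_trans (hF _ _) _; apply: le_trans (hN N (leqnn _)); rewrite ler_piMl ?rnorm_ge0 // ltW.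
by rewrite rnorm_distC hN.
Qed.

Section Resolvent.
Variable T : {linear H -> H}.
Hypothesis cT : forall x, rnorm (T x) <= rnorm x.

Lemma invertible_bounded_below (A : H -> H) :
  invertible_operator A -> exists2 k : R, 0 < k & forall x, k * rnorm x <= rnorm (A x).
Proof.
move=> [S [cS SK KS]].
have [d d0 hd] : exists2 d : R, 0 < d & forall y, rnorm y < d -> rnorm (S y) < 1.
  have := cS 0 _ (nbhs_rnorm (S 0) (@ltr01 R)); rewrite /= => /nbhs_ballP [d /= d0 hd].
  have dE : d = (complex.Re d)%:C by rewrite RRe_real // gtr0_real.
  rewrite dE ltcR in d0; exists (complex.Re d) => // y yd.
  have := hd y; rewrite dE => /(_ _)/=; rewrite linear0 sub0r rnormN; apply.
  by apply/rnorm_ball; rewrite sub0r rnormN.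
exists (d / 2); first by rewrite divr_gt0.
move=> x; have [Ax|x0] := eqVneq (A x) 0.
  have -> : x = 0 by rewrite -[x]SK Ax linear0.
  by rewrite rnorm0 mulr0 rnorm_ge0.
have nx : 0 < rnorm (A x) by rewrite lt_neqAle rnorm_ge0 eq_sym rnorm_eq0 x0.
(* [A x] is rescaled to norm [d / 2], inside the ball where [S] is bounded by 1. *)
have := hd ((d / 2 / rnorm (A x))%:C *: A x).
rewrite rnormZ rnormR ger0_norm; last by rewrite !divr_ge0 // ltW.
rewrite divfK ?gt_eqF // => /(_ _)/=.
rewrite linearZ /= SK rnormZ rnormR ger0_norm; last by rewrite !divr_ge0 // ltW.
have -> : d / 2 / rnorm (A x) * rnorm x = d / 2 * rnorm x / rnorm (A x) by rewrite mulrAC.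
rewrite (ltr_pdivrMr _ _ nx) mul1r => h; apply/ltW/h.
by rewrite ltr_pdivrMr // ltr_pMr // ltr1n.
Qed.

(** A lower bound alone does not give surjectivity. It is imported from a point [l] just outside the
    closed disk, where [T - l] is onto because [T] is a contraction, and carried back to [z] by
    perturbation. *)
Lemma bounded_below_invertible (z : C) (k : R) : rnorm z = 1 -> 0 < k ->
  (forall x, k * rnorm x <= rnorm (T x - z *: x)) ->
  invertible_operator (fun x => T x - z *: x).
Proof.
(* With [k = 4 d] and [|l - z| = d], [T - l] is still bounded below by [3 d], so the perturbation of
   size [d] leads to a contraction of ratio [1 / 3]. *)
move=> z1 k0 hk; pose d := k / 4; pose l := (1 + d)%:C * z.
have d0 : 0 < d by rewrite divr_gt0.
have d1 : 0 < 1 + d by rewrite ltr_wpDl.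
have lE : rnorm l = 1 + d by rewrite rnormM z1 mulr1 rnormR gtr0_norm.
have l0 : l != 0 by rewrite -rnorm_eq0 lE gt_eqF.
have TB c a b : T (a - b) - c *: (a - b) = (T a - c *: a) - (T b - c *: b).
  by rewrite linearB scalerBr !opprB addrACA [in RHS]addrACA [- (c *: a) + _]addrC.
have surj1 y : exists x, T x - l *: x = y.
  have [||x hx] := @fixed_point (fun x => l^-1 *: (T x - y)) (1 + d)^-1.
  - by rewrite invr_ge0 (ltW d1) /= invf_lt1 // ltrDl.
  - move=> a b; rewrite -scalerBr rnormZ rnormV lE opprB addrA subrK -linearB.
    by rewrite ler_wpM2l ?invr_ge0 ?(ltW d1).
  by exists x; rewrite -{2}hx scalerA divff // scale1r subKr.
have [S hS] := choice surj1.
have kl x : 3 * d * rnorm x <= rnorm (T x - l *: x).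
  have := hk x; have -> : k = 4 * d by rewrite /d mulrC divfK.
  have e1 : rnorm (T x - z *: x) <= rnorm (T x - l *: x) + d * rnorm x.
    have -> : T x - z *: x = T x - l *: x + (d%:C * z) *: x.
      rewrite /l rmorphD rmorph1 mulrDl mul1r scalerDl opprD addrA.
      by rewrite subrK.
    by apply: le_trans (rnormD _ _) _; rewrite rnormZ rnormM z1 mulr1 rnormR gtr0_norm.
  move=> e2; set a := rnorm x in e1 e2 *; set b := rnorm (T x - l *: x) in e1 *; lra.
have Slip a b : 3 * d * rnorm (S a - S b) <= rnorm (a - b).
  by have := kl (S a - S b); rewrite TB !hS.
have surj y : exists x, T x - z *: x = y.
  (* [T x - z x = y] is rewritten as [T x - l x = y - d z x], then solved with the inverse [S] of
     [T - l]. *)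
  have [||x hx] := @fixed_point (fun x => S (y - (d%:C * z) *: x)) 3^-1.
  - by rewrite invr_ge0 ler0n /= invf_lt1 // ltr1n.
  - move=> a b; have := Slip (y - (d%:C * z) *: a) (y - (d%:C * z) *: b).
    have -> : y - (d%:C * z) *: a - (y - (d%:C * z) *: b) = (d%:C * z) *: (b - a).
      by rewrite opprB addrC subrKA scalerBr.
    rewrite rnormZ rnormM z1 mulr1 rnormR gtr0_norm // [rnorm (b - a)]rnorm_distC.
    set p := rnorm _; set r := rnorm _ => h.
    rewrite mulrC ler_pdivlMr // -(ler_pM2l d0); apply: le_trans h.
    by rewrite le_eqVlt; apply/orP; left; apply/eqP; ring.
  exists x; have := hS (y - (d%:C * z) *: x); rewrite hx.
  move/(canRL (subrK _)) => ->; rewrite /l rmorphD rmorph1 mulrDl mul1r scalerDl.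
  by rewrite [z *: x + _]addrC addrA subrK addrK.
have [V hV] := choice surj.
have inj a b : T a - z *: a = T b - z *: b -> a = b.
  move=> E; apply/eqP; rewrite -subr_eq0 -rnorm_eq0 eq_le rnorm_ge0 andbT.
  by have := hk (a - b); rewrite TB E subrr rnorm0 pmulr_rle0.
have linV : linear V.
  move=> a x y; apply: inj; rewrite hV linearD linearZ /= scalerDr opprD addrACA hV.
  by rewrite !scalerA mulrC -scalerA -scalerBr hV.
pose VL : {linear H -> H} := HB.pack V (GRing.isLinear.Build C H H *:%R V linV).
exists VL; split => [x|x|x]; last 2 first.
- by apply: inj; rewrite hV.
- exact: hV.
apply/rnorm_cvgP => e e0.
have ke : 0 < k * e by rewrite mulr_gt0.
near=> y.
have : rnorm (x - y) < k * e by near: y; exact: nbhs_rnorm.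
have := hk (V x - V y).
rewrite TB !hV.
move=> h1 h2; have := le_lt_trans h1 h2; rewrite ltr_pM2l // => /ltW.
exact.
Unshelve. all: by end_near. Qed.

End Resolvent.

End CompactOperators.

(** * Compactness of the closed disk *)

Section ClosedDisk.
Context {R : realType}.
Local Notation C := R[i].
Local Notation Co := (R[i]^o).

Lemma compact_disk : compact [set z : Co | rnorm z <= 1].
Proof.
pose h (p : R * R) : Co := p.1 +i* p.2.
have ch : continuous h.
  move=> [a b]; apply/cvgrPdist_le => e e0.
  have ee : e = (complex.Re e)%:C by rewrite RRe_real // gtr0_real.
  rewrite ee ltcR in e0 *; move: (complex.Re e) e0 => {ee}e e0.
  have e2 : 0 < e / 2 by rewrite divr_gt0.
  have /cvgrPdist_le/(_ _ e2) c1 : fst (x : R * R) @[x --> (a, b)] --> a by exact: cvg_fst.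
  have /cvgrPdist_le/(_ _ e2) c2 : snd (x : R * R) @[x --> (a, b)] --> b by exact: cvg_snd.
  near=> p; rewrite rnormE lecR; apply: le_trans (rnorm_le_ReIm _) _.
  by rewrite [e]splitr /=; apply: lerD; [near: p; exact: c1|near: p; exact: c2].
have cS : compact (h @` (`[(-1 : R), 1] `*` `[(-1 : R), 1])).
  apply: continuous_compact; first exact: continuous_subspaceT.
  by apply: compact_setX; exact: segment_compact.
apply: subclosed_compact cS _.
  move=> z hz; apply/ler_addgt0Pr => e e0.
  have [|w [/= w1 wz]] := hz [set y : Co | rnorm (z - y) < e].
    apply/nbhs_ballP; exists e%:C; first by rewrite /= ltcR.
    by move=> y; rewrite -ball_normE /= rnormE ltcR.
  by apply: le_trans (rnorm_subD z w) _; rewrite addrC lerD // ltW.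
move=> z /= z1; exists (complex.Re z, complex.Im z); last by case: z {z1}.
have [h1 h2] := ReIm_le_rnorm z.
by split; rewrite /= in_itv /= -ler_norml (le_trans _ z1).
Unshelve. all: by end_near. Qed.

Lemma disk_rnorm (z : Co) : (`|z| <= 1) = (rnorm z <= 1).
Proof. by rewrite rnormE -(rmorph1 (real_complex R)) lecR. Qed.

Lemma open_disk_rnorm (z : Co) : (`|z| < 1) = (rnorm z < 1).
Proof. by rewrite rnormE -(rmorph1 (real_complex R)) ltcR. Qed.

Lemma nbhs_disk (x : Co) (e : R) : 0 < e -> nbhs x [set y : Co | rnorm (x - y) < e].
Proof.
move=> e0; apply/nbhs_ballP; exists e%:C; first by rewrite /= ltcR.
by move=> y; rewrite -ball_normE /= rnormE ltcR.
Qed.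

(** Heine-Cantor. Continuity is relative to the disk, so both points stay in it; compactness is used
    in near-covering form, with [d] tending to 0 from the right. *)
Lemma disk_algebra_uniform (f : Co -> Co) : disk_algebra f -> forall e : R, 0 < e ->
  exists2 d : R, 0 < d & forall z w : Co, rnorm z <= 1 -> rnorm w <= 1 ->
    rnorm (z - w) < d -> rnorm (f z - f w) <= e.
Proof.
move=> [_ cf] e e0; have e2 : 0 < e / 2 by rewrite divr_gt0.
have /compact_near_coveringP := compact_disk.
move=> /(_ _ (0 : R)^'+ (fun d z => rnorm z <= 1 -> forall w : Co, rnorm w <= 1 ->
  rnorm (z - w) < d -> rnorm (f z - f w) <= e)).
have FF : Filter ((0 : R)^'+) by exact: at_right_proper_filter.
move=> /(_ FF) hnear.
suff hnear2 : \forall d \near (0 : R)^'+, [set z : Co | rnorm z <= 1] `<=`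
    (fun z : Co => rnorm z <= 1 -> forall w : Co, rnorm w <= 1 ->
    rnorm (z - w) < d -> rnorm (f z - f w) <= e).
  have [d [hd d0]] := filter_ex (filterI hnear2 (nbhs_right_gt (0 : R))).
  by exists d => // z w z1 w1; exact: hd.
apply: hnear => z0 /= z01.
have := iffLR (subspace_continuousP _ f) cf z0.
rewrite /= disk_rnorm => /(_ z01)/cvgrPdist_le.
move=> /(_ (e / 2)%:C); rewrite ltcR => /(_ e2); rewrite /within /=.
move=> /nbhs_ballP [d /= d0 hd].
have dE : d = (complex.Re d)%:C by rewrite RRe_real // gtr0_real.
rewrite dE ltcR in d0.
have d2 : 0 < complex.Re d / 2 by rewrite divr_gt0.
have {}hd w : rnorm w <= 1 -> rnorm (z0 - w) < complex.Re d -> rnorm (f z0 - f w) <= e / 2.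
  move=> w1 hw; have := hd w; rewrite dE -ball_normE /= rnormE ltcR => /(_ hw).
  by rewrite disk_rnorm rnormE lecR; apply.
exists ([set z : Co | rnorm (z0 - z) < complex.Re d / 2], [set t : R | t < complex.Re d / 2]).
  by split; [exact: nbhs_disk | exact: nbhs_right_lt].
move=> [z t] /= [hz ht] z1 w w1 hzw.
apply: le_trans (rnorm_distD (f z0) _ _) _; rewrite [e]splitr; apply: lerD.
  rewrite rnorm_distC; apply: hd => //; apply: lt_trans hz _.
  by rewrite ltr_pdivrMr // ltr_pMr // ltr1n.
apply: hd => //; apply: le_lt_trans (rnorm_distD z _ _) _.
by rewrite [complex.Re d]splitr; apply: ltrD => //; exact: lt_trans ht.
Qed.

End ClosedDisk.

Section CircleResolvent.
Context {R : realType} {H : completeNormedModType R[i]}.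
Local Notation C := R[i].
Local Notation Co := (R[i]^o).
Variable T : {linear H -> H}.

(** Locally at [z0] one of three things happens: off the spectrum a lower bound survives small
    perturbations; inside the open disk no unimodular point is near; at a unimodular spectral point
    [f] is small. Compactness of the disk makes [k] uniform. *)
Lemma circle_resolvent_bound (f : Co -> Co) (eta : R) : disk_algebra f -> 0 < eta ->
  (forall z : Co, (spectrum T `&` unit_circle) z -> f z = 0) ->
  exists2 k : R, 0 < k & forall z : C, rnorm z = 1 ->
    rnorm (f z) <= eta \/ forall x, k * rnorm x <= rnorm (T x - z *: x).
Proof.
move=> df eta0 hf.
have [d d0 hd] := disk_algebra_uniform df eta0.
have /compact_near_coveringP := @compact_disk R.
move=> /(_ _ (0 : R)^'+ (fun k (z : Co) => rnorm z = 1 ->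
    rnorm (f z) <= eta \/ forall x, k * rnorm x <= rnorm (T x - z *: x))).
have FF : Filter ((0 : R)^'+) by exact: at_right_proper_filter.
move=> /(_ FF) hnear.
suff hnear2 : \forall k \near (0 : R)^'+, [set z : Co | rnorm z <= 1] `<=`
    (fun z : Co => rnorm z = 1 ->
    rnorm (f z) <= eta \/ forall x, k * rnorm x <= rnorm (T x - z *: x)).
  have [k [hk k0]] := filter_ex (filterI hnear2 (nbhs_right_gt (0 : R))).
  by exists k => // z z1; apply: hk => //=; rewrite z1.
apply: hnear => z0 /= z01.
have [zs|zs] := pselect (spectrum T z0); last first.
  have /invertible_bounded_below [k k0 hk] : invertible_operator (fun x => T x - z0 *: x).
    by apply: contrapT => h; apply: zs.
  have k2 : 0 < k / 2 by rewrite divr_gt0.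
  exists ([set z : Co | rnorm (z0 - z) < k / 2], [set t : R | t < k / 2]).
    by split; [exact: nbhs_disk | exact: nbhs_right_lt].
  move=> [z t] /= [hz ht] _; right => x.
  have h1 := hk x.
  have h2 : rnorm (T x - z0 *: x) <= rnorm (T x - z *: x) + k / 2 * rnorm x.
    have -> : T x - z0 *: x = (T x - z *: x) - (z0 - z) *: x.
      by rewrite scalerBl opprB addrA subrK.
    apply: le_trans (rnormB _ _) _; rewrite lerD2l rnormZ.
    by rewrite ler_wpM2r ?rnorm_ge0 // ltW.
  have h3 : t * rnorm x <= k / 2 * rnorm x by rewrite ler_wpM2r ?rnorm_ge0 // ltW.
  have E : k * rnorm x = k / 2 * rnorm x + k / 2 * rnorm x by rewrite -mulrDl -splitr.
  by rewrite -(lerD2r (k / 2 * rnorm x)); apply: le_trans h2; apply: le_trans h1; rewrite E lerD2r.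
have [z0c|z0c] := eqVneq (rnorm z0) 1; last first.
  have z0l : rnorm z0 < 1 by rewrite lt_neqAle z0c.
  exists ([set z : Co | rnorm (z0 - z) < 1 - rnorm z0], setT).
    by split; [apply: nbhs_disk; rewrite subr_gt0 | exact: filterT].
  move=> [z t] /= [hz _] z1; exfalso.
  have := rnorm_subD z z0; rewrite z1 rnorm_distC; move: hz; move: (rnorm _) => a; lra.
exists ([set z : Co | rnorm (z0 - z) < d], setT).
  by split; [exact: nbhs_disk | exact: filterT].
move=> [z t] /= [hz _] z1; left.
have fz0 : f z0 = 0.
  by apply: hf; split=> //; rewrite /unit_circle /= rnormE z0c.
have := hd z z0; rewrite z1 z0c rnorm_distC hz fz0 subr0; exact.
Qed.

End CircleResolvent.

(** * Unimodular eigenvalues *)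

Section CompletelyNonunitary.
Context {R : realType} {H : completeNormedModType R[i]}.
Local Notation C := R[i].
Variable dot : {dot H for @Num.conj C}.
Hypothesis hn : hilbert_norm dot.
Variable T : {linear H -> H}.
Hypothesis cT : forall x, rnorm (T x) <= rnorm x.

Lemma eigenspace_closed (z : C) : rnorm z = 1 -> closed [set x | T x = z *: x].
Proof.
move=> z1 x hx; apply/eqP; rewrite -subr_eq0 -rnorm_eq0 eq_le rnorm_ge0 andbT.
apply/ler_addgt0Pr => e e0; rewrite add0r; have e2 : 0 < e / 2 by rewrite divr_gt0.
have [y [/= hy xy]] := hx _ (nbhs_rnorm x e2).
have -> : T x - z *: x = T (x - y) - z *: (x - y).
  by rewrite linearB hy scalerBr opprB addrA subrK.
apply: le_trans (rnormB _ _) _; rewrite rnormZ z1 mul1r [e]splitr.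
by apply: lerD; apply: ltW => //; apply: le_lt_trans xy.
Qed.

(** The whole eigenspace [M] is used. On it [T] is isometric, hence preserves inner products of [M]
    with arbitrary vectors; as [T] maps [M] onto [M], the orthocomplement is invariant too. *)
Lemma completely_nonunitary_eigen (z : C) x : completely_nonunitary dot T ->
  rnorm z = 1 -> T x = z *: x -> x = 0.
Proof.
move=> cnu z1 hx; set M := [set x | T x = z *: x].
have zz : z * z^* = 1 by rewrite rnormCK z1 expr1n.
have iso y v : M y -> dot (T y) (T v) = dot y v.
  by move=> hy; apply: isometric_vector (linearP T) cT _ _ _ => //; rewrite hy rnormZ z1 mul1r.
have MT y : M y -> y = T (z^* *: y).
  by move=> hy; rewrite linearZ /= hy scalerA mulrC zz scale1r.
have MZ a y : M y -> M (a *: y).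
  by move=> hy; rewrite /M /= linearZ /= hy !scalerA mulrC.
suff ME : M = [set 0] by have : M x := hx; rewrite ME.
apply: cnu.
  split.
  - split; first exact: eigenspace_closed.
      by rewrite /M /= linear0 scaler0.
    by move=> a u v hu hv; rewrite /M /= linearP hu hv scalerDr !scalerA mulrC.
  - by move=> _ [y hy <-]; rewrite /M /= {1}hy linearZ.
  - move=> _ [v hv <-] y My; rewrite (MT _ My) iso; last exact: MZ.
    by apply: hv; exact: MZ.
split; last by move=> u v hu _; exact: iso.
apply/seteqP; split => [_ [y hy <-]|y hy]; first by rewrite /M /= {1}hy linearZ.
by exists (z^* *: y); [exact: MZ|rewrite -MT].
Qed.

End CompletelyNonunitary.

(** * Cauchy's formula for circles *)

Section RealIntegral.
Context {R : realType}.
Local Notation mu := (@lebesgue_measure R).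

Definition rint (u : R -> R) (a b : R) : R := \int[mu]_(t in `[a, b]) u t.

Lemma continuous_integrable (w : R -> R) a b : continuous w ->
  mu.-integrable `[a, b] (EFin \o w).
Proof.
move=> cw; apply: continuous_compact_integrable; first exact: segment_compact.
exact: continuous_subspaceT.
Qed.

Lemma rint_FTC (u U : R -> R) (a b : R) : continuous u -> a <= b -> (forall t : R, is_derive t 1 U (u t)) ->
  rint u a b = U b - U a.
Proof.
move=> cu; rewrite le_eqVlt => /predU1P[->|ab] dU.
  by rewrite /rint set_itv1 Rintegral_set1 subrr.
have cU : continuous U.
  move=> t; apply: differentiable_continuous; apply/derivable1_diffP.
  by have [] := dU t.
rewrite /rint /Rintegral (@continuous_FTC2 _ u U a b ab) //.
- exact: continuous_subspaceT.
- split; first by move=> t _; have [] := dU t.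
    by apply: cvg_at_right_filter; exact: cU.
  by apply: cvg_at_left_filter; exact: cU.
- by move=> t _; rewrite derive1E; have [_] := dU t.
Qed.

Lemma is_derive_scalar (k t : R) : is_derive t 1 (fun x => k * x) k.
Proof.
have h := @is_deriveZ R R R id k t 1 1 (is_derive_id t 1).
by apply: is_derive_eq h _; exact: mulr1.
Qed.

Section Continuous.
Variables (u v : R -> R).
Hypotheses (cu : continuous u) (cv : continuous v).

Lemma rintD a b : rint (fun t => u t + v t) a b = rint u a b + rint v a b.
Proof. by rewrite /rint RintegralD //; exact: continuous_integrable. Qed.

Lemma rintZ k a b : rint (fun t => k * u t) a b = k * rint u a b.
Proof. by rewrite /rint RintegralZl //; exact: continuous_integrable. Qed.

Lemma rint_bound a b (M : R) : a <= b -> (forall t, a <= t <= b -> `|u t| <= M) ->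
  `|rint u a b| <= M * (b - a).
Proof.
move=> ab hM; rewrite /rint.
apply: le_trans (le_normr_Rintegral _ _) _ => //; first exact: continuous_integrable.
apply: (@le_trans _ _ (\int[mu]_(t in `[a, b]) M)).
  apply: le_Rintegral => //.
    apply: continuous_integrable => t.
    by apply: continuous_comp; [exact: cu|exact: norm_continuous].
  by apply: continuous_integrable => t; exact: cvg_cst.
suff E : rint (fun=> M) a b = M * b - M * a by rewrite mulrBr -E.
apply: (@rint_FTC (fun=> M) (fun t => M * t)) => // t; first exact: cvg_cst.
exact: is_derive_scalar.
Qed.

Lemma rint_split m a b : a <= m -> m <= b -> rint u a b = rint u a m + rint u m b.
Proof.
move=> am mb; rewrite /rint.
(* The splitting rule yields a half-open piece; closing it adds a single point, of measure zero. *)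
have := @Rintegral_itvB _ u (BLeft a) (BRight b) m.
rewrite Rintegral_itv_obnd_cbnd; last first.
  by apply: integrableS (continuous_integrable m b cu) => //; exact: subset_itv_oc_cc.
move=> /(_ (continuous_integrable _ _ cu)); rewrite !bnd_simp => /(_ am mb) <-.
by rewrite addrC subrK.
Qed.

End Continuous.

Lemma eq_rint (u v : R -> R) a b : (forall t, a <= t <= b -> u t = v t) -> rint u a b = rint v a b.
Proof. by move=> h; apply: eq_Rintegral => t; rewrite inE /= in_itv /= => /h. Qed.

End RealIntegral.

Section ComplexIntegral.
Context {R : realType}.
Local Notation C := R[i].
Implicit Types u v : R -> C.

(** Componentwise, like [cint] below, so that linearity and the fundamental theorem of calculus
    carry over from real integrals. *)
Definition ccont u := continuous (fun t => complex.Re (u t) : R) /\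
                      continuous (fun t => complex.Im (u t) : R).

Definition cint u a b : C :=
  rint (fun t => complex.Re (u t)) a b +i* rint (fun t => complex.Im (u t)) a b.

Lemma ccontP u : (forall t (e : R), 0 < e -> \forall t' \near t, rnorm (u t - u t') <= e) <-> ccont u.
Proof.
split=> [h|[h1 h2] t e e0].
  split=> t; apply/cvgrPdist_le => e e0; have := h t e e0; apply: filterS => t' h'.
    by rewrite -raddfB; apply: le_trans h'; case: (ReIm_le_rnorm (u t - u t')).
  by rewrite -raddfB; apply: le_trans h'; case: (ReIm_le_rnorm (u t - u t')).
have e2 : 0 < e / 2 by rewrite divr_gt0.
have /cvgrPdist_le/(_ _ e2) c1 := h1 t.
have /cvgrPdist_le/(_ _ e2) c2 := h2 t.
near=> t'; apply: le_trans (rnorm_le_ReIm _) _.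
by rewrite !raddfB [e]splitr; apply: lerD; near: t'.
Unshelve. all: by end_near. Qed.

Lemma ccont_cst c : ccont (fun=> c).
Proof. by split=> t; exact: cvg_cst. Qed.

Lemma ccontD u v : ccont u -> ccont v -> ccont (fun t => u t + v t).
Proof.
move=> [u1 u2] [v1 v2]; split.
  have -> : (fun t => complex.Re (u t + v t)) = (fun t => complex.Re (u t) + complex.Re (v t)).
    by apply/funext => t; rewrite raddfD.
  by move=> t; exact: (continuousD (u1 t) (v1 t)).
have -> : (fun t => complex.Im (u t + v t)) = (fun t => complex.Im (u t) + complex.Im (v t)).
  by apply/funext => t; rewrite raddfD.
by move=> t; exact: (continuousD (u2 t) (v2 t)).
Qed.

Lemma ccontM u v : ccont u -> ccont v -> ccont (fun t => u t * v t).
Proof.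
have ReM (x y : C) : complex.Re (x * y) = complex.Re x * complex.Re y - complex.Im x * complex.Im y.
  by case: x y => [a b] [c d].
have ImM (x y : C) : complex.Im (x * y) = complex.Re x * complex.Im y + complex.Im x * complex.Re y.
  by case: x y => [a b] [c d].
move=> [u1 u2] [v1 v2]; split.
  have -> : (fun t => complex.Re (u t * v t)) =
      (fun t => complex.Re (u t) * complex.Re (v t) - complex.Im (u t) * complex.Im (v t)).
    by apply/funext => t; rewrite ReM.
  by move=> t; exact: (continuousB (continuousM (u1 t) (v1 t)) (continuousM (u2 t) (v2 t))).
have -> : (fun t => complex.Im (u t * v t)) =
    (fun t => complex.Re (u t) * complex.Im (v t) + complex.Im (u t) * complex.Re (v t)).
  by apply/funext => t; rewrite ImM.
by move=> t; exact: (continuousD (continuousM (u1 t) (v2 t)) (continuousM (u2 t) (v1 t))).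
Qed.

Lemma ccontB u v : ccont u -> ccont v -> ccont (fun t => u t - v t).
Proof.
move=> cu cv; have := ccontD cu (ccontM (ccont_cst (-1)) cv).
by under eq_fun do rewrite mulN1r.
Qed.

Lemma ccontX u n : ccont u -> ccont (fun t => u t ^+ n).
Proof.
move=> cu; elim: n => [|n IH]; first exact: ccont_cst.
by under eq_fun do rewrite exprS; exact: ccontM.
Qed.

Lemma ccontV u : ccont u -> (forall t, u t != 0) -> ccont (fun t => (u t)^-1).
Proof.
move=> /ccontP cu u0; apply/ccontP => t e e0.
have ut0 : 0 < rnorm (u t) by rewrite lt_neqAle eq_sym rnorm_eq0 u0 rnorm_ge0.
have c1 := cu t _ (divr_gt0 ut0 (ltr0Sn R 1)).
have c2 := cu t (e * (rnorm (u t) / 2) * rnorm (u t)) (mulr_gt0 (mulr_gt0 e0 (divr_gt0 ut0 (ltr0Sn R 1))) ut0).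
near=> t'.
have h1 : rnorm (u t - u t') <= rnorm (u t) / 2 by near: t'.
have h2 : rnorm (u t - u t') <= e * (rnorm (u t) / 2) * rnorm (u t) by near: t'.
have h3 : rnorm (u t) / 2 <= rnorm (u t').
  have := rnorm_subD (u t) (u t'); move: h1; move: (rnorm (u t - _)) (rnorm (u t)) => p q; lra.
have ut'0 : 0 < rnorm (u t') by apply: lt_le_trans h3; rewrite divr_gt0.
have -> : (u t)^-1 - (u t')^-1 = - (u t - u t') / (u t' * u t).
  by field; rewrite !u0.
rewrite rnormM rnormN rnormV rnormM ler_pdivrMr ?mulr_gt0 //.
apply: (le_trans h2); rewrite [X in _ <= X]mulrA ler_wpM2r ?rnorm_ge0 // ler_wpM2l //; exact: ltW.
Unshelve. all: by end_near. Qed.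

Lemma eq_cint u v a b : (forall t, a <= t <= b -> u t = v t) -> cint u a b = cint v a b.
Proof. by move=> h; rewrite /cint; congr (_ +i* _); apply: eq_rint => t /h ->. Qed.

Lemma cintD u v a b : ccont u -> ccont v ->
  cint (fun t => u t + v t) a b = cint u a b + cint v a b.
Proof.
move=> [u1 u2] [v1 v2]; rewrite /cint.
transitivity ((rint (fun t => complex.Re (u t)) a b + rint (fun t => complex.Re (v t)) a b) +i*
  (rint (fun t => complex.Im (u t)) a b + rint (fun t => complex.Im (v t)) a b)) => //.
by rewrite -!rintD //; congr (_ +i* _); apply: eq_rint => t _; rewrite raddfD.
Qed.

Lemma cintZ c u a b : ccont u -> cint (fun t => c * u t) a b = c * cint u a b.
Proof.
case: c => x y [u1 u2].
have cZ k (w : R -> R) : continuous w -> continuous (fun t => k * w t).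
  by move=> cw t; apply: cvgM; [exact: cvg_cst|exact: cw].
transitivity ((x * rint (fun t => complex.Re (u t)) a b + - y * rint (fun t => complex.Im (u t)) a b) +i*
  (x * rint (fun t => complex.Im (u t)) a b + y * rint (fun t => complex.Re (u t)) a b)); last first.
  by rewrite mulNr.
rewrite -!rintZ // -!rintD //; try exact: cZ.
by congr (_ +i* _); apply: eq_rint => t _; case: (u t) => c d /=; rewrite ?mulNr.
Qed.

Lemma cintB u v a b : ccont u -> ccont v ->
  cint (fun t => u t - v t) a b = cint u a b - cint v a b.
Proof.
move=> cu cv; rewrite -mulN1r -cintZ // -cintD //; last exact: ccontM (ccont_cst _) cv.
by apply: eq_cint => t _; rewrite mulN1r.
Qed.

Lemma cint_sum n (F : 'I_n -> R -> C) a b : (forall i, ccont (F i)) ->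
  ccont (fun t => \sum_i F i t) /\
  cint (fun t => \sum_i F i t) a b = \sum_i cint (F i) a b.
Proof.
elim: n F => [|n IH] F cF.
  rewrite big_ord0; split.
    by under eq_fun do rewrite big_ord0; exact: ccont_cst.
  rewrite -[RHS](mul0r (cint (fun=> 0) a b)) -cintZ; last exact: ccont_cst.
  by apply: eq_cint => t _; rewrite big_ord0 mul0r.
have [c1 e1] := IH (fun i => F (widen_ord (leqnSn n) i)) (fun i => cF _).
split; first by under eq_fun do rewrite big_ord_recr; exact: ccontD.
rewrite [RHS]big_ord_recr /= -e1 -cintD //.
by apply: eq_cint => t _; rewrite big_ord_recr.
Qed.

(** The factor 2 comes from bounding the real and imaginary parts separately; later estimates are
    used only up to a constant. *)
Lemma cint_bound u a b (M : R) : ccont u -> a <= b ->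
  (forall t, a <= t <= b -> rnorm (u t) <= M) -> rnorm (cint u a b) <= 2 * M * (b - a).
Proof.
move=> [u1 u2] ab hM; apply: le_trans (rnorm_le_ReIm _) _; rewrite mulr_natl mulr2n mulrDl.
apply: lerD; apply: rint_bound => // t /hM h; apply: le_trans h.
  by case: (ReIm_le_rnorm (u t)).
by case: (ReIm_le_rnorm (u t)).
Qed.

Lemma cint_split m u a b : ccont u -> a <= m -> m <= b -> cint u a b = cint u a m + cint u m b.
Proof.
move=> [u1 u2] am mb.
transitivity ((rint (fun t => complex.Re (u t)) a m + rint (fun t => complex.Re (u t)) m b) +i*
  (rint (fun t => complex.Im (u t)) a m + rint (fun t => complex.Im (u t)) m b)) => //.
by rewrite /cint -!rint_split.
Qed.

Lemma cint_FTC u U a b : ccont u -> a <= b ->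
  (forall t, is_derive (t : R) 1 (fun t => complex.Re (U t) : R) (complex.Re (u t))) ->
  (forall t, is_derive (t : R) 1 (fun t => complex.Im (U t) : R) (complex.Im (u t))) ->
  cint u a b = U b - U a.
Proof.
move=> [u1 u2] ab d1 d2; rewrite /cint (rint_FTC u1 ab d1) (rint_FTC u2 ab d2).
by case: (U b) (U a) => [x y] [x' y'].
Qed.

Lemma cint_cst c a b : a <= b -> cint (fun=> c) a b = c * (b - a)%:C.
Proof.
move=> ab; rewrite rmorphB mulrBr.
apply: (cint_FTC (U := fun t => c * t%:C) (ccont_cst c) ab).
- move=> t; have -> : (fun t0 : R => complex.Re (c * t0%:C)) = (fun t0 => complex.Re c * t0).
    by apply/funext => s; case: c => x y /=; rewrite mulr0 subr0.
  exact: is_derive_scalar.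
- move=> t; have -> : (fun t0 : R => complex.Im (c * t0%:C)) = (fun t0 => complex.Im c * t0).
    by apply/funext => s; case: c => x y /=; rewrite mulr0 add0r.
  exact: is_derive_scalar.
Qed.

End ComplexIntegral.

(** * Goursat's theorem by bisection *)

Lemma nested_intervals {R : realType} (lo hi : nat -> R) :
  (forall n, lo n <= lo n.+1) -> (forall n, hi n.+1 <= hi n) -> (forall n, lo n <= hi n) ->
  exists x, forall n, lo n <= x <= hi n.
Proof.
move=> hlo hhi hle.
have mlo m n : (m <= n)%N -> lo m <= lo n.
  by move=> /subnKC <-; elim: (n - m)%N => [|k IH]; rewrite ?addn0 // addnS (le_trans IH).
have mhi m n : (m <= n)%N -> hi n <= hi m.
  by move=> /subnKC <-; elim: (n - m)%N => [|k IH]; rewrite ?addn0 // addnS (le_trans _ IH).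
have ub m n : lo m <= hi n.
  apply: le_trans (mlo m (maxn m n) _) _; first exact: leq_maxl.
  by apply: le_trans (hle _) _; apply: mhi; exact: leq_maxr.
exists (sup (range lo)) => n; apply/andP; split.
  apply: ub_le_sup; last by exists n.
  by exists (hi 0%N) => _ [m _ <-].
by apply: ge_sup; [exists (lo 0%N), 0%N|move=> _ [m _ <-]].
Qed.

Section Rectangles.
Context {R : realType}.
Local Notation C := R[i].
(** A function of rectangles that is additive under cutting in either direction; it will be the
    boundary integral. *)
Variables (B : R -> R -> R -> R -> C) (a b c d : R).
Hypothesis Bs : forall s1 m s2 t1 t2, a <= s1 -> s1 <= m -> m <= s2 -> s2 <= b ->
  c <= t1 -> t1 <= t2 -> t2 <= d -> B s1 s2 t1 t2 = B s1 m t1 t2 + B m s2 t1 t2.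
Hypothesis Bt : forall s1 s2 t1 m t2, a <= s1 -> s1 <= s2 -> s2 <= b ->
  c <= t1 -> t1 <= m -> m <= t2 -> t2 <= d -> B s1 s2 t1 t2 = B s1 s2 t1 m + B s1 s2 m t2.

Let valid (q : (R * R) * (R * R)) :=
  [/\ a <= q.1.1, q.1.1 <= q.1.2, q.1.2 <= b & [/\ c <= q.2.1, q.2.1 <= q.2.2 & q.2.2 <= d]].
Let val q := rnorm (B q.1.1 q.1.2 q.2.1 q.2.2).

(** Pigeonhole over the four quarters: one of them carries at least a quarter of the value. *)
Let half_step (q : (R * R) * (R * R)) : valid q -> exists q', valid q' /\
  [/\ q.1.1 <= q'.1.1, q'.1.2 <= q.1.2, q.2.1 <= q'.2.1 & q'.2.2 <= q.2.2] /\
  [/\ q'.1.2 - q'.1.1 = (q.1.2 - q.1.1) / 2, q'.2.2 - q'.2.1 = (q.2.2 - q.2.1) / 2 &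
      val q <= 4 * val q'].
Proof.
case: q => [[s1 s2] [t1 t2]] [/= h1 h2 h3 [h4 h5 h6]].
pose m := (s1 + s2) / 2; pose n := (t1 + t2) / 2.
have m1 : s1 <= m by rewrite /m; lra.
have m2 : m <= s2 by rewrite /m; lra.
have n1 : t1 <= n by rewrite /n; lra.
have n2 : n <= t2 by rewrite /n; lra.
have am : a <= m by apply: le_trans m1.
have mb : m <= b by apply: le_trans h3.
have cn : c <= n by apply: le_trans n1.
have nd : n <= d by apply: le_trans h6.
have E : val ((s1, s2), (t1, t2)) <= val ((s1, m), (t1, n)) + val ((s1, m), (n, t2)) +
    (val ((m, s2), (t1, n)) + val ((m, s2), (n, t2))).
  rewrite /val /= (Bs h1 m1 m2) // (@Bt s1 m t1 n t2) // (@Bt m s2 t1 n t2) //.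
  apply: le_trans (rnormD _ _) _; apply: lerD; exact: rnormD.
have e1 : m - s1 = (s2 - s1) / 2 by rewrite /m; lra.
have e2 : s2 - m = (s2 - s1) / 2 by rewrite /m; lra.
have e3 : n - t1 = (t2 - t1) / 2 by rewrite /n; lra.
have e4 : t2 - n = (t2 - t1) / 2 by rewrite /n; lra.
have [k|k] := leP (val ((s1, s2), (t1, t2))) (4 * val ((s1, m), (t1, n))).
  by exists ((s1, m), (t1, n)).
have [k2|k2] := leP (val ((s1, s2), (t1, t2))) (4 * val ((s1, m), (n, t2))).
  by exists ((s1, m), (n, t2)).
have [k3|k3] := leP (val ((s1, s2), (t1, t2))) (4 * val ((m, s2), (t1, n))).
  by exists ((m, s2), (t1, n)).
exists ((m, s2), (n, t2)); split; [by []|split; [by []|split => //]].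
move: E k k2 k3; move: (val _) (val _) (val _) (val _) (val _) => *; lra.
Qed.

(** Each bisection divides the squared size by 4 and the value by at most 4, so the local bound
    [e * size^2] at the limit point returns to the initial rectangle with the same [e]. *)
Lemma additive_rectangle_eq0 : a <= b -> c <= d ->
  (forall s t, a <= s <= b -> c <= t <= d -> forall e : R, 0 < e ->
    exists2 r : R, 0 < r & forall s1 s2 t1 t2, a <= s1 -> s2 <= b -> c <= t1 -> t2 <= d ->
      s1 <= s <= s2 -> t1 <= t <= t2 -> s2 - s1 < r -> t2 - t1 < r ->
      rnorm (B s1 s2 t1 t2) <= e * ((s2 - s1) + (t2 - t1)) ^+ 2) ->
  B a b c d = 0.
Proof.
move=> ab cd loc.
have [f hf] : exists f : (R * R) * (R * R) -> (R * R) * (R * R), forall q, valid q ->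
  valid (f q) /\
  [/\ q.1.1 <= (f q).1.1, (f q).1.2 <= q.1.2, q.2.1 <= (f q).2.1 & (f q).2.2 <= q.2.2] /\
  [/\ (f q).1.2 - (f q).1.1 = (q.1.2 - q.1.1) / 2,
      (f q).2.2 - (f q).2.1 = (q.2.2 - q.2.1) / 2 & val q <= 4 * val (f q)].
  (* The step is extended to all quadruples so that it can be iterated. *)
  have ex q : exists q', valid q -> valid q' /\
    [/\ q.1.1 <= q'.1.1, q'.1.2 <= q.1.2, q.2.1 <= q'.2.1 & q'.2.2 <= q.2.2] /\
    [/\ q'.1.2 - q'.1.1 = (q.1.2 - q.1.1) / 2, q'.2.2 - q'.2.1 = (q.2.2 - q.2.1) / 2 &
      val q <= 4 * val q'].
    have [/half_step [q' h]|h] := pselect (valid q); first by exists q'.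
    by exists q.
  by have [f hf] := choice ex; exists f.
pose q n := iter n f ((a, b), (c, d)).
have vq n : valid (q n).
  by elim: n => [|n IH]; [split|have [] := hf _ IH].
have sz n : (q n).1.2 - (q n).1.1 = (b - a) / 2 ^+ n /\ (q n).2.2 - (q n).2.1 = (d - c) / 2 ^+ n /\
    val ((a, b), (c, d)) <= 4 ^+ n * val (q n).
  elim: n => [|n [IH1 [IH2 IH3]]]; first by rewrite !expr0 !divr1 mul1r.
  have [_ [_ [E1 E2 E3]]] := hf _ (vq n).
  rewrite [q n.+1]iterS -/(q n) E1 E2 IH1 IH2 !exprSr !invfM !mulrA; split=> //; split=> //.
  by apply: (le_trans IH3); rewrite -mulrA ler_wpM2l // exprn_ge0.
have [s hs] : exists s, forall n, (q n).1.1 <= s <= (q n).1.2.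
  apply: nested_intervals => n; last by case: (vq n).
    by have [_ [[]]] := hf _ (vq n).
  by have [_ [[]]] := hf _ (vq n).
have [t ht] : exists t, forall n, (q n).2.1 <= t <= (q n).2.2.
  apply: nested_intervals => n; last by case: (vq n) => _ _ _ [].
    by have [_ [[]]] := hf _ (vq n).
  by have [_ [[]]] := hf _ (vq n).
apply/eqP; rewrite -rnorm_eq0 eq_le rnorm_ge0 andbT; apply/ler_addgt0Pr => e e0; rewrite add0r.
pose W := (b - a) + (d - c).
have W0 : 0 <= W by rewrite addr_ge0 // subr_ge0.
have [|r r0 hr] := loc s t (hs 0%N) (ht 0%N) (e / (W ^+ 2 + 1)).
  by rewrite divr_gt0 // ltr_wpDl // sqr_ge0.
have [n hn] : exists n, (2^-1) ^+ n <= r / 2 / (W + 1).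
  apply: expr_small; last by rewrite !divr_gt0 // ltr_wpDl.
  by rewrite invr_ge0 ler0n invf_lt1 // ltr1n.
have [E1 [E2 E3]] := sz n; have [v1 v2 v3 [v4 v5 v6]] := vq n.
have small (x : R) : 0 <= x -> x <= W -> x / 2 ^+ n < r.
  move=> x0 xW; rewrite -exprVn.
  move: hn; rewrite ler_pdivlMr ?ltr_wpDl // => hn.
  apply: (@le_lt_trans _ _ (r / 2)); last by rewrite ltr_pdivrMr // ltr_pMr // ltr1n.
  apply: le_trans hn; rewrite mulrC ler_wpM2l ?exprn_ge0 ?invr_ge0 //.
  by rewrite (le_trans xW) // lerDl.
have := hr _ _ _ _ v1 v3 v4 v6 (hs n) (ht n); rewrite E1 E2.
rewrite !small ?subr_ge0 //; [|by rewrite /W lerDr subr_ge0|by rewrite /W lerDl subr_ge0].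
move=> /(_ isT isT); rewrite -mulrDl -/W => h.
apply: (le_trans E3).
apply: (@le_trans _ _ (4 ^+ n * (e / (W ^+ 2 + 1) * (W / 2 ^+ n) ^+ 2))).
  by rewrite ler_wpM2l // exprn_ge0.
have -> : 4 ^+ n * (e / (W ^+ 2 + 1) * (W / 2 ^+ n) ^+ 2) = e * (W ^+ 2 / (W ^+ 2 + 1)).
  have -> : (4 : R) = 2 ^+ 2 by rewrite -natrX.
  rewrite -exprM mulnC exprM; set p : R := 2 ^+ n.
  have p0 : p != 0 by rewrite expf_neq0.
  by field; rewrite p0 gt_eqF // ltr_wpDl // sqr_ge0.
rewrite ler_piMr ?(ltW e0) // ler_pdivrMr ?ltr_wpDl ?sqr_ge0 //.
by rewrite mul1r lerDl.
Qed.

End Rectangles.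

Section Goursat.
Context {R : realType}.
Local Notation C := R[i].

(** Differentiability without division: the increment may be zero, and the inequality is the one
    that the local estimate of Goursat consumes. *)
Definition holo (f : C -> C) := forall z, rnorm z < 1 -> exists L, forall e : R, 0 < e ->
  exists2 d : R, 0 < d & forall z', rnorm (z' - z) < d ->
    rnorm (f z' - f z - L * (z' - z)) <= e * rnorm (z' - z).

Lemma holo_ccont f u : holo f -> ccont u -> (forall t, rnorm (u t) < 1) -> ccont (fun t => f (u t)).
Proof.
move=> hf /ccontP cu u1; apply/ccontP => t e e0.
have [L hL] := hf _ (u1 t); have [d d0 hd] := hL 1 ltr01.
have L0 : 0 < rnorm L + 1 by rewrite ltr_wpDl ?rnorm_ge0.
have c1 := cu t _ (divr_gt0 d0 (ltr0Sn R 1)).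
have c2 := cu t _ (divr_gt0 e0 L0).
near=> t'.
have h1 : rnorm (u t - u t') <= d / 2 by near: t'.
have h2 : rnorm (u t - u t') <= e / (rnorm L + 1) by near: t'.
rewrite rnorm_distC in h1; rewrite rnorm_distC in h2.
have := hd (u t'); rewrite (le_lt_trans h1) ?ltr_pdivrMr ?ltr_pMr ?ltr1n // => /(_ isT).
rewrite mul1r => h3; rewrite rnorm_distC.
rewrite ler_pdivlMr // in h2; apply: le_trans h2.
apply: le_trans (rnorm_subD _ (L * (u t' - u t))) _.
by rewrite rnormM [X in _ <= X]mulrDr mulr1 addrC [rnorm L * _]mulrC lerD2l.
Unshelve. all: by end_near. Qed.

Definition expi (t : R) : C := cos t +i* sin t.

Lemma rnorm_expi t : rnorm (expi t) = 1.
Proof. by rewrite /rnorm normc_def /= cos2Dsin2 sqrtr1. Qed.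

Lemma ccont_expi : ccont expi.
Proof. by split; [exact: continuous_cos|exact: continuous_sin]. Qed.

Lemma expi2pi : expi (pi *+ 2) = expi 0.
Proof. by rewrite /expi cos2pi sin2pi cos0 sin0. Qed.

Section Circle.
(** The circle of radius [r] about 0 encloses [w] and is shrunk homothetically towards [w], from
    scale 1 to scale [s0]. *)
Variables (w : C) (r s0 : R).
Hypothesis wr : rnorm w < r.
Hypothesis r1 : r < 1.
Hypothesis s00 : 0 < s0.
Hypothesis s01 : s0 <= 1.

Let r0 : 0 < r := le_lt_trans (rnorm_ge0 w) wr.

Definition circ t : C := r%:C * expi t.
Definition arm t : C := circ t - w.
(** [kernel t dt] is [dz / (z - w)] along the circle. *)
Definition kernel t : C := 'i * circ t / arm t.

Lemma rnorm_circ t : rnorm (circ t) = r.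
Proof. by rewrite rnormM rnormR gtr0_norm // rnorm_expi mulr1. Qed.

Lemma ccont_circ : ccont circ.
Proof. exact: ccontM (ccont_cst _) ccont_expi. Qed.

Lemma ccont_arm : ccont arm.
Proof. exact: ccontB ccont_circ (ccont_cst _). Qed.

Lemma rnorm_arm t : r - rnorm w <= rnorm (arm t).
Proof. by rewrite lerBlDr -{1}(rnorm_circ t) rnorm_subD. Qed.

Lemma arm_neq0 t : arm t != 0.
Proof. by rewrite -rnorm_eq0 gt_eqF // (lt_le_trans _ (rnorm_arm t)) // subr_gt0. Qed.

Lemma ccont_kernel : ccont kernel.
Proof.
apply: ccontM; first exact: ccontM (ccont_cst _) ccont_circ.
exact: ccontV ccont_arm arm_neq0.
Qed.

Lemma rnorm_i : rnorm ('i : C) = 1.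
Proof. by rewrite /rnorm normc_def /= expr0n expr1n add0r sqrtr1. Qed.

Lemma rnorm_kernel t : rnorm (kernel t) <= r / (r - rnorm w).
Proof.
rewrite rnormM rnormV rnormM rnorm_i mul1r rnorm_circ ler_wpM2l ?(ltW r0) //.
rewrite lef_pV2 ?posrE ?subr_gt0 ?rnorm_arm //.
by rewrite lt_neqAle eq_sym rnorm_eq0 arm_neq0 rnorm_ge0.
Qed.

Lemma cint_circ a b : a <= b -> cint (fun t => 'i * circ t) a b = circ b - circ a.
Proof.
move=> ab; apply: cint_FTC => //; first exact: ccontM (ccont_cst _) ccont_circ.
  move=> t; have -> : (fun t : R => complex.Re (circ t)) = (fun t => r * cos t).
    by apply/funext => u; rewrite /circ /= mul0r subr0.
  have -> : complex.Re ('i * circ t) = r * - sin t by rewrite /circ /=; ring.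
  exact: (@is_deriveZ R R R cos r t 1 (- sin t) (is_derive_cos t)).
move=> t; have -> : (fun t : R => complex.Im (circ t)) = (fun t => r * sin t).
  by apply/funext => u; rewrite /circ /= mul0r addr0.
have -> : complex.Im ('i * circ t) = r * cos t by rewrite /circ /=; ring.
exact: (@is_deriveZ R R R sin r t 1 (cos t) (is_derive_sin t)).
Qed.

Lemma circ_lipschitz t t' : rnorm (circ t - circ t') <= 2 * r * `|t - t'|.
Proof.
wlog tt : t t' / t' <= t.
  by move=> h; have [|/ltW] := leP t' t; [exact: h|rewrite rnorm_distC distrC; exact: h].
rewrite -cint_circ // ger0_norm ?subr_ge0 //; apply: cint_bound => //.
  exact: ccontM (ccont_cst _) ccont_circ.
by move=> u _; rewrite rnormM rnorm_i mul1r rnorm_circ.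
Qed.

(* Makes the parametrization total while keeping [radial] in the disk and away from [w]. *)
Definition clamp (s : R) := Num.max s0 (Num.min 1 s).

Lemma clamp_itv s : s0 <= clamp s <= 1.
Proof. by rewrite /clamp le_max lexx ge_max s01 ge_min lexx. Qed.

Lemma clamp_id s : s0 <= s <= 1 -> clamp s = s.
Proof. by move=> /andP[h1 h2]; rewrite /clamp (min_idPr h2) (max_idPr h1). Qed.

Lemma ccont_clamp : ccont (fun s => (clamp s)%:C).
Proof.
split; last by move=> t; exact: cvg_cst.
move=> s; apply: continuous_max; first exact: cvg_cst.
by apply: continuous_min; [exact: cvg_cst|exact: cvg_id].
Qed.

Definition radial s t : C := w + (clamp s)%:C * arm t.

Lemma rnorm_radial s t : rnorm (radial s t) <= r.
Proof.
have /andP[h1 h2] := clamp_itv s.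
have h0 : 0 <= clamp s by apply: le_trans h1; exact: ltW.
(* A convex combination of [w] and a point of the circle. *)
have -> : radial s t = (1 - clamp s)%:C * w + (clamp s)%:C * circ t.
  by rewrite /radial /arm rmorphB rmorph1; ring.
apply: le_trans (rnormD _ _) _; rewrite [rnorm (_ * w)]rnormM [rnorm (_ * circ t)]rnormM.
rewrite rnorm_circ !rnormR !ger0_norm ?subr_ge0 //.
have : (1 - clamp s) * rnorm w <= (1 - clamp s) * r by rewrite ler_wpM2l ?subr_ge0 // ltW.
rewrite mulrBl mul1r; lra.
Qed.

Lemma ccont_radial_s t : ccont (radial^~ t).
Proof. apply: ccontD (ccont_cst _) _; exact: ccontM ccont_clamp (ccont_cst _). Qed.

Lemma ccont_radial_t s : ccont (radial s).
Proof. apply: ccontD (ccont_cst _) _; exact: ccontM (ccont_cst _) ccont_arm. Qed.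

(* The integral of [F dlog(z - w)] around a rectangle in polar coordinates
   [z = radial s t], where [z - w = s * arm t] gives [dlog(z - w) = ds / s + kernel t dt]. *)
Definition boundary (F : R -> R -> C) s1 s2 t1 t2 : C :=
  cint (fun t => (F s2 t - F s1 t) * kernel t) t1 t2 -
  cint (fun s => (F s t2 - F s t1) * (clamp s)%:C^-1) s1 s2.

Definition sepcont (F : R -> R -> C) := (forall s, ccont (F s)) /\ (forall t, ccont (F^~ t)).

Lemma ccont_clampV : ccont (fun s => (clamp s)%:C^-1).
Proof.
apply: ccontV ccont_clamp _ => s; have /andP[h _] := clamp_itv s.
by rewrite -(rmorph0 (real_complex R)) (inj_eq (@complexI _)) gt_eqF // (lt_le_trans s00).
Qed.

Lemma sepcont_t F s1 s2 : sepcont F -> ccont (fun t => (F s2 t - F s1 t) * kernel t).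
Proof. by move=> [F1 _]; apply: ccontM ccont_kernel; exact: ccontB. Qed.

Lemma sepcont_s F t1 t2 : sepcont F -> ccont (fun s => (F s t2 - F s t1) * (clamp s)%:C^-1).
Proof. by move=> [_ F2]; apply: ccontM ccont_clampV; exact: ccontB (F2 _) (F2 _). Qed.

Lemma boundaryB F G s1 s2 t1 t2 : sepcont F -> sepcont G ->
  boundary (fun s t => F s t - G s t) s1 s2 t1 t2 = boundary F s1 s2 t1 t2 - boundary G s1 s2 t1 t2.
Proof.
move=> cF cG; rewrite /boundary.
have -> : cint (fun t => (F s2 t - G s2 t - (F s1 t - G s1 t)) * kernel t) t1 t2 =
   cint (fun t => (F s2 t - F s1 t) * kernel t) t1 t2 - cint (fun t => (G s2 t - G s1 t) * kernel t) t1 t2.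
  rewrite -cintB; [|exact: sepcont_t|exact: sepcont_t].
  by apply: eq_cint => t _; ring.
have -> : cint (fun s => (F s t2 - G s t2 - (F s t1 - G s t1)) * (clamp s)%:C^-1) s1 s2 =
   cint (fun s => (F s t2 - F s t1) * (clamp s)%:C^-1) s1 s2 -
   cint (fun s => (G s t2 - G s t1) * (clamp s)%:C^-1) s1 s2.
  rewrite -cintB; [|exact: sepcont_s|exact: sepcont_s].
  by apply: eq_cint => t _; rewrite -mulrBl; congr (_ * _); rewrite !opprB; ring.
by move: (cint _ t1 t2) (cint _ t1 t2) (cint _ s1 s2) (cint _ s1 s2) => *; ring.
Qed.

Lemma boundary_bound F (m : R) s1 s2 t1 t2 : sepcont F -> s1 <= s2 -> t1 <= t2 ->
  (forall s t, s1 <= s <= s2 -> t1 <= t <= t2 -> rnorm (F s t) <= m) ->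
  rnorm (boundary F s1 s2 t1 t2) <=
  4 * m * (r / (r - rnorm w) + s0^-1) * ((s2 - s1) + (t2 - t1)).
Proof.
move=> cF s12 t12 hm.
have ds : 0 <= s2 - s1 by rewrite subr_ge0.
have dt : 0 <= t2 - t1 by rewrite subr_ge0.
have m0 : 0 <= m by apply: le_trans (hm s1 t1 _ _); rewrite ?rnorm_ge0 ?lexx ?s12 ?t12.
set k := r / (r - rnorm w).
have k0 : 0 <= k by rewrite divr_ge0 ?(ltW r0) // subr_ge0 ltW.
have s0V : 0 <= s0^-1 by rewrite invr_ge0 ltW.
have b1 : rnorm (cint (fun t => (F s2 t - F s1 t) * kernel t) t1 t2) <= 2 * (2 * m * k) * (t2 - t1).
  apply: cint_bound => //; first exact: sepcont_t.
  move=> t ht; rewrite rnormM ler_pM ?rnorm_ge0 ?rnorm_kernel //.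
  by apply: le_trans (rnormB _ _) _; rewrite mulr_natl mulr2n; apply: lerD; apply: hm => //; rewrite lexx s12.
have b2 : rnorm (cint (fun s => (F s t2 - F s t1) * (clamp s)%:C^-1) s1 s2) <= 2 * (2 * m * s0^-1) * (s2 - s1).
  apply: cint_bound => //; first exact: sepcont_s.
  move=> s hs; rewrite rnormM ler_pM ?rnorm_ge0 //.
    by apply: le_trans (rnormB _ _) _; rewrite mulr_natl mulr2n; apply: lerD; apply: hm => //; rewrite lexx t12.
  have /andP[h1 _] := clamp_itv s; have h0 := lt_le_trans s00 h1.
  by rewrite rnormV rnormR gtr0_norm // lef_pV2.
apply: le_trans (rnormB _ _) _; apply: (le_trans (lerD b1 b2)).
have e1 : 0 <= m * k * (s2 - s1) by rewrite mulr_ge0 // mulr_ge0.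
have e2 : 0 <= m * s0^-1 * (t2 - t1) by rewrite mulr_ge0 // mulr_ge0.
have -> : 4 * m * (k + s0^-1) * (s2 - s1 + (t2 - t1)) =
  2 * (2 * m * k) * (t2 - t1) + 2 * (2 * m * s0^-1) * (s2 - s1) + 4 * (m * k * (s2 - s1)) + 4 * (m * s0^-1 * (t2 - t1)) by ring.
lra.
Qed.

Let affine (c L : C) s t := c + L * radial s t.

Lemma affine_sepcont c L : sepcont (affine c L).
Proof.
split=> [s|t]; apply: ccontD (ccont_cst _) _; apply: ccontM (ccont_cst _) _.
  exact: ccont_radial_t.
exact: ccont_radial_s.
Qed.

(** Both edge integrals equal [L * (s2 - s1) * (circ t2 - circ t1)]: the factors [arm] and [s]
    cancel against the kernel and against [1 / s]. *)
Lemma boundary_affine c L s1 s2 t1 t2 : s0 <= s1 -> s1 <= s2 -> s2 <= 1 -> t1 <= t2 ->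
  boundary (affine c L) s1 s2 t1 t2 = 0.
Proof.
move=> h1 h2 h3 t12; rewrite /boundary.
have c1 : clamp s1 = s1 by rewrite clamp_id // h1 (le_trans h2).
have c2 : clamp s2 = s2 by rewrite clamp_id // h3 (le_trans h1).
have -> : cint (fun t => (affine c L s2 t - affine c L s1 t) * kernel t) t1 t2 =
   L * (s2 - s1)%:C * (circ t2 - circ t1).
  rewrite -cint_circ // -cintZ; last exact: ccontM (ccont_cst _) ccont_circ.
  apply: eq_cint => t _; rewrite /affine /radial c1 c2 /kernel rmorphB.
  by field; exact: arm_neq0.
have -> : cint (fun s => (affine c L s t2 - affine c L s t1) * (clamp s)%:C^-1) s1 s2 =
   cint (fun=> L * (circ t2 - circ t1)) s1 s2.
  apply: eq_cint => s _; rewrite /affine /radial /arm.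
  field; rewrite -(rmorph0 (real_complex R)) (inj_eq (@complexI _)) gt_eqF //.
  by have /andP[h _] := clamp_itv s; exact: lt_le_trans h.
by rewrite cint_cst // mulrAC subrr.
Qed.

Variable f : C -> C.
Hypothesis hf : holo f.
Let F s t := f (radial s t).

Lemma holo_sepcont : sepcont F.
Proof.
have rad1 s t : rnorm (radial s t) < 1 by apply: le_lt_trans r1; exact: rnorm_radial.
split=> [s|t]; first exact: holo_ccont hf (ccont_radial_t s) _.
exact: holo_ccont hf (ccont_radial_s t) _.
Qed.

Lemma goursat_boundary : boundary F s0 1 0 (pi *+ 2) = 0.
Proof.
have cF := holo_sepcont.
apply: (additive_rectangle_eq0 (B := boundary F)) => //.
- move=> s1 m s2 t1 t2 a1 a2 a3 a4 b1 b2 b3; rewrite /boundary.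
  rewrite (cint_split (sepcont_s t1 t2 cF) a2 a3) opprD addrACA -cintD; try exact: sepcont_t.
  by congr (_ + _); apply: eq_cint => t _; ring.
- move=> s1 s2 t1 m t2 a1 a2 a3 b1 b2 b3 b4; rewrite /boundary.
  rewrite (cint_split (sepcont_t s1 s2 cF) b2 b3).
  rewrite addrACA -opprD -cintD; try exact: sepcont_s.
  by congr (_ - _); apply: eq_cint => s _; rewrite -mulrDl; congr (_ * _); ring.
- by rewrite mulrn_wge0 // pi_ge0.
move=> s t /andP[sa sb] /andP[ta tb] e e0.
have [L hL] := hf (le_lt_trans (rnorm_radial s t) r1).
set k := r / (r - rnorm w) + s0^-1.
have k0 : 0 < k.
  by rewrite ltr_wpDl ?invr_gt0 // divr_ge0 ?(ltW r0) // subr_ge0 ltW.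
(* Points of a rectangle of size [h] are within [2 h], so the remainder is at most
   [e / (8 k) * 2 h], and [boundary_bound] turns this into exactly [e h^2]. *)
have [|d d0 hd] := hL (e / (8 * k)); first by rewrite divr_gt0 // mulr_gt0.
exists (d / 4); first by rewrite divr_gt0.
move=> s1 s2 t1 t2 a1 a2 b1 b2 /andP[s1s ss2] /andP[t1t tt2] ds dt.
have s12 : s1 <= s2 by apply: le_trans ss2.
have t12 : t1 <= t2 by apply: le_trans tt2.
set h := s2 - s1 + (t2 - t1).
(* Makes [affine c L] the first-order expansion of [f] at [radial s t]; its boundary integral
   vanishes and can be subtracted. *)
pose c := f (radial s t) - L * radial s t.
have -> : boundary F s1 s2 t1 t2 = boundary (fun s t => F s t - affine c L s t) s1 s2 t1 t2.
  by rewrite boundaryB ?boundary_affine ?subr0 //; exact: affine_sepcont.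
have h0 : 0 <= h by rewrite addr_ge0 ?subr_ge0.
have -> : e * h ^+ 2 = 4 * (e / (8 * k) * (2 * h)) * k * h by field; rewrite gt_eqF.
apply: boundary_bound => //.
  by have [f1 f2] := cF; have [g1 g2] := affine_sepcont c L; split=> u; exact: ccontB.
move=> s' t' /andP[s1' s2'] /andP[t1' t2'].
have dist : rnorm (radial s' t' - radial s t) <= 2 * h.
  have cs : clamp s = s by rewrite clamp_id // sa.
  have cs' : clamp s' = s'.
    by rewrite clamp_id // (le_trans a1 s1') (le_trans s2' a2).
  rewrite /radial cs cs'.
  (* The displacement is split into a move along the arm, of length at most 2, and a move along the
     circle. *)
  have -> : w + s'%:C * arm t' - (w + s%:C * arm t) = (s' - s)%:C * arm t' + s%:C * (circ t' - circ t).
    by rewrite rmorphB /arm; ring.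
  apply: le_trans (rnormD _ _) _; rewrite !rnormM !rnormR.
  have e1 : `|s' - s| * rnorm (arm t') <= (s2 - s1) * 2.
    apply: ler_pM; rewrite ?rnorm_ge0 //; first by rewrite ler_norml; apply/andP; split; lra.
    have : rnorm (arm t') <= rnorm (circ t') + rnorm w := rnormB _ _.
    rewrite rnorm_circ; move: wr r1; lra.
  have e2 : `|s| * rnorm (circ t' - circ t) <= 1 * (2 * (t2 - t1)).
    apply: ler_pM; rewrite ?rnorm_ge0 //; first by rewrite ler_norml; apply/andP; split; move: s00; lra.
    apply: le_trans (circ_lipschitz _ _) _.
    rewrite -mulrA ler_wpM2l // -[X in _ <= X]mul1r ler_pM ?(ltW r0) ?(ltW r1) //.
    by rewrite ler_norml; apply/andP; split; lra.
  by apply: (le_trans (lerD e1 e2)); rewrite /h; lra.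
have -> : F s' t' - affine c L s' t' = f (radial s' t') - f (radial s t) - L * (radial s' t' - radial s t).
  by rewrite /F /affine /c; ring.
apply: le_trans (hd _ _) _; first by apply: le_lt_trans dist _; rewrite /h; lra.
by rewrite ler_wpM2l // divr_ge0 ?(ltW e0) // mulr_ge0 // ltW.
Qed.

(** The edges [t = 0] and [t = 2 pi] are the same segment and cancel, leaving the outer and the
    inner circle. *)
Lemma cauchy_radial :
  cint (fun t => f (circ t) * kernel t) 0 (pi *+ 2) =
  cint (fun t => f (w + s0%:C * arm t) * kernel t) 0 (pi *+ 2).
Proof.
have := goursat_boundary; rewrite /boundary.
have -> : cint (fun s => (F s (pi *+ 2) - F s 0) * (clamp s)%:C^-1) s0 1 = 0.
  have -> : 0 = cint (fun=> (0 : C)) s0 1 by rewrite cint_cst // mul0r.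
  by apply: eq_cint => s _; rewrite /F /radial /arm /circ expi2pi subrr mul0r.
have c0 : clamp s0 = s0 by rewrite clamp_id // lexx.
have c1 : clamp 1 = 1 by rewrite clamp_id // lexx s01.
have [cF _] := holo_sepcont.
rewrite subr0 (eq_cint (v := fun t => F 1 t * kernel t - F s0 t * kernel t)); last first.
  by move=> t _; rewrite mulrBl.
rewrite cintB; [|exact: ccontM (cF _) ccont_kernel|exact: ccontM (cF _) ccont_kernel].
move/eqP; rewrite subr_eq0 => /eqP; rewrite /F /radial c0 c1 => <-.
by apply: eq_cint => t _; rewrite rmorph1 mul1r /arm addrC subrK.
Qed.

End Circle.

End Goursat.

(** * Cauchy's formula and Taylor expansion with remainder *)

Section Cauchy.
Context {R : realType}.
Local Notation C := R[i].

(** The second-order remainder of a power. The factor [rho ^+ 2] on the left stands for [rho^(n-2)]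
    on the right, which would be awkward for [n < 2]. *)
Lemma expr_remainder (z z' : C) (rho : R) n : 0 < rho -> rnorm z <= rho -> rnorm z' <= rho ->
  rho ^+ 2 * rnorm (z' ^+ n - z ^+ n - n%:R * z ^+ n.-1 * (z' - z)) <=
  (n ^ 2)%:R * rho ^+ n * rnorm (z' - z) ^+ 2.
Proof.
move=> rho0 hz hz'; have r0 := ltW rho0; set h := z' - z.
elim: n => [|n IH]; first by rewrite !expr0 subrr !mul0r subr0 rnorm0 mulr0.
(* The remainders obey [R_(n+1) = z' R_n + n z^(n-1) h^2], and [n^2 + n <= (n+1)^2] closes the
   induction. *)
have -> : z' ^+ n.+1 - z ^+ n.+1 - n.+1%:R * z ^+ n.+1.-1 * h =
    z' * (z' ^+ n - z ^+ n - n%:R * z ^+ n.-1 * h) + n%:R * z ^+ n.-1 * h ^+ 2.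
  rewrite /h -natr1; case: n {IH} => [|n] /=; first by rewrite !expr1 !expr0; ring.
  by rewrite !(exprS z) !(exprS z') /=; ring.
have h2 : 0 <= rnorm h ^+ 2 by exact: sqr_ge0.
have e1 : rho ^+ 2 * rnorm (z' * (z' ^+ n - z ^+ n - n%:R * z ^+ n.-1 * h)) <=
    rho * ((n ^ 2)%:R * rho ^+ n * rnorm h ^+ 2).
  by rewrite rnormM mulrCA; apply: ler_pM; rewrite ?rnorm_ge0 // mulr_ge0 ?sqr_ge0 ?rnorm_ge0.
have e2 : rho ^+ 2 * rnorm (n%:R * z ^+ n.-1 * h ^+ 2) <= n%:R * rho ^+ n.+1 * rnorm h ^+ 2.
  case: n {IH e1} => [|n]; first by rewrite !mul0r rnorm0 mulr0.
  rewrite [rnorm (_ * h ^+ 2)]rnormM [rnorm (_ * z ^+ _)]rnormM rnorm_nat !rnormX /=.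
  rewrite mulrA; apply: ler_wpM2r => //.
  rewrite mulrCA ler_wpM2l // -[n.+2]add2n exprD ler_wpM2l ?sqr_ge0 //.
  by rewrite lerXn2r // nnegrE rnorm_ge0.
have := le_trans (ler_wpM2l (sqr_ge0 rho) (rnormD _ _)) _; apply.
rewrite mulrDr; apply: (le_trans (lerD e1 e2)).
have -> : rho * ((n ^ 2)%:R * rho ^+ n * rnorm h ^+ 2) + n%:R * rho ^+ n.+1 * rnorm h ^+ 2 =
    ((n ^ 2)%:R + n%:R) * (rho ^+ n.+1 * rnorm h ^+ 2) by rewrite (exprS rho n); ring.
rewrite -[X in _ <= X]mulrA ler_wpM2r //; first by rewrite mulr_ge0 // exprn_ge0.
by rewrite -natrD ler_nat -mulnn -mulSnr mulnC -mulnn leq_mul2r leqnSn orbT.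
Qed.

Lemma holo_expr n : holo (fun z : C => z ^+ n).
Proof.
move=> z z1; exists (n%:R * z ^+ n.-1) => e e0.
pose D : R := (n ^ 2)%:R * 2 ^+ n.
have D0 : 0 <= D by rewrite mulr_ge0 // exprn_ge0.
have De : 0 < e / (D + 1) by rewrite divr_gt0 // ltr_wpDl.
exists (Num.min 1 (e / (D + 1))); first by rewrite lt_min ltr01 De.
move=> z'; rewrite lt_min => /andP[h1 h2].
have hz : rnorm z <= 2 by apply: ltW; apply: lt_trans z1 _; rewrite ltr1n.
have hz' : rnorm z' <= 2.
  apply: le_trans (rnorm_subD _ z) _; have -> : (2 : R) = 1 + 1 by rewrite -natr1.
  by apply: lerD; exact: ltW.
have := expr_remainder n (ltr0Sn R 1) hz hz'; rewrite -/D.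
set x := rnorm (_ - _ - _) => hx.
have x0 : 0 <= x by exact: rnorm_ge0.
have p0 := rnorm_ge0 (z' - z).
have {}hx : x <= D * rnorm (z' - z) ^+ 2 by apply: le_trans hx; rewrite ler_peMl // expr_ge1 // ler1n.
apply: (le_trans hx); rewrite expr2 mulrA ler_wpM2r //.
rewrite ltr_pdivlMr ?ltr_wpDl // in h2; apply: le_trans (ltW h2).
by rewrite mulrC ler_wpM2l // lerDl.
Qed.

Lemma ccont_conj (u : R -> C) : ccont u -> ccont (fun t => (u t)^*).
Proof.
move=> /ccontP cu; apply/ccontP => t e e0; have := cu t e e0; apply: filterS => t' h.
by rewrite -rmorphB rnorm_conj.
Qed.

Lemma cint_conj (u : R -> C) a b : ccont u -> cint (fun t => (u t)^*) a b = (cint u a b)^*.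
Proof.
move=> [u1 u2]; rewrite /cint /=; congr (_ +i* _).
  by apply: eq_rint => t _; case: (u t).
rewrite -mulN1r -rintZ //; apply: eq_rint => t _; case: (u t) => x y /=; by rewrite mulN1r.
Qed.

Section Radius.
Variable r : R.
Hypothesis r0 : 0 < r.
Hypothesis r1 : r < 1.

Let p2 : R := pi *+ 2.
Let p20 : 0 <= p2. Proof. by rewrite mulrn_wge0 // pi_ge0. Qed.
Let p2n : p2 != 0. Proof. by rewrite gt_eqF // pmulrn_lgt0 // pi_gt0. Qed.
Let p2Cn : p2%:C != 0. Proof. by rewrite -(rmorph0 (real_complex R)) (inj_eq (@complexI _)). Qed.
Let in0 : ('i : C) != 0. Proof. by rewrite -rnorm_eq0 rnorm_i oner_neq0. Qed.

Lemma circ_neq0 t : circ r t != 0 :> C.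
Proof. by rewrite -rnorm_eq0 (@rnorm_circ _ 0) ?rnorm0 // gt_eqF. Qed.

(** The inner circle shrinks to [w]. The integral of the kernel is left unevaluated here; it is
    compared with [2 pi i] in [cauchy_taylor]. *)
Lemma cauchy_formula f w : holo f -> rnorm w < r ->
  f w * cint (kernel w r) 0 p2 = cint (fun t => f (circ r t) * kernel w r t) 0 p2.
Proof.
move=> hf wr; apply/eqP; rewrite eq_sym -subr_eq0 -rnorm_eq0 eq_le rnorm_ge0 andbT.
apply/ler_addgt0Pr => e e0; rewrite add0r.
have [L hL] := hf _ (lt_trans wr r1); have [d d0 hd] := hL 1 ltr01.
pose k := r / (r - rnorm w); pose X := 4 * (rnorm L + 1) * k * p2.
have k0 : 0 <= k by rewrite divr_ge0 ?(ltW r0) // subr_ge0 ltW.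
have L0 : 0 <= rnorm L + 1 by rewrite addr_ge0 ?rnorm_ge0.
have X0 : 0 <= X by rewrite mulr_ge0 // mulr_ge0 // mulr_ge0.
(* [d / 4] keeps the inner circle where [f] is Lipschitz at [w] with constant [|L| + 1];
   [e / (X + 1)] makes the error [s0 * X] at most [e]. *)
pose s0 := Num.min 1 (Num.min (d / 4) (e / (X + 1))).
have s00 : 0 < s0 by rewrite !lt_min ltr01 !divr_gt0 // ltr_wpDl.
have s01 : s0 <= 1 by rewrite ge_min lexx.
have s0d : s0 <= d / 4 by rewrite !ge_min lexx orbT.
have s0e : s0 <= e / (X + 1) by rewrite !ge_min lexx !orbT.
rewrite (cauchy_radial wr r1 s00 s01 hf) -cintZ; last exact: ccont_kernel.
have c1 : ccont (fun t => f (w + s0%:C * arm w r t)).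
  apply: holo_ccont hf _ _; first exact: ccontD (ccont_cst _) (ccontM (ccont_cst _) (ccont_arm _ _)).
  move=> t; have := rnorm_radial wr s00 s01 s0 t; rewrite /radial clamp_id ?lexx // => h.
  exact: le_lt_trans h r1.
have ck := ccont_kernel wr.
rewrite -cintB; [|exact: ccontM c1 ck|exact: ccontM (ccont_cst _) ck].
apply: (@le_trans _ _ (2 * ((rnorm L + 1) * (s0 * 2) * k) * (p2 - 0))).
  apply: cint_bound => //.
    by apply: ccontB; [exact: ccontM c1 ck|exact: ccontM (ccont_cst _) ck].
  move=> t _; rewrite -mulrBl rnormM; apply: ler_pM; rewrite ?rnorm_ge0 ?rnorm_kernel //.
  set z' := w + _.
  have zw : z' - w = s0%:C * arm w r t by rewrite /z' addrC addKr.
  have nz : rnorm (z' - w) <= s0 * 2.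
    rewrite zw rnormM rnormR gtr0_norm // ler_wpM2l ?(ltW s00) //.
    have : rnorm (arm w r t) <= rnorm (circ r t) + rnorm w := rnormB _ _.
    rewrite (rnorm_circ wr); move: wr r1; lra.
  apply: (@le_trans _ _ ((rnorm L + 1) * rnorm (z' - w))); last by rewrite ler_wpM2l.
  have := hd z'; rewrite (le_lt_trans nz) ?mul1r; last by move: s0d d0; lra.
  move=> /(_ isT) h; apply: le_trans (rnorm_subD _ (L * (z' - w))) _.
  by rewrite rnormM mulrDl mul1r addrC lerD2l.
rewrite subr0 ler_pdivlMr ?ltr_wpDl // in s0e *; apply: le_trans s0e.
have -> : 2 * ((rnorm L + 1) * (s0 * 2) * k) * p2 = s0 * X by rewrite /X; ring.
by rewrite ler_wpM2l ?(ltW s00) // lerDl.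
Qed.

(** Cauchy's formula for [z^n] at the centre 0, where the kernel is the constant ['i]. *)
Lemma cint_circX n : (0 < n)%N -> cint (fun t => circ r t ^+ n : C) 0 p2 = 0.
Proof.
move=> n0; have z0 : rnorm (0 : C) < r by rewrite rnorm0.
have := cauchy_formula (holo_expr n) z0; rewrite expr0n gtn_eqF // mul0r.
rewrite (eq_cint (v := fun t => 'i * circ r t ^+ n)); last first.
  by move=> t _; rewrite /kernel /arm subr0 mulfK ?circ_neq0 // mulrC.
rewrite cintZ; last exact: ccontX (ccont_circ _).
by move/esym/eqP; rewrite mulf_eq0 (negPf in0) => /eqP.
Qed.

Lemma cint_circVX n : (0 < n)%N -> cint (fun t => circ r t ^- n : C) 0 p2 = 0.
Proof.
move=> n0; have cX := @ccontX _ _ n (ccont_circ r).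
(* On the circle [1 / z] is a multiple of the conjugate of [z], which reduces negative powers to
   positive ones. *)
have E t : (circ r t : C) ^- n = (r ^- (n + n))%:C * (circ r t ^+ n)^*.
  have h : (circ r t : C) ^+ n * (circ r t ^+ n)^* = (r ^+ (n + n))%:C.
    by rewrite rnormCK rnormX (@rnorm_circ _ 0) ?rnorm0 // -exprM muln2 addnn.
  apply: (mulfI (expf_neq0 n (circ_neq0 t))); rewrite divff ?expf_neq0 ?circ_neq0 //.
  by rewrite mulrCA h -rmorphM mulVf ?rmorph1 // expf_neq0 // gt_eqF.
rewrite (eq_cint (fun t _ => E t)) cintZ; last first.
  exact: ccont_conj.
by rewrite cint_conj // cint_circX // rmorph0 mulr0.
Qed.

Definition cauchy_coef (f : C -> C) n : C := p2^-1%:C * cint (fun t => f (circ r t) * circ r t ^- n) 0 p2.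

Lemma ccont_circV n : ccont (fun t => circ r t ^- n : C).
Proof.
by apply: ccontV; [exact: ccontX (ccont_circ _)|move=> t; rewrite expf_neq0 ?circ_neq0].
Qed.

(** The kernel is a finite geometric sum in [w / z] plus [(w / z)^N] times itself. It is stated for
    functions continuous on the circle so as to cover both [f] and the constant 1. *)
Lemma cauchy_expansion f w N M : ccont (fun t => f (circ r t)) -> rnorm w < r ->
  (forall t, rnorm (f (circ r t)) <= M) ->
  rnorm (cint (fun t => f (circ r t) * kernel w r t) 0 p2 - 'i * p2%:C * psum (cauchy_coef f) N w) <=
  2 * (M * (rnorm w / r) ^+ N * (r / (r - rnorm w))) * p2.
Proof.
move=> cf wr hM.
pose rest t := f (circ r t) * (w ^+ N * circ r t ^- N * kernel w r t).
pose term n t := f (circ r t) * ('i * w ^+ n * circ r t ^- n).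
have ct (i : 'I_N) : ccont (term i).
  by apply: ccontM cf _; apply: ccontM (ccont_cst _) _; exact: ccont_circV.
have cr : ccont rest.
  apply: ccontM cf _; apply: ccontM (ccont_kernel wr).
  by apply: ccontM (ccont_cst _) _; exact: ccont_circV.
have [cs es] := cint_sum 0 p2 ct.
have E t : f (circ r t) * kernel w r t = \sum_(i < N) term i t + rest t.
  rewrite -mulr_sumr -mulrDr; congr (_ * _).
  have wz : circ r t - w != 0 by exact: arm_neq0 wr t.
  have zn := circ_neq0 t.
  have G : (\sum_(i < N) w ^+ i * circ r t ^- i) * (circ r t - w) = circ r t * (1 - w ^+ N * circ r t ^- N).
    have := subrX1 (w / circ r t) N; rewrite exprMn exprVn => h.
    transitivity (- ((w / circ r t - 1) * \sum_(i < N) (w / circ r t) ^+ i) * circ r t).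
      under eq_bigr => i _ do rewrite -exprVn -exprMn.
      by rewrite mulrC; field.
    by rewrite -h; ring.
  have -> : \sum_(i < N) 'i * w ^+ i * circ r t ^- i = 'i * (\sum_(i < N) w ^+ i * circ r t ^- i).
    by rewrite mulr_sumr; apply: eq_bigr => i _; rewrite mulrA.
  have kE : kernel w r t * (circ r t - w) = 'i * circ r t by rewrite /kernel divfK.
  apply: (mulIf wz); rewrite [RHS]mulrDl -['i * _ * (circ r t - w)]mulrA G.
  by rewrite -[_ * kernel w r t * _]mulrA kE; move: (w ^+ N / _) => q; ring.
rewrite (eq_cint (fun t _ => E t)) cintD // es.
have -> : \sum_(i < N) cint (term i) 0 p2 = 'i * p2%:C * psum (cauchy_coef f) N w.
  rewrite /psum mulr_sumr; apply: eq_bigr => i _; rewrite /cauchy_coef.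
  rewrite (eq_cint (v := fun t => ('i * w ^+ i) * (f (circ r t) * circ r t ^- i))); last first.
    by move=> t _; rewrite /term; ring.
  rewrite cintZ; last by apply: ccontM cf _; exact: ccont_circV.
  have P : p2%:C * p2^-1%:C = 1 :> C by rewrite -rmorphM divff.
  by move: (cint _ 0 p2) => I; rewrite -[RHS]mulrA !mulrA -['i * _ * _]mulrA P; ring.
rewrite addrAC subrr add0r -[X in _ <= _ * X]subr0; apply: cint_bound => // t _.
have q : rnorm (w ^+ N * circ r t ^- N) = (rnorm w / r) ^+ N.
  by rewrite rnormM rnormV !rnormX (rnorm_circ wr) -exprVn -exprMn.
have q0 : 0 <= (rnorm w / r) ^+ N by rewrite -q rnorm_ge0.
rewrite /rest rnormM [rnorm (_ * kernel w r t)]rnormM q -mulrA.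
by apply: ler_pM; rewrite ?rnorm_ge0 ?mulr_ge0 ?rnorm_ge0 // ler_wpM2l ?rnorm_kernel.
Qed.

Lemma cauchy_coef_le f n M : ccont (fun t => f (circ r t)) ->
  (forall t, rnorm (f (circ r t)) <= M) -> rnorm (cauchy_coef f n) <= 2 * M * r ^- n.
Proof.
move=> cf hM; rewrite /cauchy_coef rnormM rnormR ger0_norm ?invr_ge0 //.
rewrite mulrC ler_pdivrMr; last by rewrite lt_neqAle eq_sym p2n p20.
rewrite -{2}[p2]subr0 -[2 * M * _]mulrA; apply: cint_bound => //.
  by apply: ccontM cf _; exact: ccont_circV.
move=> t _; rewrite rnormM ler_pM ?rnorm_ge0 //.
by rewrite rnormV rnormX (@rnorm_circ _ 0) ?rnorm0.
Qed.

(** The expansion is used twice: for [f], and for the constant 1, where it shows that the integral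
    of the kernel is [2 pi i] up to the same geometric error. The two errors add up to the constant
    4. *)
Lemma cauchy_taylor f w N (M : R) : holo f -> rnorm w < r ->
  (forall z, rnorm z <= r -> rnorm (f z) <= M) ->
  rnorm (f w - psum (cauchy_coef f) N.+1 w) <=
  4 * M * (r / (r - rnorm w)) * (rnorm w / r) ^+ N.+1.
Proof.
move=> hf wr hM.
have cf : ccont (fun t => f (circ r t)).
  apply: holo_ccont hf (ccont_circ r) _ => t; rewrite (rnorm_circ wr) //.
have hMc t : rnorm (f (circ r t)) <= M by apply: hM; rewrite (rnorm_circ wr).
have h1 := cauchy_expansion N.+1 cf wr hMc.
have c1 : ccont (fun t => (fun=> 1 : C) (circ r t)) by exact: ccont_cst.
have one_le (t : R) : rnorm (1 : C) <= 1 by rewrite rnorm1.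
have h2 := @cauchy_expansion (fun=> 1) w N.+1 1 c1 wr one_le.
have E1 : psum (cauchy_coef (fun=> 1)) N.+1 w = 1.
  rewrite /psum big_ord_recl expr0 mulr1 big1 ?addr0.
    rewrite /cauchy_coef (eq_cint (v := fun=> 1)); last by move=> t _; rewrite expr0 invr1 mulr1.
    by rewrite cint_cst // subr0 mul1r fmorphV mulVf.
  move=> i _; rewrite /cauchy_coef (eq_cint (v := fun t => circ r t ^- (lift ord0 i))).
    by rewrite cint_circVX // mulr0 mul0r.
  by move=> t _; rewrite mul1r.
rewrite E1 mulr1 (eq_cint (v := kernel w r)) in h2; last by move=> t _; rewrite mul1r.
rewrite -(cauchy_formula hf wr) in h1.
set q := (rnorm w / r) ^+ N.+1 in h1 h2 *; set k := r / (r - rnorm w) in h1 h2 *.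
set S := psum _ _ _ in h1 *; set c := cint _ _ _ in h1 h2.
have M0 : 0 <= M by apply: le_trans (hM w (ltW wr)); exact: rnorm_ge0.
have E : 'i * p2%:C * (f w - S) = (f w * c - 'i * p2%:C * S) - f w * (c - 'i * p2%:C) by ring.
have : p2 * rnorm (f w - S) <= p2 * (4 * M * k * q).
  have -> : p2 * rnorm (f w - S) = rnorm ('i * p2%:C * (f w - S)).
    by rewrite rnormM [rnorm ('i * _)]rnormM rnorm_i mul1r rnormR ger0_norm.
  rewrite E; apply: le_trans (rnormB _ _) _; rewrite [rnorm (_ * (c - _))]rnormM.
  have h3 : rnorm (f w) * rnorm (c - 'i * p2%:C) <= M * (2 * (1 * q * k) * p2).
    by apply: ler_pM; rewrite ?rnorm_ge0 // hM // ltW.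
  apply: (le_trans (lerD h1 h3)).
  by rewrite le_eqVlt; apply/orP; left; apply/eqP; ring.
by rewrite ler_pM2l // lt_neqAle eq_sym p2n p20.
Qed.

End Radius.

End Cauchy.
(** * Taylor series in the disk algebra *)

Section PowerSeries.
Context {R : realType}.
Local Notation C := R[i].
Local Notation Co := (R[i]^o).
Implicit Types (f : Co -> Co) (a : nat -> C).

Lemma complex_complete (u : nat -> C) :
  (forall e : R, 0 < e -> exists N, forall m n, (N <= m)%N -> (N <= n)%N -> rnorm (u m - u n) <= e) ->
  exists v, forall e : R, 0 < e -> exists N, forall n, (N <= n)%N -> rnorm (v - u n) <= e.
Proof.
move=> hu.
have real_complete (x : nat -> R) :
    (forall e : R, 0 < e -> exists N, forall m n, (N <= m)%N -> (N <= n)%N -> `|x m - x n| <= e) ->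
    exists y, forall e : R, 0 < e -> exists N, forall n, (N <= n)%N -> `|y - x n| <= e.
  move=> hx; have cx : cvg (x @ \oo).
    apply/cauchy_cvgP/cauchy_exP => e e0.
    have [|N hN] := hx (e / 2); first by rewrite divr_gt0.
    exists (x N); exists N => // n /= Nn; rewrite -ball_normE /=.
    by apply: le_lt_trans (hN _ _ _ Nn) _ => //; rewrite ltr_pdivrMr // ltr_pMr // ltr1n.
  exists (lim (x @ \oo)) => e e0.
  by have /cvgrPdist_le /(_ e e0) [N _ hN] := cx; exists N.
have [|y1 h1] := real_complete (fun n => complex.Re (u n)).
  move=> e e0; have [N hN] := hu e e0; exists N => m n Nm Nn.
  by rewrite -raddfB; apply: le_trans (hN m n Nm Nn); case: (ReIm_le_rnorm (u m - u n)).
have [|y2 h2] := real_complete (fun n => complex.Im (u n)).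
  move=> e e0; have [N hN] := hu e e0; exists N => m n Nm Nn.
  by rewrite -raddfB; apply: le_trans (hN m n Nm Nn); case: (ReIm_le_rnorm (u m - u n)).
exists (y1 +i* y2) => e e0; have e2 : 0 < e / 2 by rewrite divr_gt0.
have [N1 k1] := h1 _ e2; have [N2 k2] := h2 _ e2.
exists (maxn N1 N2) => n; rewrite geq_max => /andP[n1 n2].
by apply: le_trans (rnorm_le_ReIm _) _; rewrite !raddfB [e]splitr; apply: lerD; [exact: k1|exact: k2].
Qed.

Lemma dnbhs0P (P : Co -> Prop) : (\forall h \near (0 : Co)^', P h) <->
  exists2 d : R, 0 < d & forall h : Co, h != 0 -> rnorm h < d -> P h.
Proof.
split=> [/nbhs_ballP [d /= d0 hd]|[d d0 hd]].
  have dE : d = (complex.Re d)%:C by rewrite RRe_real // gtr0_real.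
  rewrite dE ltcR in d0; exists (complex.Re d) => // h h0 hh.
  by apply: hd; rewrite // -ball_normE /= sub0r normrN rnormE dE ltcR.
apply/nbhs_ballP; exists d%:C; first by rewrite /= ltcR.
by move=> h; rewrite -ball_normE /= sub0r normrN rnormE ltcR => hh h0; exact: hd.
Qed.

Lemma complex_cvgP (T : Type) (F : set_system T) (FF : Filter F) (u : T -> Co) (y : Co) :
  u x @[x --> F] --> y <-> forall e : R, 0 < e -> \forall x \near F, rnorm (y - u x) <= e.
Proof.
rewrite cvgrPdist_le; split=> h e e0.
  have := h e%:C; rewrite ltcR => /(_ e0); apply: filterS => x.
  by rewrite rnormE lecR.
have ee : e = (complex.Re e)%:C by rewrite RRe_real // gtr0_real.
rewrite ee ltcR in e0; have := h _ e0; apply: filterS => x.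
by rewrite rnormE ee lecR.
Qed.

Lemma holomorphic_disk_holo f : holomorphic_disk f -> holo f.
Proof.
move=> hf z z1; have := hf z; rewrite open_disk_rnorm => /(_ z1); rewrite /derivable.
set q := (X in cvg X) => cq; exists (lim q) => e e0.
have /complex_cvgP/(_ e e0) := cq.
move=> /dnbhs0P [d d0 hd]; exists d => // z' hz'.
have [->|zz] := eqVneq z' z; first by rewrite !subrr mulr0 subrr rnorm0 mulr0.
have h0 : z' - z != 0 by rewrite subr_eq0.
have := hd _ h0 hz'; rewrite /= [_ *: 1]mulr1 subrK rnorm_distC => h.
have -> : f z' - f z - lim q * (z' - z) = (z' - z) * ((z' - z)^-1 *: (f z' - f z) - lim q).
  rewrite [RHS]mulrBr (_ : (z' - z)^-1 *: (f z' - f z) = (z' - z)^-1 * (f z' - f z)) //.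
  by rewrite mulVKf // [_ * lim q]mulrC.
by rewrite rnormM mulrC ler_wpM2r ?rnorm_ge0.
Qed.

(** The bound on [a n * rho^n] gives the geometric decay on smaller disks needed to differentiate
    term by term. *)
Definition power_series f a (rho : R) :=
  (exists B, forall n, rnorm (a n) * rho ^+ n <= B) /\
  forall w, rnorm w < rho -> forall e : R, 0 < e ->
    exists N, forall n, (N <= n)%N -> rnorm (f w - psum a n w) <= e.

Definition derive_coef a n : C := n.+1%:R * a n.+1.

Let pow2 n : (n%:R : R) <= 2 ^+ n.
Proof. by rewrite -natrX ler_nat ltnW // ltn_expl. Qed.

(** Two of the three factors [2^-n] absorb [n^2], since [n <= 2^n], and one is left for convergence:
    hence the radius [rho / 8]. *)
Let half_pow n : (n ^ 2)%:R * 8^-1 ^+ n <= 2^-1 ^+ n :> R.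
Proof.
have -> : (8^-1 : R) = 2^-1 * 2^-1 * 2^-1 by field.
have h : 0 <= (2^-1 : R) ^+ n by rewrite exprn_ge0 // invr_ge0.
have k : n%:R * 2^-1 ^+ n <= 1 :> R.
  by rewrite exprVn ler_pdivrMr ?exprn_gt0 // mul1r.
rewrite !exprMn mulrA -[X in _ <= X]mul1r ler_wpM2r // natrX.
have -> : n%:R ^+ 2 * (2^-1 ^+ n * 2^-1 ^+ n) = (n%:R * 2^-1 ^+ n) ^+ 2 :> R by ring.
by rewrite expr_le1 // mulr_ge0.
Qed.

(* The sharp radius is not needed: only the iterated derivatives at 0 are wanted. *)
Lemma power_series_derive f a (rho : R) : 0 < rho -> power_series f a rho ->
  power_series (derive1 f) (derive_coef a) (rho / 8).
Proof.
move=> rho0 [[B hB] hf]; set rho1 := rho / 8.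
have rho10 : 0 < rho1 by rewrite divr_gt0.
have rho1r : rho1 < rho by rewrite ltr_pdivrMr // ltr_pMr // ltr1n.
have B0 : 0 <= B by apply: le_trans (hB 0%N); rewrite mulr_ge0 ?rnorm_ge0.
have hB2 n : rnorm (a n) * ((n ^ 2)%:R * rho1 ^+ n) <= B * 2^-1 ^+ n.
  have -> : rnorm (a n) * ((n ^ 2)%:R * rho1 ^+ n) = (rnorm (a n) * rho ^+ n) * ((n ^ 2)%:R * 8^-1 ^+ n).
    by rewrite /rho1 exprMn; ring.
  by apply: ler_pM; rewrite ?mulr_ge0 ?rnorm_ge0 ?exprn_ge0 ?invr_ge0 ?(ltW rho0).
have hD n : rnorm (derive_coef a n) * rho1 ^+ n <= B / rho1 * 2^-1 ^+ n.
  rewrite mulrAC ler_pdivlMr //; apply: (@le_trans _ _ (B * 2^-1 ^+ n.+1)).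
    apply: le_trans (hB2 n.+1).
    have -> : rnorm (derive_coef a n) * rho1 ^+ n * rho1 = rnorm (a n.+1) * (n.+1%:R * rho1 ^+ n.+1).
      by rewrite /derive_coef rnormM rnorm_nat (exprSr rho1); ring.
    rewrite ler_wpM2l ?rnorm_ge0 // ler_wpM2r ?exprn_ge0 ?(ltW rho10) //.
    by rewrite ler_nat -mulnn leq_pmulr.
  by rewrite ler_wpM2l // exprS ler_piMl ?exprn_ge0 ?invr_ge0 // invf_le1 // ler1n.
split.
  exists (B / rho1) => n; apply: (le_trans (hD n)).
  apply: ler_piMr; first by rewrite divr_ge0 // ltW.
  by rewrite exprn_ile1 ?invr_ge0 // invf_le1 // ler1n.
move=> w w1.
have [g hg] : exists g, forall e : R, 0 < e -> exists N, forall n, (N <= n)%N ->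
    rnorm (g - psum (derive_coef a) n w) <= e.
  apply: complex_complete => e e0.
  apply: (@geometric_cauchy _ _ _ (B / rho1) 2^-1) => //.
  - by rewrite invr_ge0 ler0n invf_lt1 // ltr1n.
  - by rewrite divr_ge0 // ltW.
  move=> n; rewrite /psum big_ord_recr /= addrAC subrr add0r rnormM rnormX.
  apply: le_trans (hD n); rewrite ler_wpM2l ?rnorm_ge0 // lerXn2r ?nnegrE ?rnorm_ge0 ?(ltW rho10) //.
  exact: ltW.
(* A quadratic remainder bound, proved for partial sums and passed to the limit; it identifies [g]
   as the derivative. *)
have est w' : rnorm w' <= rho1 ->
    rho1 ^+ 2 * rnorm (f w' - f w - g * (w' - w)) <= 2 * B * rnorm (w' - w) ^+ 2.
  move=> w'1; set h := w' - w.
  (* The lengths differ by one because differentiating [n + 1] terms kills the constant one. *)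
  have fin n : rho1 ^+ 2 * rnorm (psum a n.+1 w' - psum a n.+1 w - psum (derive_coef a) n w * h) <=
      2 * B * rnorm h ^+ 2.
    have -> : psum (derive_coef a) n w = \sum_(i < n.+1) i%:R * a i * w ^+ i.-1.
      by rewrite big_ord_recl !mul0r add0r.
    rewrite /psum mulr_suml -!sumrB.
    have -> : \sum_(i < n.+1) (a i * w' ^+ i - a i * w ^+ i - i%:R * a i * w ^+ i.-1 * h) =
       \sum_(i < n.+1) a i * (w' ^+ i - w ^+ i - i%:R * w ^+ i.-1 * h).
      by apply: eq_bigr => i _; ring.
    apply: le_trans (ler_wpM2l (sqr_ge0 _) (rnorm_sum _ _ _)) _.
    have geo m : \sum_(i < m) 2^-1 ^+ i + 2 * 2^-1 ^+ m = 2 :> R.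
      elim: m => [|m IH]; first by rewrite big_ord0 expr0; ring.
      by rewrite big_ord_recr /= exprS -[RHS]IH; field.
    apply: (@le_trans _ _ (\sum_(i < n.+1) B * 2^-1 ^+ i * rnorm h ^+ 2)).
      rewrite mulr_sumr; apply: ler_sum => i _; rewrite rnormM mulrCA.
      apply: (@le_trans _ _ (rnorm (a i) * ((i ^ 2)%:R * rho1 ^+ i * rnorm h ^+ 2))).
        by rewrite ler_wpM2l ?rnorm_ge0 // expr_remainder // ltW.
      by rewrite mulrA ler_wpM2r ?sqr_ge0.
    rewrite -mulr_suml -mulr_sumr [2 * B]mulrC ler_wpM2r ?sqr_ge0 // ler_wpM2l //.
    rewrite -[X in _ <= X](geo n.+1) lerDl mulr_ge0 // exprn_ge0 // invr_ge0 //.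
  apply/ler_addgt0Pr => e e0.
  pose X := rho1 ^+ 2 * (2 + rnorm h).
  have X0 : 0 <= X by rewrite mulr_ge0 ?sqr_ge0 // addr_ge0 ?rnorm_ge0.
  have eX : 0 < e / (X + 1) by rewrite divr_gt0 // ltr_wpDl.
  have [N1 k1] := hf w' (le_lt_trans w'1 rho1r) _ eX.
  have [N2 k2] := hf w (lt_trans w1 rho1r) _ eX.
  have [N3 k3] := hg _ eX.
  pose n := maxn N1 (maxn N2 N3).
  have {}k1 := k1 n.+1 (leqW (leq_maxl _ _)).
  have {}k2 := k2 n.+1 (leqW (leq_trans (leq_maxl _ _) (leq_maxr _ _))).
  have {}k3 := k3 n (leq_trans (leq_maxr _ _) (leq_maxr _ _)).
  have -> : f w' - f w - g * h = (psum a n.+1 w' - psum a n.+1 w - psum (derive_coef a) n w * h) +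
     ((f w' - psum a n.+1 w') - (f w - psum a n.+1 w) - (g - psum (derive_coef a) n w) * h) by ring.
  apply: le_trans (ler_wpM2l (sqr_ge0 _) (rnormD _ _)) _; rewrite mulrDr; apply: lerD (fin n) _.
  apply: (@le_trans _ _ (rho1 ^+ 2 * (e / (X + 1) + e / (X + 1) + e / (X + 1) * rnorm h))).
    rewrite ler_wpM2l ?sqr_ge0 //; apply: le_trans (rnormB _ _) _; apply: lerD.
      by apply: le_trans (rnormB _ _) _; apply: lerD.
    by rewrite rnormM ler_wpM2r ?rnorm_ge0.
  have -> : rho1 ^+ 2 * (e / (X + 1) + e / (X + 1) + e / (X + 1) * rnorm h) = e * (X / (X + 1)).
    by rewrite /X; field; rewrite gt_eqF // ltr_wpDl.
  by rewrite ler_piMr ?(ltW e0) // ler_pdivrMr ?ltr_wpDl // mul1r lerDl.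
have dE : derive1 f w = g.
  apply: cvg_lim => //; apply/complex_cvgP => e e0; apply/dnbhs0P.
  exists (Num.min (rho1 - rnorm w) (e * rho1 ^+ 2 / (2 * B + 1))).
    rewrite lt_min subr_gt0 w1 /= divr_gt0 // ?mulr_gt0 // ?exprn_gt0 //.
    by rewrite ltr_wpDl // mulr_ge0.
  move=> h h0; rewrite lt_min => /andP[h1 h2].
  have nh : 0 < rnorm h by rewrite lt_neqAle eq_sym rnorm_eq0 h0 rnorm_ge0.
  have := est (h + w); rewrite addrK => /(_ _)/wrap[].
    by apply: le_trans (rnormD _ _) _; rewrite -lerBrDr ltW.
  have -> : g - h^-1 *: (f (h + w) - f w) = - h^-1 * (f (h + w) - f w - g * h).
    by rewrite /GRing.scale /=; field.
  rewrite rnormM rnormN rnormV; set x := rnorm (_ - _) => hx.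
  rewrite mulrC ler_pdivrMr // -(ler_pM2l (exprn_gt0 2 rho10)).
  apply: (le_trans hx).
  have -> : rho1 ^+ 2 * (e * rnorm h) = e * rho1 ^+ 2 * rnorm h by ring.
  have -> : 2 * B * rnorm h ^+ 2 = rnorm h * (2 * B) * rnorm h by ring.
  rewrite ler_wpM2r ?rnorm_ge0 //.
  rewrite ltr_pdivlMr in h2; last by rewrite ltr_wpDl // mulr_ge0.
  by apply: le_trans (ltW h2); rewrite ler_wpM2l ?rnorm_ge0 // lerDl.
by rewrite dE.
Qed.

Lemma power_series_derive1n n f a (rho : R) : 0 < rho -> power_series f a rho ->
  derive1n n f 0 = n`!%:R * a n.
Proof.
elim: n f a rho => [|n IH] f a rho rho0 hf.
  rewrite /= fact0 mul1r; apply/eqP; rewrite -subr_eq0 -rnorm_eq0 eq_le rnorm_ge0 andbT.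
  apply/ler_addgt0Pr => e e0; rewrite add0r.
  have [_ /(_ 0)] := hf; rewrite rnorm0 => /(_ rho0 e e0) [N /(_ N.+1 (leqnSn N))].
  rewrite /psum big_ord_recl expr0 mulr1 big1 ?addr0 // => i _.
  by rewrite exprS mul0r mulr0.
rewrite /derive1n iterSr; have := IH _ _ _ _ (power_series_derive rho0 hf).
rewrite /derive1n => ->; last by rewrite divr_gt0.
by rewrite /derive_coef mulrA -natrM mulnC factS.
Qed.

Lemma taylor_power_series f a (rho : R) n : 0 < rho -> power_series f a rho -> taylor f n = a n.
Proof.
move=> rho0 /(power_series_derive1n n rho0) E.
by rewrite /taylor E mulrC mulKf // pnatr_eq0 -lt0n fact_gt0.
Qed.

(** The radius from 0 to [z] is walked in [n] steps shorter than [d], each changing [f] by at most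
    1. *)
Lemma disk_algebra_bounded f : disk_algebra f ->
  exists2 M : R, 0 <= M & forall z : Co, rnorm z <= 1 -> rnorm (f z) <= M.
Proof.
move=> df; have [d d0 hd] := disk_algebra_uniform df ltr01.
pose n := (Num.trunc d^-1).+1.
have n0 : (0 : R) < n%:R by rewrite ltr0n.
have nd : n%:R^-1 < d.
  by rewrite -[d]invrK ltf_pV2 ?posrE ?invr_gt0 // truncnS_gt.
exists (n%:R + rnorm (f 0)); first by rewrite addr_ge0 ?rnorm_ge0.
move=> z z1.
pose p k : Co := (k%:R / n%:R : R)%:C * z.
have p1 k : (k <= n)%N -> rnorm (p k) <= 1.
  move=> kn; rewrite rnormM rnormR ger0_norm ?divr_ge0 //.
  apply: mulr_ile1; rewrite ?rnorm_ge0 ?divr_ge0 //.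
  by rewrite ler_pdivrMr // mul1r ler_nat.
have H k : (k <= n)%N -> rnorm (f (p k) - f 0) <= k%:R.
  elim: k => [|k IH] kn.
    by rewrite /p mul0r rmorph0 mul0r subrr rnorm0.
  apply: le_trans (rnorm_distD (f (p k)) _ _) _; rewrite -natr1 addrC.
  apply: lerD; first exact: IH (ltnW kn).
  apply: hd; [exact: p1|exact: p1 (ltnW kn)|].
  have -> : p k.+1 - p k = (n%:R^-1)%:C * z.
    rewrite /p -mulrBl -rmorphB -mulrBl -natr1; congr (_%:C * _).
    by rewrite addrC addKr mul1r.
  rewrite rnormM rnormR ger0_norm ?invr_ge0 //; apply: le_lt_trans nd.
  by rewrite ler_piMr ?invr_ge0.
have := H n (leqnn _); have -> : p n = z by rewrite /p divff ?gt_eqF // rmorph1 mul1r.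
by move=> h; apply: le_trans (rnorm_subD _ (f 0)) _; rewrite lerD2r.
Qed.

(** [taylor] is made of iterated derivatives, whereas the estimates concern [cauchy_coef]; the power
    series expansion identifies the two. *)
Lemma disk_algebra_taylor f (M r : R) : disk_algebra f -> 0 < r -> r < 1 ->
  (forall z : Co, rnorm z <= 1 -> rnorm (f z) <= M) ->
  (forall n, rnorm (taylor f n) <= 2 * M * r ^- n) /\
  forall w N, rnorm w < r -> rnorm (f w - psum (taylor f) N.+1 w) <=
    4 * M * (r / (r - rnorm w)) * (rnorm w / r) ^+ N.+1.
Proof.
move=> [hf _] r0 r1 hM.
have ho := holomorphic_disk_holo hf.
have hMr (z : C) : rnorm z <= r -> rnorm (f z) <= M.
  by move=> zr; apply: hM; apply: le_trans zr (ltW r1).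
have M0 : 0 <= M by apply: le_trans (hMr 0 _); rewrite ?rnorm_ge0 ?rnorm0 ?ltW.
have z0 : rnorm (0 : C) < r by rewrite rnorm0.
have cf : ccont (fun t => f (circ r t)).
  by apply: holo_ccont ho (ccont_circ r) _ => t; rewrite (rnorm_circ z0).
have hMc t : rnorm (f (circ r t)) <= M by apply: hMr; rewrite (rnorm_circ z0).
have cle n := cauchy_coef_le r0 n cf hMc.
have PS : power_series f (cauchy_coef r f) r.
  split.
    exists (2 * M) => n; rewrite -ler_pdivlMr ?exprn_gt0 //.
  move=> w wr e e0; set k := 4 * M * (r / (r - rnorm w)).
  have k0 : 0 <= k.
    rewrite /k mulr_ge0 //; first by rewrite mulr_ge0.
    by rewrite divr_ge0 ?(ltW r0) // subr_ge0 ltW.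
  have q01 : 0 <= rnorm w / r < 1.
    by rewrite divr_ge0 ?rnorm_ge0 ?(ltW r0) //= ltr_pdivrMr // mul1r.
  have [N hN] := expr_small q01 (divr_gt0 e0 (ltr_wpDl k0 ltr01)).
  exists N.+1 => -[//|n]; rewrite ltnS => Nn.
  have h : rnorm (f w - psum (cauchy_coef r f) n.+1 w) <= k * (rnorm w / r) ^+ n.+1.
    exact: cauchy_taylor.
  apply: (le_trans h).
  have /andP[q0 /ltW q1] := q01.
  have qn : (rnorm w / r) ^+ n.+1 <= e / (k + 1).
    apply: le_trans hN; rewrite -(subnKC (leqW Nn)) exprD ler_piMr ?exprn_ge0 //.
    by rewrite exprn_ile1.
  apply: le_trans (ler_wpM2l k0 qn) _.
  rewrite mulrC mulrAC ler_pdivrMr ?ltr_wpDl // ler_wpM2l ?(ltW e0) //.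
  by rewrite lerDl.
have E n : taylor f n = cauchy_coef r f n by exact: taylor_power_series r0 PS.
split=> [n|w N wr]; first by rewrite E.
have -> : psum (taylor f) N.+1 w = psum (cauchy_coef r f) N.+1 w.
  by apply: eq_bigr => i _; rewrite E.
exact: cauchy_taylor.
Qed.

End PowerSeries.

(** * The functional calculus *)

Section Calculus.
Context {R : realType} {H : completeNormedModType R[i]}.
Local Notation C := R[i].
Local Notation Co := (R[i]^o).
Variable dot : {dot H for @Num.conj C}.
Hypothesis hn : hilbert_norm dot.
Variable T : {linear H -> H}.
Hypothesis cT : forall x, rnorm (T x) <= rnorm x.
Variable f : Co -> Co.
Hypothesis df : disk_algebra f.

(** The Taylor coefficients of [f (r z)]. *)
Let dil (r : R) n : C := taylor f n * r%:C ^+ n.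

Lemma dilated_taylor_uniform (r e : R) : 0 < r -> r < 1 -> 0 < e ->
  exists N, forall n, (N <= n)%N -> forall z : C, rnorm z <= 1 ->
    rnorm (f (r%:C * z) - psum (dil r) n z) <= e.
Proof.
move=> r0 r1 e0; have [M M0 hM] := disk_algebra_bounded df.
(* Cauchy's estimates on a circle strictly between [r] and 1 give the ratio [r / rho < 1], uniformly
   on the closed disk. *)
pose rho := (1 + r) / 2.
have r_rho : r < rho by rewrite /rho; lra.
have rho1 : rho < 1 by rewrite /rho; lra.
have rho0 : 0 < rho by apply: lt_trans r_rho.
have [_ ht] := disk_algebra_taylor df rho0 rho1 hM.
pose k := 4 * M * (rho / (rho - r)).
have k0 : 0 <= k.
  rewrite /k mulr_ge0 //; first by rewrite mulr_ge0.
  by rewrite divr_ge0 ?(ltW rho0) // subr_ge0 ltW.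
have q01 : 0 <= r / rho < 1.
  by rewrite divr_ge0 ?(ltW r0) ?(ltW rho0) //= ltr_pdivrMr // mul1r.
have [N hN] := expr_small q01 (divr_gt0 e0 (ltr_wpDl k0 ltr01)).
exists N.+1 => -[//|n]; rewrite ltnS => Nn z z1.
have rz : rnorm (r%:C * z) <= r.
  by rewrite rnormM rnormR gtr0_norm // ler_piMr // ltW.
have -> : psum (dil r) n.+1 z = psum (taylor f) n.+1 (r%:C * z).
  by apply: eq_bigr => i _; rewrite exprMn mulrA.
have h : rnorm (f (r%:C * z) - psum (taylor f) n.+1 (r%:C * z)) <=
    4 * M * (rho / (rho - rnorm (r%:C * z))) * (rnorm (r%:C * z) / rho) ^+ n.+1.
  by apply: ht; apply: le_lt_trans rz r_rho.
apply: (le_trans h); apply: (@le_trans _ _ (k * (r / rho) ^+ n.+1)).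
  have s1 : 0 < rho - r by rewrite subr_gt0.
  have s2 : rho - r <= rho - rnorm (r%:C * z) by rewrite lerD2l lerN2.
  have s3 := lt_le_trans s1 s2.
  apply: ler_pM.
  - rewrite mulr_ge0 //; first by rewrite mulr_ge0.
    by rewrite divr_ge0 ?(ltW rho0) ?(ltW s3).
  - by rewrite exprn_ge0 // divr_ge0 ?rnorm_ge0 ?(ltW rho0).
  - by rewrite ler_wpM2l ?mulr_ge0 // ler_wpM2l ?(ltW rho0) // lef_pV2.
  - have q2 : 0 <= rnorm (r%:C * z) / rho by apply: divr_ge0; rewrite ?rnorm_ge0 // ltW.
    apply: lerXn2r; rewrite ?nnegrE //; first by case/andP: q01.
    by rewrite ler_wpM2r // invr_ge0 ltW.
have /andP[q0 /ltW q1] := q01.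
have qn : (r / rho) ^+ n.+1 <= e / (k + 1).
  apply: le_trans hN; rewrite -(subnKC (leqW Nn)) exprD ler_piMr ?exprn_ge0 //.
  by rewrite exprn_ile1.
apply: le_trans (ler_wpM2l k0 qn) _.
by rewrite mulrC mulrAC ler_pdivrMr ?ltr_wpDl // ler_wpM2l ?(ltW e0) // lerDl.
Qed.

Lemma radial_calculus_limit (r : R) x : 0 < r -> r < 1 -> forall e : R, 0 < e ->
  exists N, forall n, (N <= n)%N ->
    rnorm (radial_calculus T f r x - opsum T (dil r) n x) <= e.
Proof.
move=> r0 r1; have [M M0 hM] := disk_algebra_bounded df.
pose rho := (1 + r) / 2.
have r_rho : r < rho by rewrite /rho; lra.
have rho1 : rho < 1 by rewrite /rho; lra.
have rho0 : 0 < rho by apply: lt_trans r_rho.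
have [hc _] := disk_algebra_taylor df rho0 rho1 hM.
have [v hv] : exists v, forall e : R, 0 < e -> exists N, forall n, (N <= n)%N ->
    rnorm (v - opsum T (dil r) n x) <= e.
  apply: (@geometric_cvg _ _ _ (2 * M * rnorm x) (r / rho)).
  - by rewrite divr_ge0 ?(ltW r0) ?(ltW rho0) //= ltr_pdivrMr // mul1r.
  - by rewrite mulr_ge0 ?rnorm_ge0 // mulr_ge0.
  move=> n; rewrite /opsum big_ord_recr /= addrAC subrr add0r rnormZ.
  rewrite /dil rnormM rnormX rnormR gtr0_norm //.
  have -> : 2 * M * rnorm x * (r / rho) ^+ n = 2 * M * rho ^- n * r ^+ n * rnorm x.
    by rewrite exprMn exprVn; ring.
  rewrite ler_pM ?rnorm_ge0 ?rnorm_iter //; first by rewrite mulr_ge0 ?rnorm_ge0 ?exprn_ge0 ?(ltW r0).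
  by rewrite ler_wpM2r ?exprn_ge0 ?(ltW r0).
have -> : radial_calculus T f r x = v.
  apply: cvg_lim => //; apply/rnorm_cvgP => e e0; have [N hN] := hv e e0.
  by exists N => // n /= Nn; rewrite big_mkord; exact: hN.
exact: hv.
Qed.

(** Padding with zeros lets two polynomials of different lengths be subtracted, so that von
    Neumann's inequality applies to the difference. *)
Lemma psum_pad (c : nat -> C) d n z : (d <= n)%N ->
  psum (fun i => if (i < d)%N then c i else 0) n z = psum c d z.
Proof.
move=> dn; rewrite /psum (big_ord_widen n (fun i => c i * z ^+ i) dn) [RHS]big_mkcond.
by apply: eq_bigr => i _; case: ifP => // _; rewrite mul0r.
Qed.

Lemma opsum_pad (c : nat -> C) d n x : (d <= n)%N ->
  opsum T (fun i => if (i < d)%N then c i else 0) n x = opsum T c d x.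
Proof.
move=> dn; rewrite /opsum (big_ord_widen n (fun i => c i *: iter i T x) dn) [RHS]big_mkcond.
by apply: eq_bigr => i _; case: ifP => // _; rewrite scale0r.
Qed.

(** One polynomial, a truncation for [f (s z)] with [s] near 1, serves for all [r] near 1 and all
    [x]. The comparison is made between functions on the disk and transferred to operators by von
    Neumann's inequality. *)
Lemma radial_approx (e : R) : 0 < e -> exists (c : nat -> C) (d : nat) (del : R),
  [/\ 0 < del,
      forall z : Co, rnorm z <= 1 -> rnorm (f z - psum c d z) <= e &
      forall r, 0 < r -> r < 1 -> 1 - del < r ->
        forall x, rnorm (radial_calculus T f r x - opsum T c d x) <= e * rnorm x].
Proof.
move=> e0; have e4 : 0 < e / 4 by rewrite divr_gt0.
have [del0 del00 hdel] := disk_algebra_uniform df e4.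
pose del := Num.min del0 1; have del_gt0 : 0 < del by rewrite lt_min del00 ltr01.
have del1 : del <= 1 by rewrite ge_min lexx orbT.
have del_le : del <= del0 by rewrite ge_min lexx.
pose s := 1 - del / 2.
have s0 : 0 < s by rewrite /s; lra.
have s1 : s < 1 by rewrite /s; lra.
have in_disk (r : R) (z : C) : 0 < r -> r < 1 -> rnorm z <= 1 -> rnorm (r%:C * z) <= 1.
  by move=> r0 r1 z1; rewrite rnormM rnormR gtr0_norm // mulr_ile1 ?rnorm_ge0 // ltW.
have close (r r' : R) (z : C) : 0 < r <= 1 -> 0 < r' <= 1 -> 1 - del < r -> 1 - del < r' -> rnorm z <= 1 ->
    rnorm (f (r%:C * z) - f (r'%:C * z)) <= e / 4.
  move=> /andP[r0 r1] /andP[r'0 r'1] dr dr' z1; apply: hdel.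
  - by rewrite rnormM rnormR gtr0_norm // mulr_ile1 ?rnorm_ge0 // ltW.
  - by rewrite rnormM rnormR gtr0_norm // mulr_ile1 ?rnorm_ge0 // ltW.
  rewrite -mulrBl -rmorphB rnormM rnormR.
  apply: (@le_lt_trans _ _ `|r - r'|); first by rewrite ler_piMr.
  by apply: lt_le_trans del_le; rewrite ltr_norml; apply/andP; split; lra.
have sdel : 1 - del < s by rewrite /s; lra.
have s01 : 0 < s <= 1 by rewrite s0 ltW.
have [d hd] := dilated_taylor_uniform s0 s1 e4.
exists (dil s), d, del; split => //.
  move=> z z1; apply: le_trans (rnorm_distD (f (s%:C * z)) _ _) _.
  have h1 : rnorm (f z - f (s%:C * z)) <= e / 4.
    have := close 1 s z; rewrite rmorph1 mul1r; apply => //; first by rewrite ltr01 lexx.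
    by rewrite gtrBl.
  have h2 := hd d (leqnn d) z z1.
  by apply: (le_trans (lerD h1 h2)); lra.
move=> r r0 r1 rdel x.
have [N hN] := dilated_taylor_uniform r0 r1 e4.
(* Von Neumann's inequality is available for polynomials only; [e'] pays for truncating the
   series. *)
apply/ler_addgt0Pr => e' e'0.
have [N' hN'] := radial_calculus_limit x r0 r1 e'0.
pose n := maxn d (maxn N N').
have dn : (d <= n)%N := leq_maxl _ _.
have Nn : (N <= n)%N := leq_trans (leq_maxl _ _) (leq_maxr _ _).
have N'n : (N' <= n)%N := leq_trans (leq_maxr _ _) (leq_maxr _ _).
apply: le_trans (rnorm_distD (opsum T (dil r) n x) _ _) _.
rewrite addrC; apply: lerD; last exact: hN'.
rewrite -(opsum_pad (dil s) x dn) /opsum -sumrB.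
under eq_bigr do rewrite -scalerBl.
pose c i := dil r i - (if (i < d)%N then dil s i else 0).
apply: (vonNeumann hn (linearP T) cT (c := c)); first exact: ltW.
move=> z z1.
have z1' : rnorm z <= 1 by rewrite z1.
have -> : psum c n z = psum (dil r) n z - psum (dil s) d z.
  by rewrite -(psum_pad (dil s) z dn) /psum -sumrB; apply: eq_bigr => i _; rewrite mulrBl.
have h1 := hN n Nn z z1'; have h2 := hd d (leqnn d) z z1'.
have h3 : rnorm (f (r%:C * z) - f (s%:C * z)) <= e / 4.
  by apply: close => //; rewrite r0 ltW.
have E : psum (dil r) n z - psum (dil s) d z = - (f (r%:C * z) - psum (dil r) n z) +
   (f (r%:C * z) - f (s%:C * z)) + (f (s%:C * z) - psum (dil s) d z) by ring.
rewrite E; apply: le_trans (rnormD _ _) _.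
have h4 : rnorm (- (f (r%:C * z) - psum (dil r) n z) + (f (r%:C * z) - f (s%:C * z))) <= e / 4 + e / 4.
  by apply: le_trans (rnormD _ _) _; rewrite rnormN; apply: lerD.
by apply: (le_trans (lerD h4 h2)); lra.
Qed.

Lemma Hinfty_calculus_approx (e : R) : 0 < e -> exists (c : nat -> C) (d : nat),
  (forall z : Co, rnorm z <= 1 -> rnorm (f z - psum c d z) <= e) /\
  (forall x, rnorm (Hinfty_calculus T f x - opsum T c d x) <= e * rnorm x).
Proof.
move=> e0; have [c [d [del [del0 h1 h2]]]] := radial_approx e0.
exists c, d; split => // x.
have FF : ProperFilter ((1 : R)^'-) by exact: at_left_proper_filter.
have nearr (t : R) : 0 < t -> \forall r \near (1 : R)^'-, [/\ 0 < r, r < 1 & 1 - t < r].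
  move=> t0; near=> r; split.
  - by near: r; apply: nbhs_left_gt.
  - by near: r; apply: nbhs_left_lt.
  - by near: r; apply: nbhs_left_gt; rewrite gtrBl.
(* Applied with all tolerances, the approximation gives a Cauchy condition, so the [lim] in
   [Hinfty_calculus] is a genuine limit. *)
have cv : cvg (radial_calculus T f r x @[r --> (1 : R)^'-]).
  apply/cauchy_cvgP/cauchy_exP => g g0.
  have gE : g = (complex.Re g)%:C by rewrite RRe_real // gtr0_real.
  rewrite gE ltcR in g0.
  have k0 : 0 < complex.Re g / (rnorm x + 1) by rewrite divr_gt0 // ltr_wpDl ?rnorm_ge0.
  have [c' [d' [t [t0 _ ht]]]] := radial_approx k0.
  exists (opsum T c' d' x); apply: filterS (nearr _ t0) => r [r0 r1 tr].
  rewrite gE; apply/rnorm_ball; rewrite rnorm_distC; apply: le_lt_trans (ht r r0 r1 tr x) _.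
  by rewrite mulrAC ltr_pdivrMr ?ltr_wpDl ?rnorm_ge0 // ltr_pM2l // ltrDl.
have := cv; rewrite -/(Hinfty_calculus T f x) => /rnorm_cvgP hl.
apply/ler_addgt0Pr => g g0.
have [r [hr [r0 r1 dr]]] := filter_ex (filterI (hl g g0) (nearr _ del0)).
apply: le_trans (rnorm_distD (radial_calculus T f r x) _ _) _.
by rewrite addrC; apply: lerD => //; exact: h2.
Unshelve. all: by end_near. Qed.

End Calculus.

(** * The two implications *)

Section CompactCalculus.
Context {R : realType} {H : completeNormedModType R[i]}.
Local Notation C := R[i].
Local Notation Co := (R[i]^o).
Variable dot : {dot H for @Num.conj C}.
Hypothesis hn : hilbert_norm dot.
Variable T : {linear H -> H}.
Hypothesis cT : forall x, rnorm (T x) <= rnorm x.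
Variable f : Co -> Co.
Hypothesis df : disk_algebra f.

Lemma totally_bounded_comp (K L : H -> H) (D : R) : 0 < D -> linear K -> linear L ->
  (forall x, rnorm (L x) <= D * rnorm x) ->
  totally_bounded_operator K -> totally_bounded_operator (K \o L).
Proof.
move=> D0 lK lL hL tK e e0.
have [n [col hcol]] := tK _ (divr_gt0 e0 D0).
(* [L x] is scaled back into the unit ball, where the colouring of [K] is meaningful. *)
exists n, (fun x => col (D^-1%:C *: L x)) => x y x1 y1 E.
have KZ a u : K (a *: u) = a *: K u.
  have K0 : K 0 = 0 by have := lK (-1) 0 0; rewrite scaler0 addr0 scaleN1r addNr.
  by have := lK a u 0; rewrite K0 !addr0.
have sc u : rnorm u <= 1 -> rnorm (D^-1%:C *: L u) <= 1.
  move=> u1; rewrite rnormZ rnormR ger0_norm ?invr_ge0 ?(ltW D0) // mulrC ler_pdivrMr // mul1r.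
  by apply: le_trans (hL u) _; rewrite ler_piMr // ltW.
have := hcol _ _ (sc x x1) (sc y y1) E.
rewrite !KZ -scalerBr rnormZ rnormR ger0_norm ?invr_ge0 ?(ltW D0) //.
by rewrite mulrC ler_pM2r // invr_gt0.
Qed.

Lemma compact_calculus :
  compact_operator (fun x => x - adjoint dot T (T x)) ->
  (forall z : Co, (spectrum T `&` unit_circle) z -> f z = 0) ->
  compact_operator (Hinfty_calculus T f).
Proof.
move=> cK hf; apply: totally_bounded_compact => e e0.
have [M M0 hM] := disk_algebra_bounded df.
(* Error budget: [e / 16] for each of the two approximations of the calculus and [e / 2] for the
   polynomial at [x - y]. The bound [e / 8] for the polynomial is [e / 16] from [f] plus [e / 16]
   from the approximation. *)
have e16 : 0 < e / 16 by rewrite divr_gt0.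
have e8 : 0 <= e / 8 by rewrite divr_ge0 // ltW.
have [k k0 hk] := circle_resolvent_bound df e16 hf.
have [c [d [hp hF]]] := Hinfty_calculus_approx hn cT df e16.
have linT : linear T := linearP T.
have hB (z : C) : rnorm z = 1 -> rnorm (psum c d z) <= M + e / 16.
  move=> z1; have zle : rnorm z <= 1 by rewrite z1.
  apply: le_trans (rnorm_subD _ (f z)) _; rewrite addrC; apply: lerD; first exact: hM.
  by rewrite rnorm_distC; exact: hp.
have hgood (z : C) : rnorm z = 1 -> rnorm (psum c d z) <= e / 8 \/
    forall x, k * rnorm x <= rnorm (T x - z *: x).
  move=> z1; have zle : rnorm z <= 1 by rewrite z1.
  have [fz|h] := hk z z1; [left|by right].
  apply: le_trans (rnorm_subD _ (f z)) _.
  have h : rnorm (psum c d z - f z) <= e / 16 by rewrite rnorm_distC; exact: hp.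
  by apply: (le_trans (lerD h fz)); lra.
have lK := defect_operator_linear hn linT cT.
have B0 : 0 <= M + e / 16 by rewrite addr_ge0 // ltW.
have e64 : 0 < e ^+ 2 / 64 by rewrite divr_gt0 // exprn_gt0.
have [n [L [D [D0 lL bL hes]]]] :=
  opsum_essential hn linT cT (defect_le_operator hn linT cT) B0 e8 k0 e64 hB hgood.
have tK (j : 'I_n) := totally_bounded_comp D0 lK (lL j) (bL j) (compact_totally_bounded cK).
have q0 : 0 < 2 * D * n%:R + 1 by rewrite ltr_wpDl // mulr_ge0 // mulr_ge0 // ltW.
have e3 : 0 < e ^+ 2 / 8 / (2 * D * n%:R + 1).
  by rewrite !divr_gt0 // exprn_gt0.
have [m [col hcol]] := totally_bounded_family tK e3.
exists m, col => x y x1 y1 /(hcol x y x1 y1) hxy.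
have KB j : rnorm (defect_operator dot T (L j (x - y))) <= e ^+ 2 / 8 / (2 * D * n%:R + 1).
  have -> : defect_operator dot T (L j (x - y)) =
     defect_operator dot T (L j x) - defect_operator dot T (L j y); last exact: hxy.
  have E1 : x - y = (-1) *: y + x by rewrite scaleN1r addrC.
  by rewrite E1 lL lK scaleN1r addrC.
have v2 : rnorm (x - y) <= 2.
  by apply: le_trans (rnormB _ _) _; exact: lerD x1 y1.
have v0 := rnorm_ge0 (x - y).
have hS : \sum_(j < n) rnorm (defect_operator dot T (L j (x - y))) <=
    n%:R * (e ^+ 2 / 8 / (2 * D * n%:R + 1)).
  apply: le_trans (ler_sum _ (fun j _ => KB j)) _.
  by rewrite sumr_const card_ord -[X in X <= _]mulr_natl.
have hpv : rnorm (opsum T c d (x - y)) <= e / 2.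
  (* Since [|x - y|^2 <= 4], the first term is at most [4 * (e^2 / 64 + e^2 / 64) = e^2 / 8]; the
     tolerance of the colouring gives another [e^2 / 8], in total [(e / 2)^2]. *)
  rewrite -ler_sqr ?nnegrE ?rnorm_ge0 ?divr_ge0 ?(ltW e0) //.
  apply: le_trans (hes _) _.
  have sq : rnorm (x - y) ^+ 2 <= 4.
    by apply: (@le_trans _ _ (2 ^+ 2)); rewrite ?lerXn2r ?nnegrE // -natrX.
  have t1 : ((e / 8) ^+ 2 + e ^+ 2 / 64) * rnorm (x - y) ^+ 2 <= ((e / 8) ^+ 2 + e ^+ 2 / 64) * 4.
    by rewrite ler_wpM2l // addr_ge0 ?sqr_ge0 // ltW.
  have t2 : D * rnorm (x - y) * \sum_(j < n) rnorm (defect_operator dot T (L j (x - y))) <=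
     D * 2 * (n%:R * (e ^+ 2 / 8 / (2 * D * n%:R + 1))).
    apply: ler_pM => //; first by rewrite mulr_ge0 // ltW.
      by apply: sumr_ge0 => j _; exact: rnorm_ge0.
    by rewrite ler_wpM2l // ltW.
  have t3 : D * 2 * (n%:R * (e ^+ 2 / 8 / (2 * D * n%:R + 1))) <= e ^+ 2 / 8.
    have -> : D * 2 * (n%:R * (e ^+ 2 / 8 / (2 * D * n%:R + 1))) =
       e ^+ 2 / 8 * ((2 * D * n%:R) / (2 * D * n%:R + 1)).
      by field; rewrite gt_eqF.
    apply: ler_piMr; first by rewrite divr_ge0 ?sqr_ge0.
    by rewrite ler_pdivrMr // mul1r lerDl.
  apply: (le_trans (lerD t1 (le_trans t2 t3))).
  have -> : (e / 2) ^+ 2 = ((e / 8) ^+ 2 + e ^+ 2 / 64) * 4 + e ^+ 2 / 8 by field.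
  exact: lexx.
have E : Hinfty_calculus T f x - Hinfty_calculus T f y =
  (Hinfty_calculus T f x - opsum T c d x) + opsum T c d (x - y) -
  (Hinfty_calculus T f y - opsum T c d y).
  have -> : opsum T c d (x - y) = opsum T c d x - opsum T c d y.
    rewrite /opsum -sumrB; apply: eq_bigr => i _.
    have E1 : x - y = (-1) *: y + x by rewrite scaleN1r addrC.
    by rewrite E1 (iter_linear linT) scaleN1r addrC scalerBr.
  by rewrite subrKA opprB subrKA.
have a1 : rnorm (Hinfty_calculus T f x - opsum T c d x) <= e / 16.
  by apply: le_trans (hF x) _; rewrite ler_piMr // ltW.
have a2 : rnorm (Hinfty_calculus T f y - opsum T c d y) <= e / 16.
  by apply: le_trans (hF y) _; rewrite ler_piMr // ltW.
rewrite E; apply: le_trans (rnormB _ _) _.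
apply: (le_trans (lerD (le_trans (rnormD _ _) (lerD a1 hpv)) a2)); lra.
Qed.

Lemma spectrum_circle_approximate_eigen (z : C) : rnorm z = 1 -> spectrum T z ->
  forall k : R, 0 < k -> exists x, rnorm x = 1 /\ rnorm (T x - z *: x) < k.
Proof.
move=> z1 sz k k0; apply: contrapT => hno.
apply: sz; apply: (bounded_below_invertible cT z1 k0) => x; rewrite leNgt; apply/negP => hx.
have x0 : 0 < rnorm x.
  rewrite lt_neqAle rnorm_ge0 eq_sym andbT; apply/negP => /eqP x0.
  by move: hx; rewrite x0 mulr0 ltNge rnorm_ge0.
apply: hno; exists ((rnorm x)^-1%:C *: x).
rewrite rnormZ rnormR ger0_norm ?invr_ge0 ?(ltW x0) // mulVf ?gt_eqF //; split=> //.
rewrite linearZ /= scalerA [z * _]mulrC -scalerA -scalerBr rnormZ rnormR.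
by rewrite ger0_norm ?invr_ge0 ?(ltW x0) // mulrC ltr_pdivrMr.
Qed.

Lemma calculus_approximate_eigen (z : C) (e : R) : rnorm z = 1 -> 0 < e ->
  exists2 k : R, 0 < k & forall x, rnorm x = 1 -> rnorm (T x - z *: x) <= k ->
    rnorm (Hinfty_calculus T f x - f z *: x) <= e.
Proof.
move=> z1 e0; have e3 : 0 < e / 3 by rewrite divr_gt0.
have [c [d [hp hF]]] := Hinfty_calculus_approx hn cT df e3.
pose S := \sum_(i < d) rnorm (c i) * i%:R.
have S0 : 0 <= S by apply: sumr_ge0 => i _; rewrite mulr_ge0 ?rnorm_ge0.
exists (e / 3 / (S + 1)); first by rewrite !divr_gt0 // ltr_wpDl.
move=> x x1 hx; set k := e / 3 / (S + 1) in hx.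
(* The eigenvalue error grows linearly in the power, because [T] is a contraction and [|z| = 1]. *)
have iterk i : rnorm (iter i T x - z ^+ i *: x) <= i%:R * k.
  elim: i => [|i IH]; first by rewrite /= expr0 scale1r subrr rnorm0 mul0r.
  have -> : iter i.+1 T x - z ^+ i.+1 *: x = T (iter i T x - z ^+ i *: x) + z ^+ i *: (T x - z *: x).
    by rewrite [T (_ - _)]linearB [T (_ *: _)]linearZ /= scalerBr subrKA scalerA -exprSr.
  apply: le_trans (rnormD _ _) _; rewrite -natr1 mulrDl mul1r.
  apply: lerD; first exact: le_trans (cT _) IH.
  by rewrite rnormZ rnormX z1 expr1n mul1r.
have k0 : 0 <= k by rewrite !divr_ge0 ?(ltW e0) // addr_ge0.
have hpx : rnorm (opsum T c d x - psum c d z *: x) <= e / 3.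
  apply: (@le_trans _ _ (S * k)).
    rewrite /opsum /psum scaler_suml -sumrB mulr_suml; apply: le_trans (rnorm_sum _ _ _) _.
    apply: ler_sum => i _; rewrite -scalerA -scalerBr rnormZ -mulrA.
    by rewrite ler_wpM2l ?rnorm_ge0.
  have -> : S * k = e / 3 * (S / (S + 1)) by rewrite /k; field; rewrite gt_eqF // ltr_wpDl.
  apply: ler_piMr; first exact: ltW.
  by rewrite ler_pdivrMr ?ltr_wpDl // mul1r lerDl.
have h1 : rnorm (Hinfty_calculus T f x - opsum T c d x) <= e / 3.
  by have := hF x; rewrite x1 mulr1.
have h2 : rnorm (psum c d z *: x - f z *: x) <= e / 3.
  rewrite -scalerBl rnormZ x1 mulr1 rnorm_distC; apply: hp.
  by rewrite z1.
apply: le_trans (rnorm_distD (opsum T c d x) _ _) _.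
apply: (le_trans (lerD h1 (rnorm_distD (psum c d z *: x) _ _))).
by apply: (le_trans (lerD (lexx _) (lerD hpx h2))); lra.
Qed.

Lemma compact_calculus_vanish (z : C) : completely_nonunitary dot T ->
  compact_operator (Hinfty_calculus T f) -> rnorm z = 1 -> spectrum T z -> f z = 0.
Proof.
move=> cnu; rewrite /compact_operator precompactE => cF z1 sz.
apply/eqP/negPn/negP => fz0.
set a := f z in fz0.
have phi0 : 0 < rnorm a by rewrite lt_neqAle rnorm_ge0 eq_sym rnorm_eq0 fz0.
have [x hx] : exists x : nat -> H, forall n, rnorm (x n) = 1 /\ rnorm (T (x n) - z *: x n) < n.+1%:R^-1.
  have ex n : exists v : H, rnorm v = 1 /\ rnorm (T v - z *: v) < n.+1%:R^-1.
    by apply: spectrum_circle_approximate_eigen => //; rewrite invr_gt0.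
  by have [x hx] := choice ex; exists x.
pose u n := Hinfty_calculus T f (x n).
(* A cluster point of the images [f(T) x_n], from compactness of the closure. *)
have [|y [_ hy]] := cF (u @ \oo) _.
  exists 0%N => // n _ /=; apply: subset_closure; exists (x n) => //=.
  by rewrite rnormE (hx n).1 rmorph1.
have near_y (e : R) : 0 < e -> exists n, [/\ rnorm (y - u n) < e, rnorm (u n - a *: x n) <= e &
    rnorm (T (x n) - z *: x n) <= e].
  move=> e0; have [k k0 hk] := calculus_approximate_eigen z1 e0.
  have ke : 0 < Num.min k e by rewrite lt_min k0 e0.
  have [N hN] := harmonic_small ke.
  have [|_ [[n /= Nn <-] yn]] := hy [set u n | n in [set n | (N <= n)%N]] _ _ (nbhs_rnorm y e0).
    by exists N => // n /= Nn; exists n.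
  have := le_trans (ltW (hx n).2) (hN n Nn); rewrite le_min => /andP[h1 h2].
  by exists n; split => //; apply: hk => //; exact: (hx n).1.
have y0 : y = 0.
  apply: (completely_nonunitary_eigen hn cT cnu z1).
  apply/eqP; rewrite -subr_eq0 -rnorm_eq0 eq_le rnorm_ge0 andbT.
  apply/ler_addgt0Pr => e e0; rewrite add0r.
  (* [T - z] has norm at most 2, so the three terms below cost 2, 2 and [|a|] times the
     tolerance. *)
  have q0 : 0 < 4 + rnorm a by rewrite addr_gt0.
  have [n [h1 h2 h3]] := near_y _ (divr_gt0 e0 q0).
  set e' := e / _ in h1 h2 h3.
  have gen v : rnorm (T v - z *: v) <= 2 * rnorm v.
    apply: le_trans (rnormB _ _) _; rewrite rnormZ z1 mul1r mulr_natl mulr2n.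
    by rewrite lerD2r.
  have -> : T y - z *: y = (T (y - u n) - z *: (y - u n)) +
      ((T (u n - a *: x n) - z *: (u n - a *: x n)) + a *: (T (x n) - z *: x n)).
    have LB v w : (T (v - w) - z *: (v - w)) = (T v - z *: v) - (T w - z *: w).
      by rewrite linearB scalerBr !opprB addrACA [in RHS]addrACA [- (z *: v) + _]addrC.
    have LZ : a *: (T (x n) - z *: x n) = T (a *: x n) - z *: (a *: x n).
      by rewrite [T (a *: _)]linearZ /= scalerBr !scalerA mulrC.
    by rewrite !LB LZ !subrK.
  have E : e = 2 * e' + (2 * e' + rnorm a * e').
    by rewrite /e'; field; rewrite gt_eqF.
  rewrite [leRHS]E; apply: le_trans (rnormD _ _) _; apply: lerD.
    by apply: le_trans (gen _) _; rewrite ler_wpM2l // ltW.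
  apply: le_trans (rnormD _ _) _; apply: lerD.
    by apply: le_trans (gen _) _; rewrite ler_wpM2l.
  by rewrite rnormZ ler_wpM2l ?rnorm_ge0.
(* Now [u n] is close to 0 and to [a x_n], both within [|a| / 4], while [|a x_n| = |a|]. *)
have [n [h1 h2 _]] := near_y _ (divr_gt0 phi0 (ltr0Sn R 3)).
have h4 : rnorm a <= rnorm (u n - a *: x n) + rnorm (u n).
  have -> : rnorm a = rnorm (a *: x n) by rewrite rnormZ (hx n).1 mulr1.
  by rewrite rnorm_distC; exact: rnorm_subD.
have h5 : rnorm (u n) < rnorm a / 4 by rewrite -[u n]opprK rnormN -[- u n]add0r -y0.
by move: h2 h4 h5 phi0; move: (rnorm _) (rnorm a) (rnorm _) => *; lra.
Qed.

End CompactCalculus.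

Theorem theorem2p1 (R : realType) (H : completeNormedModType R[i])
    (dot : {dot H for @Num.conj R[i]}) (T : {linear H -> H})
    (f : R[i]^o -> R[i]^o) :
  hilbert_norm dot ->
  separable_space H ->
  continuous T ->
  essentially_unitary dot T ->
  C0_contraction dot T ->
  disk_algebra f ->
  compact_operator (Hinfty_calculus T f) <->
  (forall z, (spectrum T `&` unit_circle) z -> f z = 0).
Proof.
move=> hn _ _ [/contraction_rnorm cT cK] [_ cnu _] df; split=> [cF z [sz]|hf].
  rewrite /unit_circle /= rnormE -(rmorph1 (real_complex R)) => /complexI z1.
  exact: (compact_calculus_vanish hn cT df cnu cF z1 sz).
exact: (compact_calculus hn cT df cK hf).
Qed.
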